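(* Suppose that Assumption 1, Assumption 2 (with $p^*=1$ and $q^*=2$) and Assumption 4 (all written out in the context) hold, and that $\mu=0$, where $\mu=\int_0^\infty\int_{-\infty}^\infty xy\,\nu(\mathrm dx,\mathrm dy)$. Then, for any intermediate sequence $k=k_n$, as $n\to\infty$: $\dfrac{b(n/k)(\hat\rho-\rho)}{a\circ b(n/k)}$ converges weakly to $0$; $\dfrac{\check a(X_{(n:n-k)})}{a\circ b(n/k)}$ converges weakly to $1$; and $\check\Psi$ is a consistent estimator of $\Psi$. If moreover $a(x)=o(x)$ as $x\to\infty$, then $\hat\rho$ converges weakly to $\rho$.
   Context: Let $(X,Y)$ be a bivariate random vector and $(X_1,Y_1),\dots,(X_n,Y_n)$ i.i.d. copies of it. Let $\gamma\ge 0$, with the conventions $1/\gamma=+\infty$, $-1/\gamma=-\infty$ when $\gamma=0$. If $\gamma=0$, the right endpoint of the distribution of $X$ is assumed infinite. Assumption 1. There exist $\gamma\ge0$ and monotone functions $a,b,m,\psi$ (with $a,\psi$ positive) such that the marginal distribution of $X$ is in the domain of attraction of the extreme value distribution with index $\gamma$, and the measures $\nu_n(\cdot)=n\,\mathbb P\big(\big(\frac{X-b(n)}{\psi\circ b(n)},\frac{Y-m\circ b(n)}{a\circ b(n)}\big)\in\cdot\big)$ converge vaguely on $(-1/\gamma,\infty]\times[-\infty,\infty]$ to a Radon measure $\nu$ such that $\nu([0,\infty)\times(-\infty,\infty))=1$, the distribution function $y\mapsto\nu([0,\infty)\times(-\infty,y])$ is non degenerate, and $(x,y)\mapsto\nu([x,\infty)\times(-\infty,y])$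 is continuous on $(-1/\gamma,\infty]\times[-\infty,\infty]$. The function $b$ is chosen as $b=(1/(1-F_X))^{\leftarrow}$ (generalized inverse), $F_X$ being the distribution function of $X$. Assumption 2. There exist $p^*>0$, $q^*>0$ such that for any $\epsilon\in(0,1/\gamma)$, $\lim_{n\to\infty}\int_{-\epsilon}^\infty\int_{-\infty}^\infty|x|^{p^*}|y|^{q^*}\nu_n(\mathrm dx,\mathrm dy)=\int_{-\epsilon}^\infty\int_{-\infty}^\infty|x|^{p^*}|y|^{q^*}\nu(\mathrm dx,\mathrm dy)$. Assumption 4. The function $\psi$ is an auxiliary function satisfying $\lim_{x\to\infty}\psi(x)/x=0$ (so that $\gamma=0$ and $\psi(x+\psi(x)u)/\psi(x)\to1$ as $x\to\infty$), there exists $\rho\in\mathbb R$ such that $m(x)=\rho x$, and $\nu([x,\infty]\times(-\infty,y])=\mathrm e^{-x}\Psi(y)$, where $\Psi$ is a distribution function on $\mathbb R$. Standing normalization (fixing the scale of $a$ and $\nu$): $\int_{-\infty}^\infty y^2\,\Psi(\mathrm dy)=1$. $X_{(n:1)}\le\dots\le X_{(n:n)}$ are the order statistics of $X_1,\dots,X_n$ and $Y_{[n:i]}$ is the $Y$-variable (concomitant) corresponding to $X_{(n:i)}$. An intermediate sequence is a sequence of integers $k=k_n$ with $k_n\to\infty$ and $n/k_n\to\infty$. The estimators are $$\hat\rho=\frac{\sum_{i=1}^kY_{[n:n-i+1]}\{X_{(n:n-i+1)}-X_{(n:n-k)}\}}{\sum_{i=1}^kX_{(n:n-i+1)}\{X_{(n:n-i+1)}-X_{(n:n-k)}\}},\qquad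 \check a(X_{(n:n-k)})=\Big[\frac1k\sum_{i=1}^k\{Y_{[n:n-i+1]}-\hat\rho X_{(n:n-i+1)}\}^2\Big]^{1/2},$$ $$\check\Psi(z)=\frac1k\sum_{i=1}^k\mathbf 1_{\{Y_{[n:n-i+1]}\le\hat\rho X_{(n:n-i+1)}+\check a(X_{(n:n-k)})z\}}.$$ Weak convergence to a constant is convergence in probability. *)

(* Defs.v *)
From HB Require Import structures.
From mathcomp Require Import all_boot all_order all_algebra finmap.
From mathcomp Require Import all_classical all_reals all_analysis measurable_realfun.

Set Implicit Arguments.
Unset Strict Implicit.
Unset Printing Implicit Defensive.

Import Order.TTheory GRing.Theory Num.Theory.
Import numFieldNormedType.Exports.

Local Open Scope classical_set_scope.
Local Open Scope ring_scope.

Section sampling.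
Context d (T : measurableType d) (R : realType) (P : probability T R).

Definition same_law (X Y X' Y' : {RV P >-> R}) : Prop :=
  forall A : set (R * R), measurable A ->
    P [set w | A (X' w, Y' w)] = P [set w | A (X w, Y w)].

Definition independent_pairs (Xs Ys : nat -> {RV P >-> R}) : Prop :=
  forall (J : {fset nat}) (A : nat -> set (R * R)),
    (forall j, measurable (A j)) ->
    P [set w | forall j, j \in J -> A j (Xs j w, Ys j w)] =
    (\prod_(j <- J) P [set w | A j (Xs j w, Ys j w)])%E.

Definition iid_copies (X Y : {RV P >-> R}) (Xs Ys : nat -> {RV P >-> R}) :=
  (forall i, same_law X Y (Xs i) (Ys i)) /\ independent_pairs Xs Ys.

Definition cvg_in_prob (Z : nat -> T -> R) (c : R) : Prop :=
  forall eps : R, 0 < eps ->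
    P [set w | eps <= `|Z n w - c|] @[n --> \oo] --> 0%E.

Definition dfun (X : {RV P >-> R}) (x : R) : R := fine (cdf X x).

Definition intermediate (k : nat -> nat) : Prop :=
  k n @[n --> \oo] --> \oo /\
  (n%:R / (k n)%:R : R) @[n --> \oo] --> +oo.

End sampling.

Section extremes.
Context d (T : measurableType d) (R : realType) (P : probability T R).
Implicit Types (X Y : {RV P >-> R}) (gamma : R) (a b m psi : R -> R).

(* For gamma >= 0 only: below its lower endpoint the distribution
   function vanishes. *)
Definition gev gamma (x : R) : R :=
  if gamma == 0 then expR (- expR (- x))
  else if 0 < 1 + gamma * x
       then expR (- ((1 + gamma * x) `^ (- gamma^-1)))
       else 0.

Definition max_domain_of_attraction X gamma : Prop :=
  exists c e : nat -> R, (forall n, 0 < c n) /\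
    forall x : R, (dfun X (c n * x + e n)) ^+ n @[n --> \oo] --> gev gamma x.

Definition generalized_inverse (f : R -> R) (t : R) : R :=
  inf [set x | t <= f x].

Definition infinite_right_endpoint X : Prop := forall x, dfun X x < 1.

Definition monotone_beyond (x0 : R) (f : R -> R) : Prop :=
  {in `]x0, +oo[ &, {homo f : x y / x <= y}} \/
  {in `]x0, +oo[ &, {homo f : x y / x <= y >-> y <= x}}.

(* (-1/gamma, +oo] x [-oo, +oo]; in \bar R, 0^-1 = +oo. *)
Definition half_plane gamma : set (\bar R * \bar R) :=
  [set p | (- (gamma%:E)^-1 < p.1)%E].

Section rescaled.
Context X Y a b m psi (n : nat).

Definition rescaled (w : T) : \bar R * \bar R :=
  (((X w - b n%:R) / psi (b n%:R))%:E,
   ((Y w - m (b n%:R)) / a (b n%:R))%:E).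

Lemma measurable_rescaled : measurable_fun setT rescaled.
Proof.
apply: measurable_fun_pair; apply/measurable_EFinP;
  by apply: measurable_funM => //; apply: measurable_funB.
Qed.

HB.instance Definition _ :=
  isMeasurableFun.Build _ _ _ _ rescaled measurable_rescaled.

Definition nu_ : {measure set (\bar R * \bar R) -> \bar R} :=
  mscale (n%:R%:nng : {nonneg R}) (distribution P rescaled).

End rescaled.

(* A Radon measure on half_plane gamma is represented by its extension by
   zero to \bar R * \bar R. The space being locally compact with a countable
   base, Radon means Borel and finite on compact sets. *)
Definition radon gamma (nu : {measure set (\bar R * \bar R) -> \bar R}) :=
  nu (~` half_plane gamma) = 0%E /\
  forall K, compact K -> K `<=` half_plane gamma -> (nu K < +oo)%E.

Definition vague_cvg gamma
    (nus : nat -> {measure set (\bar R * \bar R) -> \bar R})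
    (nu : {measure set (\bar R * \bar R) -> \bar R}) : Prop :=
  forall (f : \bar R * \bar R -> R) (K : set (\bar R * \bar R)),
    continuous f -> compact K -> K `<=` half_plane gamma ->
    (forall p, ~ K p -> f p = 0) ->
    (\int[nus n]_p (f p)%:E)%E @[n --> \oo] --> (\int[nu]_p (f p)%:E)%E.

(* [x, +oo) x (-oo, y]. The library interval `[x, +oo[ of \bar R contains the
   point +oo, hence the explicit comprehensions. *)
Definition quadrant (x y : \bar R) : set (\bar R * \bar R) :=
  [set p | (x <= p.1 < +oo)%E /\ (-oo < p.2 <= y)%E].

Definition half_strip (x : \bar R) : set (\bar R * \bar R) :=
  [set p | (x <= p.1 < +oo)%E /\ (-oo < p.2 < +oo)%E].

(* Only the behaviour of a, b, m and psi near +oo matters: monotonicity and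
   positivity are required beyond some point, so that functions defined on a
   neighbourhood of +oo only are covered (e.g. powers); b is prescribed where
   the generalized inverse is a genuine infimum. When the right endpoint of X
   is infinite, 1 - dfun X x never vanishes. *)
Record assumption1 X Y gamma a b m psi
    (nu : {measure set (\bar R * \bar R) -> \bar R}) : Prop := {
  a1_monotone : exists x0,
    [/\ monotone_beyond x0 a, monotone_beyond x0 b,
        monotone_beyond x0 m, monotone_beyond x0 psi
      & forall x, x0 < x -> 0 < a x /\ 0 < psi x] ;
  a1_quantile : forall t, 1 < t ->
    b t = generalized_inverse (fun x => (1 - dfun X x)^-1) t ;
  a1_domain : max_domain_of_attraction X gamma ;
  a1_radon : radon gamma nu ;
  a1_vague : vague_cvg gamma (nu_ X Y a b m psi) nu ;
  a1_mass : nu (half_strip 0%E) = 1%E ;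
  a1_nondegenerate : ~ exists c : R, forall y : R,
    nu (quadrant 0%E y%:E) = (if c <= y then 1%E else 0%E) ;
  a1_continuous : {within half_plane gamma,
    continuous (fun p : \bar R * \bar R => nu (quadrant p.1 p.2))} }.

Definition assumption2 X Y gamma a b m psi
    (nu : {measure set (\bar R * \bar R) -> \bar R}) (p q : R) : Prop :=
  forall eps : R, 0 < eps -> (eps%:E < (gamma%:E)^-1)%E ->
    (\int[nu_ X Y a b m psi n]_(z in half_strip (- eps)%:E)
       (`|z.1| `^ p * `|z.2| `^ q))%E @[n --> \oo] -->
    (\int[nu]_(z in half_strip (- eps)%:E) (`|z.1| `^ p * `|z.2| `^ q))%E.

(* a4_gamma and a4_self_neglecting are consequences of assumption1 and of the
   other conditions; they spell out that psi is an auxiliary function. *)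
Record assumption4 gamma m psi
    (nu : {measure set (\bar R * \bar R) -> \bar R})
    (rho : R) (Psi : cumulativeBounded (0:R) (1:R)) : Prop := {
  a4_gamma : gamma = 0 ;
  a4_psi : psi x / x @[x --> +oo] --> (0 : R) ;
  a4_self_neglecting : forall u : R,
    psi (x + psi x * u) / psi x @[x --> +oo] --> (1 : R) ;
  a4_m : forall x, m x = rho * x ;
  a4_product : forall x y : R,
    nu [set p | (x%:E <= p.1)%E /\ (-oo < p.2 <= y%:E)%E] =
    (expR (- x) * Psi y)%:E }.

Definition cross_moment (nu : {measure set (\bar R * \bar R) -> \bar R}) :=
  (\int[nu]_(z in half_strip 0%E) (z.1 * z.2))%E.

End extremes.

Section estimators.
Context d (T : measurableType d) (R : realType) (P : probability T R).
Context (Xs Ys : nat -> {RV P >-> R}).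

(* Stable sort: among equal X-values, the sampling order is kept. *)
Definition ordered_sample (n : nat) (w : T) : seq (R * R) :=
  sort (fun p q => p.1 <= q.1) [seq (Xs i w, Ys i w) | i <- iota 0 n].

(* X_(n:i) and Y_[n:i], 1 <= i <= n *)
Definition order_stat (n i : nat) (w : T) : R :=
  (nth (0, 0) (ordered_sample n w) i.-1).1.
Definition concomitant (n i : nat) (w : T) : R :=
  (nth (0, 0) (ordered_sample n w) i.-1).2.

Definition rho_hat (n k : nat) (w : T) : R :=
  (\sum_(1 <= i < k.+1) concomitant n (n - i + 1) w *
     (order_stat n (n - i + 1) w - order_stat n (n - k) w)) /
  (\sum_(1 <= i < k.+1) order_stat n (n - i + 1) w *
     (order_stat n (n - i + 1) w - order_stat n (n - k) w)).

Definition a_check (n k : nat) (w : T) : R :=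
  Num.sqrt (k%:R^-1 * \sum_(1 <= i < k.+1)
    (concomitant n (n - i + 1) w
     - rho_hat n k w * order_stat n (n - i + 1) w) ^+ 2).

Definition Psi_check (n k : nat) (z : R) (w : T) : R :=
  k%:R^-1 * \sum_(1 <= i < k.+1)
    (concomitant n (n - i + 1) w <=
     rho_hat n k w * order_stat n (n - i + 1) w + a_check n k w * z)%R%:R.

End estimators.

(* Main.v *)
(** Put N = n / (e k), xi = (X - b N) / psi (b N) and eta = (Y - rho b N) / a (b N).
    With this choice the upper k sample points are asymptotically those with xi > 1,
    and (1 / k) * sum over { xi > s } of g eta converges in probability to
    exp (1 - s) * int g dPsi for every continuous g >= 0 dominated by 1 + y^2 (a weak law
    for bounded functions plus a truncation based on Assumption 2).  The order
    statistics enter only through the fact that, with high probability, the top k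
    points contain { xi > 1 + e } and are contained in { xi > 1 - e }.

    Since the cross moment vanishes, Psi is centered; approximating xi - 1 by a step
    function of xi, the top means of eta and of eta * (xi - 1) tend to 0, while that of
    xi minus the threshold stays away from 0.  Hence r = b N (rho_hat - rho) / a (b N)
    tends to 0, and the residuals are a (b N) * (eta - drift) where the drift is small
    in mean square; this gives the limits of a_check and Psi_check.

    Two facts are not immediate from the assumptions: rho psi (b t) / a (b t) tends to 0
    and a (b t), b t vary slowly in t.  They follow by comparing the vague limits at
    levels n and 2 n, as in the convergence of types theorem, using second moments
    of Psi. *)
Require Import Defs.
From HB Require Import structures.
From mathcomp Require Import all_boot all_order all_algebra.
From mathcomp Require Import all_classical all_reals all_analysis measurable_realfun.
From mathcomp Require Import ring lra zify finmap.

Import Order.TTheory GRing.Theory Num.Theory.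
Import numFieldNormedType.Exports.

Set Implicit Arguments.
Unset Strict Implicit.
Unset Printing Implicit Defensive.

Local Open Scope classical_set_scope.
Local Open Scope ring_scope.

(** * Measures on the extended plane *)

(** The threshold sits at [xi] = 1, through N = n / (e k) in place of n / k, because of the weight
    |x| in Assumption 2: it controls y^2 uniformly only on { x > s } with s > 0, and says nothing
    near x = 0, where the upper k points would start at level n / k. Assumption 2 bounds no power of
    x beyond the first, whereas the denominator of [rho_hat] and the drift of the residuals involve
    means of xi^2. These are only shown to be bounded in expectation, by a dyadic estimate on the
    growth of [b]; they are used only with a small factor in front. Integrals of signed functions
    are avoided: bracketing the upper k points between two tails compares sums only for nonnegative
    summands, and nonnegative integrals need no integrability. Linear quantities in eta are
    recovered from 1, eta^2 and (1 + eta)^2, so the centering of Psi is used in the form int (1 +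
    y)^2 dPsi = 2. *)

Section extended_reals.
Context {R : realType}.

Lemma contract_expandE (r : R) : contract (expand r) = Num.max (-1) (Num.min 1 r).
Proof.
have [r1|r1] := leP 1 r; first by rewrite expand1//= max_r//; lra.
have [rN|rN] := leP r (-1); first by rewrite expandN1.
by rewrite expandK// inE ler_norml; apply/andP; split; lra.
Qed.

(** Distances in [\bar R] are read off through [contract], and [contract] after [expand] is the
    clamp to [-1, 1], which does not increase distances. Compact sets of [\bar R] are then obtained
    as images of segments. *)
Lemma expand_continuous : continuous (@expand R).
Proof.
move=> r; apply/cvg_ballP => e e0; near=> r'.
rewrite /ball /= /ereal_ball !contract_expandE.
apply: (@le_lt_trans _ _ `|r - r'|); last by near: r'; apply: cvgr_dist_lt.
have d1 := ler_norm (r - r'); have := ler_norm (r' - r); rewrite distrC => d2.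
clear -d1 d2; rewrite ler_norml; have [?|?] := leP 1 r; have [?|?] := leP 1 r';
  have [?|?] := leP r (-1); have [?|?] := leP r' (-1);
  rewrite ?(@max_r _ R (-1) 1)//; try (apply/andP; split); lra.
Unshelve. all: by end_near. Qed.

Lemma compact_expand_itv (a b : R) : compact (@expand R @` `[a, b]).
Proof.
apply: continuous_compact; last exact: segment_compact.
exact/continuous_subspaceT/expand_continuous.
Qed.

Lemma expand_image_ge (c : R) :
  (@expand R) @` `[contract c%:E, 1] = [set x | (c%:E <= x)%E].
Proof.
apply/seteqP; split => [_ [r /= + <-]|x /= cx].
  rewrite in_itv/= => /andP[cr r1].
  rewrite -[c%:E]contractK; exact: le_expand.
exists (contract x); last by rewrite contractK.
have cx' : contract c%:E <= contract x by rewrite le_contract.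
have := contract_le1 x; rewrite ler_norml => /andP[_ x1].
by rewrite /mkset in_itv; apply/andP.
Qed.

Lemma compact_eitv_ge (c : R) : compact [set x : \bar R | (c%:E <= x)%E].
Proof. by rewrite -expand_image_ge; exact: compact_expand_itv. Qed.

Lemma compact_ereal : compact [set: \bar R].
Proof.
have <- : (@expand R) @` `[-1, 1] = setT; last exact: compact_expand_itv.
apply/seteqP; split => // x _; exists (contract x); last by rewrite contractK.
by rewrite /= in_itv/=; have := contract_le1 x; rewrite ler_norml.
Qed.

(* A function that is constant below -C and above C, extended to [-oo, +oo]. *)
Definition eext (C : R) (F : R -> R) (x : \bar R) : R :=
  match x with EFin r => F r | EPInf => F C | ENInf => F (- C)%R end.

Lemma eext_continuous (C : R) (F : R -> R) : continuous F ->
  (forall x, x <= - C -> F x = F (- C)) -> (forall x, C <= x -> F x = F C) ->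
  continuous (eext C F).
Proof.
move=> cF FN FC [r||].
- apply/cvgrPdist_lt => e e0; apply/nbhs_EFin => /=.
  by move/cvgrPdist_lt: (cF r); exact.
- move=> A /nbhs_singleton /= AC; exists C; split; first exact: num_real.
  by case=> [x||]//=; rewrite lte_fin => Cx; rewrite FC// ltW.
- move=> A /nbhs_singleton /= AC; exists (- C); split; first exact: num_real.
  by case=> [x||]//=; rewrite lte_fin => Cx; rewrite FN// ltW.
Qed.

End extended_reals.

(** [m] is given by its values only, so that one change of variables serves both measures built by
    hand below, [real_part] and [tail_law]. *)
Lemma ge0_integral_restr_pushforward d1 d2 (T1 : measurableType d1)
    (T2 : measurableType d2) (R : realType) (mu : {measure set T1 -> \bar R})
    (m : {measure set T2 -> \bar R}) (phi : T1 -> T2) (D : set T1)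
    (f : T2 -> \bar R) :
  measurable_fun setT phi -> measurable D ->
  (forall A, measurable A -> m A = mu (phi @^-1` A `&` D)) ->
  measurable_fun setT f -> (forall y, 0 <= f y)%E ->
  (\int[m]_y f y = \int[mu]_(x in D) f (phi x))%E.
Proof.
move=> mphi mD mE mf f0.
have mf2 : measurable_fun setT (f \o phi) by exact: measurableT_comp.
transitivity (\int[mrestr mu mD]_x f (phi x))%E.
  rewrite -[setT in RHS](preimage_setT phi).
  rewrite -(ge0_integral_pushforward mphi (mrestr mu mD))//.
  by apply: eq_measure_integral => A mA _; rewrite mE.
rewrite -(setUv D) ge0_integral_setU//=; last 3 first.
- exact: measurableC.
- by rewrite setUv.
- exact/disj_setPCl.
rewrite [X in (_ + X)%E](_ : _ = 0%E) ?adde0.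
  by apply: eq_measure_integral => A mA AD; rewrite /= /mrestr setIidl.
rewrite (@eq_measure_integral _ _ _ _ mzero) ?integral_measure_zero// => A mA AD.
by rewrite /= /mrestr [A `&` _](_ : _ = set0) ?measure0//; exact/disj_set2P/disj_setPLR.
Qed.

(** * From the extended plane to the real plane *)

Section real_part.
Context {R : realType}.
Local Notation RR := (measurableTypeR R * measurableTypeR R)%type.

Definition fine2 (p : \bar R * \bar R) : RR := (fine p.1, fine p.2).

Lemma measurable_fine2 : measurable_fun setT fine2.
Proof.
apply: measurable_fun_pair.
  by apply: (measurableT_comp (fine_measurable _)).
by apply: (measurableT_comp (fine_measurable _)).
Qed.

HB.instance Definition _ :=
  isMeasurableFun.Build _ _ _ _ fine2 measurable_fine2.

Definition finite_points : set (\bar R * \bar R) :=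
  [set x | x \is a fin_num] `*` [set x | x \is a fin_num].

Lemma measurable_finite_points : measurable finite_points.
Proof.
have mfin : measurable [set x : \bar R | x \is a fin_num].
  by rewrite -[X in measurable X]setTI; exact: emeasurable_fin_num.
exact: measurableX.
Qed.

Context (nu : {measure set (\bar R * \bar R) -> \bar R}).

(** Points with an infinite coordinate are dropped. The rescaled measures do not charge them; for
    the limit, the test functions in use vanish there except on the line x = +oo with y finite,
    which is shown to be null. *)
Definition real_part (A : set RR) : \bar R :=
  pushforward (mrestr nu measurable_finite_points) fine2 A.

Let real_part0 : real_part set0 = 0%E.
Proof. exact: measure0. Qed.

Let real_part_ge0 A : (0 <= real_part A)%E.
Proof. exact: measure_ge0. Qed.

Let real_part_sigma_additive : semi_sigma_additive real_part.
Proof. exact: measure_semi_sigma_additive. Qed.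

HB.instance Definition _ := isMeasure.Build _ _ _ real_part
  real_part0 real_part_ge0 real_part_sigma_additive.

Lemma ge0_integral_real_part (f : RR -> \bar R) :
  measurable_fun setT f -> (forall p, 0 <= f p)%E ->
  (\int[real_part]_p f p = \int[nu]_(p in finite_points) f (fine2 p))%E.
Proof.
exact: ge0_integral_restr_pushforward measurable_fine2 measurable_finite_points _.
Qed.

End real_part.

Lemma measure_bigcup_eq0 d (T : measurableType d) (R : realType)
    (mu : {measure set T -> \bar R}) (F : (set T)^nat) :
  (forall n, measurable (F n)) -> (forall n, mu (F n) = 0%E) ->
  mu (\bigcup_n F n) = 0%E.
Proof.
move=> mF F0; apply/eqP; rewrite eq_le measure_ge0 andbT.
have := measure_sigma_subadditive mu mF (bigcupT_measurable F mF) (fun _ => id).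
by move/le_trans; apply; rewrite eseries0.
Qed.

Lemma measurable_natr_bool d (T : measurableType d) (R : realType) (f : T -> bool) :
  measurable_fun setT f -> measurable_fun setT (fun x => (f x)%:R : R).
Proof.
move=> mf; rewrite (_ : (fun x => _) = (fun x => if f x then 1 else 0)).
  exact: measurable_fun_ifT.
by apply/funext => x; case: (f x).
Qed.

Section bridge.
Context {R : realType}.
Local Notation RR := (measurableTypeR R * measurableTypeR R)%type.
Local Notation EE := (\bar R * \bar R)%type.

Definition xinfty_fin : set EE := [set +oo%E] `*` [set x | x \is a fin_num].

Lemma measurable_xinfty_fin : measurable xinfty_fin.
Proof.
apply: measurableX; first exact: emeasurable_set1.
by rewrite -[X in measurable X]setTI; exact: emeasurable_fin_num.
Qed.

Lemma ge0_integral_finite (nu : {measure set EE -> \bar R}) (T : EE -> \bar R) :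
  nu xinfty_fin = 0%E -> measurable_fun setT T -> (forall p, 0 <= T p)%E ->
  (forall p, ~ finite_points p -> ~ xinfty_fin p -> T p = 0%E) ->
  (\int[nu]_p T p = \int[nu]_(p in finite_points) T p)%E.
Proof.
move=> nu0 mT T0 T00.
rewrite (ge0_negligible_integral measurable_xinfty_fin)//.
rewrite integral_mkcond [RHS]integral_mkcond; apply: eq_integral => p _.
rewrite !patchE setTD; case: ifPn => [/set_mem|/negP] pN;
  case: ifPn => [/set_mem|] pD//; first by rewrite T00// => /mem_set; apply/negP.
have /contrapT : ~ ~ xinfty_fin p by move=> ?; apply: pN; exact: mem_set.
by move=> -[/= p1 _]; move: pD => [/=]; rewrite p1.
Qed.

Lemma measurable_equadrant (x y : R) :
  measurable [set p : EE | (x%:E <= p.1)%E /\ (-oo < p.2 <= y%:E)%E].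
Proof.
rewrite (_ : mkset _ = [set` `[x%:E, +oo[%O] `*` [set` `]-oo%E, y%:E]%O]).
  by apply: measurableX; exact: emeasurable_itv.
by apply/seteqP; split => p [/= p1 p2]; split => //=; move: p1 p2;
  rewrite !in_itv/= ?andbT.
Qed.

Lemma measurable_eext (C : R) (F : R -> R) : continuous F ->
  measurable_fun setT (fun x => (eext C F x)%:E).
Proof.
move=> cF.
have -> : (fun x => (eext C F x)%:E) = (fun x : \bar R => if x == +oo%E then
    (F C)%:E else if x == -oo%E then (F (- C))%:E else (F (fine x))%:E).
  by apply/funext => -[r||].
apply: measurable_fun_ifT => //.
  exact: measurable_fun_eqe.
apply: measurable_fun_ifT => //.
  exact: measurable_fun_eqe.
apply/measurable_EFinP; apply: measurableT_comp.
  exact: continuous_measurable_fun.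
exact: fine_measurable.
Qed.


(** [G] vanishes at both infinities and [F] at -oo, so at infinite points the product can be nonzero
    only on the null line [xinfty_fin]. *)
Lemma eext_prod_vague (C : R) (F G : R -> R) (nu : {measure set EE -> \bar R}) :
  nu xinfty_fin = 0%E -> continuous F -> continuous G ->
  (forall x, 0 <= F x) -> (forall x, 0 <= G x) ->
  (forall x, x <= - C -> F x = 0) -> (forall x, x <= - C -> G x = 0) ->
  (forall x, C <= x -> G x = 0) ->
  (\int[nu]_p (eext C F p.1 * eext C G p.2)%:E =
   \int[real_part nu]_p (F p.1 * G p.2)%:E)%E.
Proof.
move=> nu0 cF cG F0 G0 FN GN GC.
have F0' x : 0 <= eext C F x by case: x => [r||] /=.
have G0' x : 0 <= eext C G x by case: x => [r||] /=.
have mT : measurable_fun setT (fun p : EE => (eext C F p.1 * eext C G p.2)%:E).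
  apply/measurable_EFinP; apply: measurable_funM.
    exact: (measurableT_comp ((measurable_EFinP _ _).1 (measurable_eext C cF))).
  exact: (measurableT_comp ((measurable_EFinP _ _).1 (measurable_eext C cG))).
rewrite ge0_integral_finite//; first last.
- case=> -[r||] -[s||] //=; rewrite ?(GN (- C)) ?(GC C) ?(FN (- C)) ?mulr0 ?mul0r//.
  + by move=> /(_ _)[].
  + by move=> _ /(_ _)[].
- by move=> p; rewrite lee_fin mulr_ge0.
rewrite ge0_integral_real_part.
- by apply: eq_integral => -[[x||] [y||]] /set_mem[].
- apply/measurable_EFinP; apply: measurable_funM.
    by apply: measurableT_comp => //; exact: continuous_measurable_fun.
  by apply: measurableT_comp => //; exact: continuous_measurable_fun.
- by move=> p; rewrite lee_fin mulr_ge0.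
Qed.

Lemma eext_prod_continuous (C : R) (F G : R -> R) :
  continuous F -> continuous G ->
  (forall x, x <= - C -> F x = 0) -> (forall x, C <= x -> F x = F C) ->
  (forall x, x <= - C -> G x = 0) -> (forall x, C <= x -> G x = 0) ->
  continuous (fun p : EE => eext C F p.1 * eext C G p.2).
Proof.
move=> cF cG FN FC GN GC p; apply: cvgM.
  apply: (cvg_comp fst (eext C F)); first exact: cvg_fst.
  by apply: eext_continuous => // x xC; rewrite !FN.
apply: (cvg_comp snd (eext C G)); first exact: cvg_snd.
by apply: eext_continuous => // x xC; [rewrite !GN|rewrite !GC].
Qed.

Lemma ge0_integral_half_strip (nu : {measure set EE -> \bar R}) (c : R)
    (f : RR -> R) (g : EE -> \bar R) :
  measurable_fun setT f -> (forall p, 0 <= f p) ->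
  (forall x y : R, c <= x -> g (x%:E, y%:E) = (f (x, y))%:E) ->
  (\int[nu]_(z in half_strip c%:E) g z =
   \int[real_part nu]_p ((c <= p.1)%R%:R * f p)%:E)%E.
Proof.
move=> mf f0 gf; rewrite ge0_integral_real_part; first last.
- by move=> p; rewrite lee_fin mulr_ge0.
- apply/measurable_EFinP; apply: measurable_funM => //.
  exact/measurable_natr_bool/measurable_fun_ler.
rewrite integral_mkcond [RHS]integral_mkcond; apply: eq_integral => -[x y] _.
rewrite !patchE; case: ifPn => [/set_mem|/negP] hs;
  case: ifPn => [/set_mem|/negP] fs //.
- move: hs fs => [/= + _] [/= + +]; case: x y => [x||] [y||]//=.
  by rewrite lee_fin => /andP[cx _] _ _; rewrite cx mul1r gf.
- exfalso; apply: fs; apply/mem_set; move: hs => [/= + +].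
  by case: x y => [x||] [y||]//=; rewrite ?andbF.
- move: fs => [/= + +]; case: x y hs => [x||] [y||]//= hs _ _.
  suff -> : (c <= x) = false by rewrite mul0r.
  apply/negP => cx; apply: hs; apply/mem_set; split => /=.
    by rewrite lee_fin cx ltry.
  by rewrite ltNyr ltry.
Qed.

End bridge.

(** * The rescaled measures and their limit, seen on the real plane *)

Section rescaled_measures.
Context d (T : measurableType d) (R : realType) (P : probability T R).
Context (X Y : {RV P >-> R}) (gamma : R) (a b m psi : R -> R).
Context (nu : {measure set (\bar R * \bar R) -> \bar R}) (rho : R)
  (Psi : cumulativeBounded (0:R) (1:R)).
Hypotheses (A1 : assumption1 X Y gamma a b m psi nu)
  (A4 : assumption4 gamma m psi nu rho Psi).
Local Notation RR := (measurableTypeR R * measurableTypeR R)%type.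

Definition mu_ n := real_part (nu_ X Y a b m psi n).
HB.instance Definition _ n := Measure.on (mu_ n).

Lemma nu_n_xinfty_fin n : nu_ X Y a b m psi n xinfty_fin = 0%E.
Proof.
transitivity (n%:R%:E * P (rescaled X Y a b m psi n @^-1` xinfty_fin))%E => //.
rewrite [_ @^-1` _](_ : _ = set0) ?measure0 ?mule0//.
by apply/seteqP; split => // w [].
Qed.

(** For every real x, the part of the line with y <= M lies in [x, +oo] x (-oo, M], whose mass exp
    (- x) Psi M tends to 0 as x grows. *)
Lemma nu_xinfty_fin : nu xinfty_fin = 0%E.
Proof.
pose E (M : nat) : set (\bar R * \bar R) :=
  [set +oo%E] `*` [set` `]-oo%E, M%:R%:E]%O].
have mE M : measurable (E M).
  by apply: measurableX; [exact: emeasurable_set1|exact: emeasurable_itv].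
have E0 M : nu (E M) = 0%E.
  apply/eqP; rewrite eq_le measure_ge0 andbT; apply/lee_addgt0Pr => e e0.
  rewrite add0e; pose c := e / (`|Psi M%:R| + 1).
  have n1 : 0 < `|Psi M%:R| + 1 by rewrite ltr_wpDl.
  have c0 : 0 < c by rewrite divr_gt0.
  apply: (@le_trans _ _ (nu [set p | ((- ln c)%:E <= p.1)%E /\
      (-oo < p.2 <= M%:R%:E)%E])).
    apply: le_measure.
    - apply: mem_set; exact: mE.
    - apply: mem_set; exact: measurable_equadrant.
    - by move=> p [/= -> /=]; rewrite in_itv/= => p2; split => //; rewrite leey.
  rewrite (a4_product A4) opprK lnK ?posrE// lee_fin.
  rewrite mulrAC ler_pdivrMr//; apply: ler_wpM2l; first exact: ltW.
  by apply: (le_trans (ler_norm _)); rewrite lerDl.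
have -> : xinfty_fin = \bigcup_M E M.
  clear mE; apply/seteqP; split => [[x y] [/= -> yfin]|[x y] [M _ [/= -> +]]].
    exists (Num.truncn `|fine y|).+1 => //; split => //=.
    rewrite in_itv/= -[y]fineK// ltNyr lee_fin/=.
    by rewrite (le_trans (ler_norm _))// ltW// truncnS_gt.
  rewrite in_itv/= => yM; by split => //=; case: y yM.
exact: measure_bigcup_eq0.
Qed.

Lemma integral_mu_ n (f : RR -> R) : measurable_fun setT f ->
  (forall p, 0 <= f p) ->
  (\int[mu_ n]_p (f p)%:E = n%:R%:E * \int[P]_w (f
    ((X w - b n%:R) / psi (b n%:R), (Y w - m (b n%:R)) / a (b n%:R)))%:E)%E.
Proof.
move=> mf f0.
have mff : measurable_fun setT (fun p => (f (fine2 p))%:E).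
  by apply/measurable_EFinP; exact: (measurableT_comp mf measurable_fine2).
rewrite ge0_integral_real_part; first last.
- by move=> p; rewrite lee_fin.
- exact/measurable_EFinP.
rewrite ge0_integral_mscale; first last.
- by move=> p _; rewrite lee_fin.
- exact: measurable_funTS.
- exact: measurable_finite_points.
congr (_ * _)%E.
rewrite (ge0_integral_pushforward (measurable_rescaled X Y a b m psi n)); first last.
- by move=> p _; rewrite lee_fin.
- exact: measurable_funTS.
- exact: measurable_finite_points.
by rewrite (_ : _ @^-1` _ = setT)//; apply/seteqP; split.
Qed.

(** Since gamma = 0 the half plane is x > -oo, and [-C, +oo] x [-oo, +oo] is compact in it. Hence
    [F] may stay nonzero up to x = +oo, which is how the tails { x > s } become accessible. *)
Lemma mu_vague (C : R) (F G : R -> R) : continuous F -> continuous G ->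
  (forall x, 0 <= F x) -> (forall x, 0 <= G x) ->
  (forall x, x <= - C -> F x = 0) -> (forall x, C <= x -> F x = F C) ->
  (forall x, x <= - C -> G x = 0) -> (forall x, C <= x -> G x = 0) ->
  (\int[mu_ n]_p (F p.1 * G p.2)%:E)%E @[n --> \oo] -->
  (\int[real_part nu]_p (F p.1 * G p.2)%:E)%E.
Proof.
move=> cF cG F0 G0 FN FC GN GC.
rewrite -(@eext_prod_vague _ C)//; last exact: nu_xinfty_fin.
under eq_fun do rewrite /mu_ -(@eext_prod_vague _ C F G _ (nu_n_xinfty_fin _))//.
apply: (a1_vague A1 (K := [set x | ((- C)%:E <= x)%E] `*` setT)).
- exact: eext_prod_continuous.
- by apply: compact_setX; [exact: compact_eitv_ge|exact: compact_ereal].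
- move=> [x y] [/= Cx _]; rewrite /half_plane/= (a4_gamma A4).
  by rewrite inve0 /= (lt_le_trans _ Cx)// ltNyr.
- move=> [x y] /= Kxy; rewrite [eext C F x](_ : _ = 0) ?mul0r//.
  case: x Kxy => [x||] Kxy /=; rewrite ?FN//.
    by rewrite leNgt; apply/negP => xC; apply: Kxy; split => //=; rewrite lee_fin ltW.
  by exfalso; apply: Kxy; split => //=; rewrite leey.
Qed.

(** The set in [a4_product] contains points with x = +oo; removing the null line leaves the real
    quadrant. *)
Lemma real_part_quadrant (x y : R) :
  real_part nu [set p | x <= p.1 /\ p.2 <= y] = (expR (- x) * Psi y)%:E.
Proof.
rewrite -(a4_product A4).
set A := [set p : \bar R * \bar R | _].
have mA : measurable A by exact: measurable_equadrant.
have <- : nu (A `\` xinfty_fin) = nu A.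
  rewrite -[in RHS](setDUK (A := A `&` xinfty_fin) (B := A)); last exact: subIsetl.
  rewrite setDIr setDv set0U setUC measureU0//.
  - by apply: measurableD => //; exact: measurable_xinfty_fin.
  - by apply: measurableI => //; exact: measurable_xinfty_fin.
  - apply/eqP; rewrite eq_le measure_ge0 andbT -nu_xinfty_fin.
    apply: le_measure.
    + by apply: mem_set; apply: measurableI => //; exact: measurable_xinfty_fin.
    + by apply: mem_set; exact: measurable_xinfty_fin.
    + by move=> ? [].
rewrite /real_part/= /pushforward /mrestr; congr (nu _).
apply/seteqP; split => -[u v] /=.
  move=> [[xu vy] [/= uf vf]]; move: u v uf vf xu vy => [u||] [v||]//= _ _ xu vy.
  by split; [rewrite /A/= !lee_fin ltNyr xu vy|case].
move=> [[/= xu vy] nN]; move: u v xu vy nN => [u||] [v||]//=.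
  by rewrite !lee_fin => xu /andP[_ vy].
by move=> _ _ nN; exfalso; apply: nN.
Qed.

Lemma mu_second_moment (e : R) :
  assumption2 X Y gamma a b m psi nu 1 2 -> 0 < e ->
  (\int[mu_ n]_p ((- e <= p.1)%R%:R * (`|p.1| * p.2 ^+ 2))%:E)%E @[n --> \oo] -->
  (\int[real_part nu]_p ((- e <= p.1)%R%:R * (`|p.1| * p.2 ^+ 2))%:E)%E.
Proof.
move=> A2 e0; have := A2 e e0; rewrite (a4_gamma A4) inve0 ltry => /(_ isT).
have mf : measurable_fun setT (fun p : RR => `|p.1| * p.2 ^+ 2).
  apply: measurable_funM; first exact: measurableT_comp.
  exact: measurable_funX.
have f0 (p : RR) : 0 <= `|p.1| * p.2 ^+ 2 by rewrite mulr_ge0// sqr_ge0.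
have E (x y : R) : - e <= x ->
    (`|x%:E| `^ 1 * `|y%:E| `^ 2 = (`|x| * y ^+ 2)%:E)%E.
  by move=> _; rewrite /= powRr1// (powR_mulrn 2)// real_normK// num_real.
rewrite (ge0_integral_half_strip _ mf f0 E).
by under eq_fun do rewrite (ge0_integral_half_strip _ mf f0 E).
Qed.

Lemma cross_moment_real_part : cross_moment nu = 0%E ->
  (\int[real_part nu]_p ((0 <= p.1)%R%:R * (`|p.1| * Num.max p.2 0))%:E =
   \int[real_part nu]_p ((0 <= p.1)%R%:R * (`|p.1| * Num.max (- p.2) 0))%:E)%E.
Proof.
have mM (f : RR -> R) : measurable_fun setT f ->
    measurable_fun setT (fun p : RR => `|p.1| * Num.max (f p) 0).
  move=> mf; apply: measurable_funM; first exact: measurableT_comp.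
  exact: measurable_maxr.
have M0 (u v : R) : 0 <= `|u| * Num.max v 0.
  by rewrite mulr_ge0// le_max lexx orbT.
rewrite /cross_moment integralE.
rewrite (@ge0_integral_half_strip _ nu 0 (fun p => `|p.1| * Num.max p.2 0)); first last.
- by move=> x y x0; rewrite funeposE/= -EFin_max maxr_pMr// mulr0 ger0_norm.
- by move=> p; exact: M0.
- exact: mM.
rewrite (@ge0_integral_half_strip _ nu 0 (fun p => `|p.1| * Num.max (- p.2) 0)); first last.
- move=> x y x0; rewrite funenegE/= -EFin_max maxr_pMr// mulr0.
  by rewrite mulrN ger0_norm.
- by move=> p; exact: M0.
- by apply: mM; exact: measurableT_comp.
set u := integral _ _ _; set v := integral _ _ _.
(* A difference with an infinite term is infinite, so a zero difference forces both halves to be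
   finite and equal. *)
by case: u => [u||]; case: v => [v||]// [] /eqP; rewrite subr_eq0 => /eqP ->.
Qed.



End rescaled_measures.

(** * Tail moments of a product limit measure *)

(** Hook for the elementary functions that [meas] does not analyse, redefined once [ramp] and [cut]
    are available. *)
Ltac meas_base := fail.

Ltac meas := cbv beta; lazymatch goal with
  | |- measurable_fun _ (fun x => EFin _) => apply/measurable_EFinP; meas
  | |- measurable_fun _ (fun x => x) => exact: measurable_id
  | |- measurable_fun _ fst => exact: measurable_fst
  | |- measurable_fun _ snd => exact: measurable_snd
  | |- measurable_fun _ (GRing.add _) =>
      apply: (measurable_funD (measurable_cst _) (@measurable_id _ _ _))
  | |- measurable_fun _ ( *%R _) => exact: mulrl_measurable
  | |- measurable_fun _ -%R => exact: oppr_measurable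
  | |- measurable_fun _ Num.norm => exact: normr_measurable
  | |- measurable_fun _ (fun x => fst x) => exact: measurable_fst
  | |- measurable_fun _ (fun x => snd x) => exact: measurable_snd
  | |- measurable_fun _ (fun x => (nat_of_bool _)%:R) =>
      apply: measurable_natr_bool; meas
  | |- measurable_fun _ (fun x => (_ <= _)%R) => apply: measurable_fun_ler; meas
  | |- measurable_fun _ (fun x => (_ < _)%R) => apply: measurable_fun_ltr; meas
  | |- measurable_fun _ (fun x => _ ^+ _) => apply: measurable_funX; meas
  | |- measurable_fun _ (fun x => _ * _) => apply: measurable_funM; meas
  | |- measurable_fun _ (fun x => _ - _) => apply: measurable_funB; meas
  | |- measurable_fun _ (fun x => _ + _) => apply: measurable_funD; meas
  | |- measurable_fun _ (fun x => - _) =>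
      apply: measurable_funN; meas
  | |- measurable_fun _ (fun x => `|_|) =>
      apply: (measurableT_comp (@normr_measurable _ setT)); meas
  | |- measurable_fun _ (fun x => Num.max _ _) => apply: measurable_maxr; meas
  | |- measurable_fun _ (fun x => Num.min _ _) => apply: measurable_minr; meas
  | H : measurable_fun _ ?g |- measurable_fun _ ?g => exact: H
  | H : measurable_fun _ ?g |- measurable_fun _ (fun x => ?g x) => exact: H
  | H : measurable_fun _ ?g |- measurable_fun _ (fun x => ?g _) =>
      apply: (measurableT_comp H); meas
  | |- measurable_fun _ (fun x => ?g (@?h x)) =>
      first [exact: measurable_cst
            |apply: (measurableT_comp (f := g)); [meas_base|meas]]
  | |- measurable_fun _ (fun x => _) => exact: measurable_cst
  | |- measurable_fun _ _ => meas_base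
  end.

Lemma nneseries_geometric (R : realType) (c q : R) : 0 <= q -> q < 1 ->
  (\sum_(0 <= j <oo) (c * q ^+ j)%:E = (c / (1 - q))%:E)%E.
Proof.
move=> q0 q1; apply/cvg_lim => //.
rewrite (_ : (fun n => _) = EFin \o series (geometric c q)).
  by apply: cvg_EFin; [near=> n|apply: cvg_geometric_series; rewrite ger0_norm].
by apply/funext => n /=; rewrite sumEFin.
Unshelve. all: by end_near. Qed.

(** * Integration against the product of an exponential tail and Psi *)

Section exp_times_Psi.
Context {R : realType}.
Local Notation RR := (measurableTypeR R * measurableTypeR R)%type.
Context (mu : {measure set RR -> \bar R}) (Psi : cumulativeBounded (0:R) (1:R)).
Hypothesis muE : forall x y : R,
  mu [set p | x <= p.1 /\ p.2 <= y] = (expR (- x) * Psi y)%:E.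
Local Notation lsf := (lebesgue_stieltjes_measure Psi).

Definition right_of (s : R) : set RR := [set p | s <= p.1].

Lemma measurable_right_of s : measurable (right_of s).
Proof.
rewrite -[X in measurable X]setTI -[right_of s]/((fun p : RR => s <= p.1) @^-1` [set true]).
by apply: measurable_fun_ler; [meas|meas|exact: measurableT|].
Qed.

Let second : RR -> measurableTypeR R := snd.
HB.instance Definition _ :=
  isMeasurableFun.Build _ _ _ _ second measurable_snd.

(** The second marginal of [mu] restricted to { x >= s }: exp (- s) times the law with distribution
    function Psi. *)
Definition tail_law (s : R) (A : set (measurableTypeR R)) : \bar R :=
  pushforward (mrestr mu (measurable_right_of s)) second A.

Let tail_law0 s : tail_law s set0 = 0%E.
Proof. exact: measure0. Qed.

Let tail_law_ge0 s A : (0 <= tail_law s A)%E.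
Proof. exact: measure_ge0. Qed.

Let tail_law_sigma_additive s : semi_sigma_additive (tail_law s).
Proof. exact: measure_semi_sigma_additive. Qed.

HB.instance Definition _ s := isMeasure.Build _ _ _ (tail_law s)
  (tail_law0 s) (@tail_law_ge0 s) (@tail_law_sigma_additive s).

(** Both sides agree on half-open intervals, and these determine the Lebesgue-Stieltjes measure. *)
Lemma tail_lawE (s : R) (A : set (measurableTypeR R)) : measurable A ->
  lsf A = mscale (NngNum (expR_ge0 s)) (tail_law s) A.
Proof.
apply: lebesgue_stieltjes_measure_unique => {A} _ [[x y] _ <-].
pose t : {measure set (measurableTypeR R) -> \bar R} :=
  mscale (NngNum (expR_ge0 s)) (tail_law s).
have E (z : R) : t `]-oo, z]%classic = (Psi z)%:E.
  transitivity ((expR s)%:E * mu [set p | (s <= p.1)%R /\ (p.2 <= z)%R])%E.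
    congr (_ * mu _)%E; apply/seteqP; split => p /=; rewrite in_itv/=; by case.
  by rewrite muE -EFinM mulrA expRN divff ?mul1r// gt_eqF// expR_gt0.
rewrite /lebesgue_stieltjes_measure /measure_extension/=.
rewrite measurable_mu_extE/=; last exact: is_ocitv.
have [xy|yx] := leP x y; last first.
  rewrite set_itv_ge; last by rewrite bnd_simp -leNgt ltW.
  by rewrite wlength0 measure0.
rewrite wlength_itv_bnd// EFinB -!E.
change (t `]-oo, y] - t `]-oo, x] = t `]x, y])%classic%E.
have -> : `]x, y]%classic = `]-oo, y] `\` `]-oo, x] :> set (measurableTypeR R).
  by rewrite -[RHS]setCK setCD setCitvl setUC -[LHS]setCK setCitv.
rewrite measureD//; first by rewrite setIidr//; exact: subset_itvl.
exact: (eq_ind_r (fun z => z < +oo)%E (ltry _) (E y)).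
Qed.

Lemma ge0_integral_tail (s : R) (g : R -> R) :
  measurable_fun setT g -> (forall y, 0 <= g y) ->
  (\int[mu]_p ((s <= p.1)%R%:R * g p.2)%:E =
   (expR (- s))%:E * \int[lsf]_y (g y)%:E)%E.
Proof.
move=> mg g0.
have g0' y : (0 <= (g y)%:E)%E by rewrite lee_fin.
have mg' : measurable_fun setT (fun y => (g y)%:E) by exact/measurable_EFinP.
have mg2 : measurable_fun setT (fun p : RR => (g p.2)%:E) by meas.
have -> : (\int[lsf]_y (g y)%:E =
    \int[mscale (NngNum (expR_ge0 s)) (tail_law s)]_y (g y)%:E)%E.
  by apply: eq_measure_integral => A mA _; exact: tail_lawE.
rewrite ge0_integral_mscale//= muleA -EFinM -expRD addNr expR0 mul1e.
rewrite (ge0_integral_restr_pushforward (mu := mu) (@measurable_snd _ _ _ _) (measurable_right_of s))//.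
rewrite [RHS]integral_mkcond; apply: eq_integral => p _; rewrite patchE.
case: ifPn => [/set_mem|/negP] sp; first by rewrite sp mul1r.
by have [/mem_set //|] := boolP (s <= p.1); rewrite mul0r.
Qed.

(** Only integrals over tails { x >= s } are known, so for x >= 0 the weight x is compared with the
    staircase h #{ j >= 1 : j h <= x }, which lies between x - h and x. The steps integrate to a
    geometric series of ratio exp (- h), and both bounds tend to G as h tends to 0. *)
Lemma ge0_integral_mesh (h G : R) (g : R -> R) : 0 < h ->
  measurable_fun setT g -> (forall y, 0 <= g y) ->
  (\int[lsf]_y (g y)%:E = G%:E)%E ->
  ((h * expR (- h) * G / (1 - expR (- h)))%:E <=
    \int[mu]_p ((0 <= p.1)%R%:R * (`|p.1| * g p.2))%:E <=
    (h * G / (1 - expR (- h)))%:E)%E.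
Proof.
move=> h0 mg g0 gG; set q := expR (- h).
have q0 : 0 <= q by exact: expR_ge0.
have q1 : q < 1 by rewrite expR_lt1 oppr_lt0.
pose st j (p : RR) := h * ((h * j.+1%:R <= p.1)%R%:R * g p.2).
have st0 j p : (0 <= (st j p)%:E)%E.
  by rewrite lee_fin /st mulr_ge0 ?mulr_ge0// ltW.
have mst j : measurable_fun setT (fun p => (st j p)%:E) by rewrite /st; meas.
have intst : (\int[mu]_p (\sum_(0 <= j <oo) (st j p)%:E) =
    (h * q * G / (1 - q))%:E)%E.
  rewrite integral_nneseries// -nneseries_geometric//.
  apply: eq_eseriesr => j _; rewrite /st.
  under eq_integral do rewrite EFinM.
  rewrite ge0_integralZl_EFin//; last 3 first.
  - by move=> p _; rewrite lee_fin mulr_ge0.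
  - by meas.
  - exact: ltW.
  rewrite ge0_integral_tail// gG -!EFinM; congr (_%:E).
  by rewrite -mulNr expRM_natr -/q exprS; ring.
have mI : measurable_fun setT (fun p : RR => ((0 <= p.1)%R%:R * (`|p.1| * g p.2))%:E).
  by meas.
have I0 (p : RR) : (0 <= ((0 <= p.1)%R%:R * (`|p.1| * g p.2))%:E)%E.
  by rewrite lee_fin mulr_ge0// mulr_ge0.
have mser : measurable_fun setT (fun p => \sum_(0 <= j <oo) (st j p)%:E)%E.
  exact: ge0_emeasurable_sum.
have ser0 p : (0 <= \sum_(0 <= j <oo) (st j p)%:E)%E by exact: nneseries_ge0.
apply/andP; split.
  rewrite -intst; apply: ge0_le_integral => // p _.
  apply: lime_le; first exact: is_cvg_nneseries.
  apply: nearW => n; rewrite sumEFin lee_fin.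
  have [p0|p0] := leP 0 p.1; last first.
    rewrite mul0r big1// => j _; rewrite /st [_ <= p.1](_ : _ = false) ?mul0r ?mulr0//.
    by apply/negbTE; rewrite -ltNge (lt_le_trans p0)// mulr_ge0// ltW.
  rewrite mul1r ger0_norm//.
  have : \sum_(0 <= j < n) h * (h * j.+1%:R <= p.1)%R%:R <= p.1 /\
      \sum_(0 <= j < n) h * (h * j.+1%:R <= p.1)%R%:R <= h * n%:R.
    elim: n => [|n [IH1 IH2]]; first by rewrite big_geq// mulr0.
    rewrite big_nat_recr//=; case: (leP (h * n.+1%:R) p.1) => hn;
      rewrite ?mulr1 ?mulr0 ?addr0.
      rewrite -[in X in _ /\ X]natr1 mulrDr mulr1; split; last by rewrite lerD2r.
      by apply: le_trans hn; rewrite -natr1 mulrDr mulr1 lerD2r.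
    by split; [exact: IH1|rewrite (le_trans IH2)// ler_pM2l// ler_nat].
  move=> [Sn _]; rewrite /st; under eq_bigr do rewrite mulrA.
  by rewrite -mulr_suml ler_wpM2r.
have -> : (h * G / (1 - q))%:E = (h%:E * G%:E + (h * q * G / (1 - q))%:E)%E.
  rewrite -EFinM -EFinD; congr (_%:E); field.
  by rewrite subr_eq0 eq_sym lt_eqF.
have <- : (\int[mu]_p (h * ((0 <= p.1)%R%:R * g p.2))%:E = h%:E * G%:E)%E.
  under eq_integral do rewrite EFinM.
  rewrite ge0_integralZl_EFin//; last 3 first.
  - by move=> p _; rewrite lee_fin mulr_ge0.
  - by meas.
  - exact: ltW.
  by rewrite ge0_integral_tail// gG oppr0 expR0 mul1e.
rewrite -intst -ge0_integralD//; last 2 first.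
- by move=> p _; rewrite lee_fin mulr_ge0 ?mulr_ge0// ltW.
- by meas.
apply: ge0_le_integral => //.
  by apply: emeasurable_funD; [meas|exact: mser].
move=> p _; have [p0|p0] := leP 0 p.1; last first.
  by rewrite !mul0r mulr0 add0e.
rewrite !mul1r ger0_norm//.
(* The J steps at h, ..., J h are all reached, and p.1 < (J + 1) h; the extra h is the added
   constant. *)
pose J := Num.truncn (p.1 / h).
apply: (@le_trans _ _ ((h * g p.2)%:E + \sum_(0 <= j < J) (st j p)%:E)%E); last first.
  by rewrite leeD2l// nneseries_lim_ge.
rewrite (eq_big_nat _ _ (F2 := fun=> (h * g p.2)%:E)); last first.
  move=> j /andP[_ jJ]; rewrite /st [_ <= _](_ : _ = true) ?mul1r//.
  rewrite mulrC -ler_pdivlMr//.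
  apply: (@le_trans _ _ J%:R); first by rewrite ler_nat.
  by rewrite truncn_le divr_ge0// ltW.
rewrite sumEFin sumr_const_nat subn0 -EFinD lee_fin -[X in X + _]mulr1n -mulrnDr.
rewrite -mulr_natr mulrAC ler_wpM2r// mulrC -ler_pdivrMr// add1n ltW//.
exact: truncnS_gt.
Qed.

End exp_times_Psi.

Lemma ge0_integral_const (d : measure_display) (T : measurableType d) (R : realType)
    (m : {measure set T -> \bar R}) (f : T -> R) (k : R) :
  measurable_fun setT f -> (forall x, 0 <= f x) -> 0 <= k ->
  (\int[m]_x (k * f x)%:E = k%:E * \int[m]_x (f x)%:E)%E.
Proof.
move=> /measurable_EFinP mf f0 k0; under eq_integral do rewrite EFinM.
by rewrite ge0_integralZl_EFin// => x _; rewrite lee_fin.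
Qed.

Lemma ge0_le_integral_fin (d : measure_display) (T : measurableType d) (R : realType)
    (m : {measure set T -> \bar R}) (f g : T -> R) :
  measurable_fun setT f -> measurable_fun setT g -> (forall x, 0 <= f x) ->
  (forall x, f x <= g x) ->
  (\int[m]_x (f x)%:E <= \int[m]_x (g x)%:E)%E.
Proof.
move=> /measurable_EFinP mf /measurable_EFinP mg f0 fg.
by apply: ge0_le_integral => // x _; rewrite lee_fin.
Qed.

Lemma ge0_integralD_fin (d : measure_display) (T : measurableType d) (R : realType)
    (m : {measure set T -> \bar R}) (f g : T -> R) :
  measurable_fun setT f -> measurable_fun setT g -> (forall x, 0 <= f x) ->
  (forall x, 0 <= g x) ->
  (\int[m]_x (f x + g x)%:E = \int[m]_x (f x)%:E + \int[m]_x (g x)%:E)%E.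
Proof.
move=> /measurable_EFinP mf /measurable_EFinP mg f0 g0.
under eq_integral do rewrite EFinD.
by rewrite ge0_integralD// => x _; rewrite lee_fin.
Qed.

Lemma cvge_squeeze_eps (R : realType) (T : Type) (F : set_system T) {FF : Filter F}
    (u : T -> \bar R) (c : R) :
  (forall e, 0 < e -> \forall n \near F, ((c - e)%:E <= u n <= (c + e)%:E)%E) ->
  u n @[n --> F] --> c%:E.
Proof.
move=> H; have fin : \forall n \near F, u n \is a fin_num.
  near=> n; have : ((c - 1)%:E <= u n <= (c + 1)%:E)%E by near: n; exact: H.
  by case: (u n) => //=; rewrite ?leeNy_eq ?andbF.
apply/fine_cvgP; split => //.
apply/cvgrPdist_le => e e0; near=> n.
have un : u n \is a fin_num by near: n.
have : ((c - e)%:E <= u n <= (c + e)%:E)%E by near: n; exact: H.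
rewrite -[u n]fineK// !lee_fin => /andP[h1 h2] /=.
by rewrite ler_norml; apply/andP; split; lra.
Unshelve. all: by end_near. Qed.

Lemma cvge_near_eps (R : realType) (T : Type) (F : set_system T) {FF : Filter F}
    (u : T -> \bar R) (c : R) :
  u n @[n --> F] --> c%:E -> forall e, 0 < e ->
  \forall n \near F, ((c - e)%:E <= u n <= (c + e)%:E)%E.
Proof.
move=> /fine_cvgP[ufin /cvgrPdist_le uc] e e0.
near=> n; have un : u n \is a fin_num by near: n.
have : `|c - fine (u n)| <= e by near: n; exact: uc.
rewrite -[u n]fineK// !lee_fin ler_norml => /andP[h1 h2].
by apply/andP; split; lra.
Unshelve. all: by end_near. Qed.

Lemma cvge_lt_near (R : realType) (T : Type) (F : set_system T) {FF : Filter F}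
    (u : T -> \bar R) (c : R) (x : R) : (c < x)%R -> u n @[n --> F] --> c%:E ->
  \forall n \near F, (u n < x%:E)%E.
Proof.
move=> cx uc; apply: filterS (cvge_near_eps uc (_ : 0 < (x - c) / 2)) => [n /andP[_]|].
  by move=> /le_lt_trans; apply; rewrite lte_fin; lra.
by rewrite divr_gt0// subr_gt0.
Qed.

Lemma cvge_gt_near (R : realType) (T : Type) (F : set_system T) {FF : Filter F}
    (u : T -> \bar R) (c : R) (x : R) : (x < c)%R -> u n @[n --> F] --> c%:E ->
  \forall n \near F, (x%:E < u n)%E.
Proof.
move=> cx uc; apply: filterS (cvge_near_eps uc (_ : 0 < (c - x) / 2)) => [n /andP[+ _]|].
  by apply: lt_le_trans; rewrite lte_fin; lra.
by rewrite divr_gt0// subr_gt0.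
Qed.

Lemma ge0_integral_cutoff (d : measure_display) (T : measurableType d) (R : realType)
    (m : {measure set T -> \bar R}) (f : T -> R) (c : nat -> T -> R) :
  measurable_fun setT f -> (forall n, measurable_fun setT (c n)) ->
  (forall x, 0 <= f x) -> (forall n x, 0 <= c n x) ->
  (forall x, {homo c ^~ x : n k / (n <= k)%N >-> n <= k}) ->
  (forall x, \forall n \near \oo, c n x = 1) ->
  (\int[m]_x (f x * c n x)%:E)%E @[n --> \oo] --> (\int[m]_x (f x)%:E)%E.
Proof.
move=> mf mc f0 c0 ch c1.
pose g n x := (f x * c n x)%:E.
have -> : (\int[m]_x (f x)%:E = \int[m]_x limn (g ^~ x))%E.
  apply: eq_integral => x _; apply/esym/cvg_lim => //.
  apply: cvg_near_cst; near=> n; rewrite /g; have -> : c n x = 1 by near: n; exact: c1.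
  by rewrite mulr1.
apply: cvg_monotone_convergence => //.
- by move=> n; apply/measurable_EFinP/measurable_funM.
- by move=> n x _; rewrite lee_fin mulr_ge0.
- by move=> x _ n k nk; rewrite /g lee_fin ler_wpM2l// ch.
Unshelve. all: by end_near. Qed.

(** * Continuous substitutes for indicators *)

Section cutoffs.
Context {R : realType}.
Implicit Types (u v M x : R).

Lemma clamp01_continuous : continuous (fun t : R => Num.max 0 (Num.min 1 t)).
Proof.
have -> : (fun t : R => Num.max 0 (Num.min 1 t)) =
    (fun t => (1 + `|t| - `|t - 1|) * 2^-1).
  apply/funext => t; have [t1|t1] := leP 1 t.
    by rewrite max_r ?ler01// !ger0_norm ?subr_ge0//; [lra|lra].
  have [t0|t0] := leP 0 t.
    by rewrite ger0_norm// ler0_norm; lra.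
  by rewrite ltr0_norm// ltr0_norm; lra.
move=> t; apply: cvgMl; apply: cvgB.
  by apply: cvgD; [exact: cvg_cst|exact: norm_continuous].
apply: cvg_norm; apply: cvgB; [exact: cvg_id|exact: cvg_cst].
Qed.

Definition ramp u v x : R := Num.max 0 (Num.min 1 ((x - u) / (v - u))).
Definition cut M x : R := Num.max 0 (Num.min 1 (M + 1 - `|x|)).

Lemma ramp_ge0 u v x : 0 <= ramp u v x. Proof. by rewrite le_max lexx. Qed.
Lemma ramp_le1 u v x : ramp u v x <= 1.
Proof. by rewrite ge_max ler01 ge_min lexx. Qed.
Lemma ramp0 u v x : u < v -> x <= u -> ramp u v x = 0.
Proof.
move=> uv xu; apply/max_l; rewrite ge_min; apply/orP; right.
by rewrite ler_pdivrMr ?subr_gt0// mul0r subr_le0.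
Qed.
Lemma ramp1 u v x : u < v -> v <= x -> ramp u v x = 1.
Proof.
move=> uv vx; rewrite /ramp [Num.min _ _]min_l ?max_r//.
by rewrite ler_pdivlMr ?subr_gt0// mul1r lerD2r.
Qed.
Lemma ramp_continuous u v : continuous (ramp u v).
Proof.
move=> x; apply: (@continuous_comp _ _ _ (fun x => (x - u) / (v - u))
  (fun t => Num.max 0 (Num.min 1 t))); last exact: clamp01_continuous.
by apply: cvgMl; apply: cvgB; [exact: cvg_id|exact: cvg_cst].
Qed.

Lemma cut_ge0 M x : 0 <= cut M x. Proof. by rewrite le_max lexx. Qed.
Lemma cut_le1 M x : cut M x <= 1.
Proof. by rewrite ge_max ler01 ge_min lexx. Qed.
Lemma cut0 M x : M + 1 <= `|x| -> cut M x = 0.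
Proof. by move=> xM; apply/max_l; rewrite ge_min subr_le0 xM orbT. Qed.
Lemma cut1 M x : `|x| <= M -> cut M x = 1.
Proof.
move=> xM; rewrite /cut [Num.min _ _]min_l ?max_r//.
by rewrite -addrA addrCA lerDl subr_ge0.
Qed.
Lemma cut_continuous M : continuous (cut M).
Proof.
move=> x; apply: (@continuous_comp _ _ _ (fun x => M + 1 - `|x|)
  (fun t => Num.max 0 (Num.min 1 t))); last exact: clamp01_continuous.
by apply: cvgB; [exact: cvg_cst|exact: norm_continuous].
Qed.
Lemma cut_homo x : {homo cut ^~ x : M M' / M <= M'}.
Proof.
move=> M M' MM'; rewrite /cut ge_max le_max lexx/= le_max le_min !ge_min lexx/=.
by rewrite [X in _ || (_ || X)](_ : _ = true) ?orbT// lerD2r lerD2r.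
Qed.
Lemma cut_near1 x : \forall n \near \oo, cut n%:R x = 1.
Proof. by near=> n; apply: cut1; near: n; exact: nbhs_infty_ger. Unshelve. all: by end_near. Qed.

Lemma measurable_ramp u v : measurable_fun setT (ramp u v).
Proof. by apply: continuous_measurable_fun; exact: ramp_continuous. Qed.

Lemma measurable_cut M : measurable_fun setT (cut M).
Proof. by apply: continuous_measurable_fun; exact: cut_continuous. Qed.

End cutoffs.

Ltac meas_base ::= first [exact: measurable_ramp | exact: measurable_cut].

(** * Tail moments from vague convergence and one mixed moment *)

Section tail_moments.
Context {R : realType}.
Local Notation RR := (measurableTypeR R * measurableTypeR R)%type.
Context (mu_ : nat -> {measure set RR -> \bar R})
  (mu : {measure set RR -> \bar R}) (Psi : cumulativeBounded (0:R) (1:R)).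
Local Notation lsf := (lebesgue_stieltjes_measure Psi).
Hypothesis vague : forall (C : R) (F G : R -> R), continuous F -> continuous G ->
  (forall x, 0 <= F x) -> (forall x, 0 <= G x) ->
  (forall x, x <= - C -> F x = 0) -> (forall x, C <= x -> F x = F C) ->
  (forall x, x <= - C -> G x = 0) -> (forall x, C <= x -> G x = 0) ->
  (\int[mu_ n]_p (F p.1 * G p.2)%:E)%E @[n --> \oo] -->
  (\int[mu]_p (F p.1 * G p.2)%:E)%E.
Hypothesis muE : forall x y : R,
  mu [set p | x <= p.1 /\ p.2 <= y] = (expR (- x) * Psi y)%:E.
Hypothesis second_moment : forall e : R, 0 < e ->
  (\int[mu_ n]_p ((- e <= p.1)%R%:R * (`|p.1| * p.2 ^+ 2))%:E)%E @[n --> \oo] -->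
  (\int[mu]_p ((- e <= p.1)%R%:R * (`|p.1| * p.2 ^+ 2))%:E)%E.
Hypothesis normalized : (\int[lsf]_y (y ^+ 2)%:E = 1)%E.

Let msqr : measurable_fun setT (fun y : R => y ^+ 2).
Proof. exact: exprn_measurable. Qed.

Let strip_sum e (p : RR) : 0 < e ->
  (- e <= p.1)%R%:R * (`|p.1| * p.2 ^+ 2) <=
  e * ((- e <= p.1)%R%:R * p.2 ^+ 2) + (0 <= p.1)%R%:R * (`|p.1| * p.2 ^+ 2).
Proof.
move=> e0; have y0 := sqr_ge0 p.2; have [p0|p0] := leP 0 p.1.
  have pe : - e <= p.1 by lra.
  by rewrite pe !mul1r lerDr; apply: mulr_ge0 => //; exact: ltW.
rewrite mul0r addr0; have [pe|pe] := leP (- e) p.1; last by rewrite !mul0r mulr0.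
by rewrite !mul1r ler_wpM2r// ltr0_norm//; lra.
Qed.

(** For -e <= x < 0 the weight |x| is at most e, and the tail { x >= -e } carries the second moment
    exp e. The strip left of 0 therefore costs at most e exp e, which vanishes with e. *)
Lemma strip_moment_split e : 0 < e ->
  (\int[mu]_p ((- e <= p.1)%R%:R * (`|p.1| * p.2 ^+ 2))%:E <=
   (e * expR e)%:E + \int[mu]_p ((0 <= p.1)%R%:R * (`|p.1| * p.2 ^+ 2))%:E)%E.
Proof.
move=> e0; have -> : ((e * expR e)%:E =
    \int[mu]_p (e * ((- e <= p.1)%R%:R * p.2 ^+ 2))%:E)%E.
  rewrite ge0_integral_const ?ltW//.
  - rewrite (ge0_integral_tail muE (- e) msqr (@sqr_ge0 R)).
    by rewrite normalized opprK mule1 EFinM.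
  - by meas.
  - by move=> p; rewrite ?(sqr_ge0, mulr_ge0).
rewrite -ge0_integralD_fin//.
- apply: ge0_le_integral_fin => [||p|p]; [by meas|by meas| |exact: strip_sum].
  by rewrite ?(sqr_ge0, mulr_ge0).
- by meas.
- by meas.
- by move=> p; rewrite ?(sqr_ge0, mulr_ge0)// ltW.
- by move=> p; rewrite ?(sqr_ge0, mulr_ge0).
Qed.

Lemma strip_moment_fin e : 0 < e -> exists c,
  (\int[mu]_p ((- e <= p.1)%R%:R * (`|p.1| * p.2 ^+ 2))%:E = c%:E)%E.
Proof.
move=> e0.
have /andP[_ up] := @ge0_integral_mesh _ _ _ muE 1 1 (fun y => y ^+ 2) ltr01
  msqr (@sqr_ge0 R) normalized.
have := le_trans (strip_moment_split e0) (leeD2l _ up).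
have : (0 <= \int[mu]_p ((- e <= p.1)%R%:R * (`|p.1| * p.2 ^+ 2))%:E)%E.
  by apply: integral_ge0 => p _; rewrite lee_fin ?(sqr_ge0, mulr_ge0).
by case: integral => // r _ _; exists r.
Qed.

(** Produces a continuous minorant of |x| y^2 on { x >= -e }, of bounded support in both variables,
    that loses at most [del] of the mass: half of it left of 0, by the choice of e, and half by the
    cutoff at M, by monotone convergence. *)
Lemma strip_cutoff (del : R) : 0 < del -> exists e (M : nat) (H K : R),
  [/\ 0 < e,
   (\int[mu]_p ((- e <= p.1)%R%:R * (`|p.1| * p.2 ^+ 2))%:E = H%:E)%E,
   (\int[mu]_p ((`|p.1| * ramp (- e) 0 p.1 * cut M%:R p.1) *
     (p.2 ^+ 2 * cut M%:R p.2))%:E = K%:E)%E & H - K <= del].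
Proof.
move=> del0; pose e := Num.min 1 (del / 2 / expR 1).
have e0 : 0 < e by rewrite lt_min ltr01/= !divr_gt0// expR_gt0.
have e1 : e <= 1 by rewrite ge_min lexx.
have ee : e * expR e <= del / 2.
  apply: (@le_trans _ _ (e * expR 1)).
    by rewrite ler_wpM2l ?ler_expR// ltW.
  by rewrite -ler_pdivlMr ?expR_gt0// ge_min lexx orbT.
have [H intH] := strip_moment_fin e0.
pose f (p : RR) := `|p.1| * ramp (- e) 0 p.1 * p.2 ^+ 2.
have mf : measurable_fun setT f by rewrite /f; meas.
have f0 p : 0 <= f p by rewrite ?(sqr_ge0, ramp_ge0, mulr_ge0).
pose c n (p : RR) := cut n%:R p.1 * cut n%:R p.2.
have c0 n p : 0 <= c n p by rewrite mulr_ge0 ?cut_ge0.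
have intf_le : (\int[mu]_p (f p)%:E <= H%:E)%E.
  rewrite -intH; apply: ge0_le_integral_fin => //; first by meas.
  move=> p; rewrite /f; have [pe|pe] := leP (- e) p.1.
    rewrite mul1r ler_wpM2r ?sqr_ge0//.
    by rewrite -[leRHS]mulr1 ler_wpM2l// ramp_le1.
  by rewrite mul0r ramp0 ?mulr0 ?mul0r ?oppr_lt0// ltW.
have [I intf] : exists I, (\int[mu]_p (f p)%:E = I%:E)%E.
  have : (0 <= \int[mu]_p (f p)%:E)%E by apply: integral_ge0 => p _; rewrite lee_fin.
  by move: intf_le; case: integral => // r; exists r.
have HI : H <= del / 2 + I.
  rewrite -lee_fin -intH EFinD -intf (le_trans (strip_moment_split e0))// leeD//.
  apply: ge0_le_integral_fin => // [|p|p]; first by meas.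
    by rewrite ?(sqr_ge0, mulr_ge0).
  rewrite /f; have [p0|p0] := leP 0 p.1; last by rewrite mul0r f0.
  by rewrite ramp1 ?oppr_lt0// mulr1 mul1r.
have : (\int[mu]_p (f p * c n p)%:E)%E @[n --> \oo] --> (\int[mu]_p (f p)%:E)%E.
  apply: ge0_integral_cutoff => //.
  - by move=> n; rewrite /c; meas.
  - by move=> p n k nk; rewrite /c ler_pM ?cut_ge0// cut_homo// ler_nat.
  - move=> p; near=> n; rewrite /c.
    by rewrite (_ : cut _ p.1 = 1) 1?(_ : cut _ p.2 = 1) ?mulr1//;
      near: n; exact: cut_near1.
rewrite intf => /cvge_near_eps /(_ (del / 2)); rewrite divr_gt0// => /(_ isT).
move=> [N _ /(_ N (leqnn N))].
have : (0 <= \int[mu]_p (f p * c N p)%:E)%E.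
  by apply: integral_ge0 => p _; rewrite lee_fin mulr_ge0.
case intc: integral => [r||] //; rewrite ?andbF// !lee_fin => _ /andP[Ir _].
exists e, N, H, r; split => //; last lra.
rewrite -intc; apply: eq_integral => p _; congr (_%:E).
by rewrite /f /c; ring.
Unshelve. all: by end_near. Qed.

(** The weighted total converges by Assumption 2 and its part of bounded support by vague
    convergence, so the remainder stays small along the sequence. On { x > s } the weight |x|
    exceeds s and can be divided out; this is what s > 0 is for. *)
Lemma tail_second_moment_ui (s del : R) : 0 < s -> 0 < del -> exists M : nat,
  \forall n \near \oo,
  (\int[mu_ n]_p ((s < p.1)%R%:R * (p.2 ^+ 2 * (1 - cut M%:R p.2)))%:E <= del%:E)%E.
Proof.
(* The remainder is at most (H + d) - (K - d) <= 3 d = s del. *)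
move=> s0 del0; pose d := del * s / 3.
have d0 : 0 < d by rewrite divr_gt0// mulr_gt0.
have [e [M [H [K [e0 intH intK HK]]]]] := strip_cutoff d0.
exists M.
have := second_moment e0; rewrite intH => /cvge_near_eps /(_ _ d0) nearH.
have : (\int[mu_ n]_p ((`|p.1| * ramp (- e) 0 p.1 * cut M%:R p.1) *
     (p.2 ^+ 2 * cut M%:R p.2))%:E)%E @[n --> \oo] --> K%:E.
  rewrite -intK.
  apply: (@vague (e + M%:R + 1) (fun x => `|x| * ramp (- e) 0 x * cut M%:R x)
    (fun y => y ^+ 2 * cut M%:R y)).
  - move=> x; apply: cvgM; last exact: cut_continuous.
    by apply: cvgM; [exact: norm_continuous|exact: ramp_continuous].
  - move=> x; apply: cvgM; last exact: cut_continuous.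
    exact: exprn_continuous.
  - by move=> x; rewrite ?(ramp_ge0, cut_ge0, mulr_ge0).
  - by move=> x; rewrite ?(sqr_ge0, cut_ge0, mulr_ge0).
  - move=> x xC; rewrite ramp0 ?mulr0 ?mul0r ?oppr_lt0//.
    by apply: (le_trans xC); rewrite lerN2 -addrA lerDl addr_ge0.
  - move=> x xC; rewrite !(@cut0 _ M%:R) ?mulr0//.
    + by rewrite ger0_norm; [rewrite -addrA lerDr ltW|rewrite !addr_ge0// ltW].
    + apply: le_trans (ler_norm _); apply: le_trans xC.
      by rewrite -addrA lerDr ltW.
  - move=> x xC; rewrite cut0 ?mulr0//.
    rewrite -normrN (le_trans _ (ler_norm _))// lerNr (le_trans xC)// lerN2.
    by rewrite -addrA lerDr ltW.
  - move=> x xC; rewrite cut0 ?mulr0//.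
    apply: le_trans (ler_norm _); apply: le_trans xC.
    by rewrite -addrA lerDr ltW.
move=> /cvge_near_eps /(_ _ d0) nearK.
near=> n.
have /andP[_ nH] : ((H - d)%:E <= \int[mu_ n]_p ((- e <= p.1)%R%:R *
  (`|p.1| * p.2 ^+ 2))%:E <= (H + d)%:E)%E by near: n.
have /andP[nK _] : ((K - d)%:E <= \int[mu_ n]_p ((`|p.1| * ramp (- e) 0 p.1 *
  cut M%:R p.1) * (p.2 ^+ 2 * cut M%:R p.2))%:E <= (K + d)%:E)%E by near: n.
have U0 (p : RR) : 0 <= (s < p.1)%R%:R * (p.2 ^+ 2 * (1 - cut M%:R p.2)).
  by rewrite mulr_ge0// mulr_ge0 ?sqr_ge0// subr_ge0 cut_le1.
have F0 (p : RR) : 0 <= (`|p.1| * ramp (- e) 0 p.1 * cut M%:R p.1) *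
     (p.2 ^+ 2 * cut M%:R p.2).
  by rewrite ?(sqr_ge0, ramp_ge0, cut_ge0, mulr_ge0).
have key : (s%:E * \int[mu_ n]_p ((s < p.1)%R%:R * (p.2 ^+ 2 * (1 - cut M%:R p.2)))%:E
   + \int[mu_ n]_p ((`|p.1| * ramp (- e) 0 p.1 * cut M%:R p.1) *
     (p.2 ^+ 2 * cut M%:R p.2))%:E <= \int[mu_ n]_p ((- e <= p.1)%R%:R *
  (`|p.1| * p.2 ^+ 2))%:E)%E.
  rewrite -ge0_integral_const//; [|by meas|exact: ltW].
  rewrite -ge0_integralD_fin//; [|by meas|by meas|by move=> p; rewrite mulr_ge0// ltW].
  apply: ge0_le_integral_fin; [by meas|by meas| |].
    by move=> p; rewrite addr_ge0// mulr_ge0// ltW.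
  move=> p; have y0 := sqr_ge0 p.2.
  have FG : `|p.1| * ramp (- e) 0 p.1 * cut M%:R p.1 * (p.2 ^+ 2 * cut M%:R p.2)
      <= `|p.1| * (p.2 ^+ 2 * cut M%:R p.2).
    apply: ler_wpM2r; first by rewrite mulr_ge0 ?cut_ge0.
    rewrite -mulrA -[leRHS]mulr1 ler_wpM2l// mulr_ile1 ?ramp_ge0 ?cut_ge0 ?ramp_le1//.
    exact: cut_le1.
  have [sp|ps] := ltP s p.1.
    have pe : - e <= p.1 by lra.
    rewrite pe !mul1r; apply: (le_trans (lerD (lexx _) FG)).
    apply: (@le_trans _ _ (`|p.1| * (p.2 ^+ 2 * (1 - cut M%:R p.2)) +
       `|p.1| * (p.2 ^+ 2 * cut M%:R p.2))).
      rewrite lerD2r; apply: ler_wpM2r.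
        by apply: mulr_ge0 => //; rewrite subr_ge0 cut_le1.
      exact: le_trans (ltW sp) (ler_norm _).
    by rewrite -mulrDr -mulrDr subrK mulr1.
  rewrite mul0r mulr0 add0r; have [pe|pe] := leP (- e) p.1.
    rewrite mul1r (le_trans FG)// ler_wpM2l// -[leRHS]mulr1 ler_wpM2l//.
    exact: cut_le1.
  by rewrite ramp0 ?mulr0 ?mul0r// ?oppr_lt0// ltW.
have : (s%:E * \int[mu_ n]_p ((s < p.1)%R%:R * (p.2 ^+ 2 * (1 - cut M%:R p.2)))%:E
   + (K - d)%:E <= (H + d)%:E)%E.
  by apply: le_trans nH; apply: le_trans key; rewrite leeD2l.
have : (0 <= \int[mu_ n]_p ((s < p.1)%R%:R * (p.2 ^+ 2 * (1 - cut M%:R p.2)))%:E)%E.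
  by apply: integral_ge0 => p _; rewrite lee_fin.
case: integral => [r||]//; last by rewrite gt0_muley ?lte_fin.
rewrite -EFinM -EFinD !lee_fin => _ sr.
rewrite -(ler_pM2l s0); have -> : s * del = 3 * d by rewrite /d; field.
lra.
Unshelve. all: by end_near. Qed.

(** The limit is only located between the tails at v and at u, which is enough because u and v are
    chosen close together afterwards. *)
Lemma ramp_cut_cvg (u v M Gm : R) (g : R -> R) : u < v -> 0 <= M ->
  continuous g -> (forall y, 0 <= g y) ->
  (\int[lsf]_y (g y * cut M y)%:E = Gm%:E)%E ->
  exists L : R, [/\ expR (- v) * Gm <= L, L <= expR (- u) * Gm &
    (\int[mu_ n]_p (ramp u v p.1 * (g p.2 * cut M p.2))%:E)%E @[n --> \oo] --> L%:E].
Proof.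
move=> uv M0 cg g0 gG.
have mg : measurable_fun setT g by exact: continuous_measurable_fun.
have mgc : measurable_fun setT (fun y => g y * cut M y) by meas.
have gc0 y : 0 <= g y * cut M y by rewrite mulr_ge0 ?cut_ge0.
have lo : ((expR (- v) * Gm)%:E <=
    \int[mu]_p (ramp u v p.1 * (g p.2 * cut M p.2))%:E)%E.
  rewrite EFinM -gG -(ge0_integral_tail muE v mgc gc0).
  apply: ge0_le_integral_fin; [by meas|by meas| |] => p; first by rewrite mulr_ge0.
  rewrite ler_wpM2r//; have [vp|_] := leP v p.1; last exact: ramp_ge0.
  by rewrite ramp1.
have hi : (\int[mu]_p (ramp u v p.1 * (g p.2 * cut M p.2))%:E <=
    (expR (- u) * Gm)%:E)%E.
  rewrite EFinM -gG -(ge0_integral_tail muE u mgc gc0).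
  apply: ge0_le_integral_fin; [by meas|by meas| |] => p.
    by rewrite mulr_ge0 ?ramp_ge0.
  rewrite ler_wpM2r//; have [up|/ltW pu] := leP u p.1; first exact: ramp_le1.
  by rewrite ramp0.
have [L LE] : exists L, (\int[mu]_p (ramp u v p.1 * (g p.2 * cut M p.2))%:E = L%:E)%E.
  by move: lo hi; case: integral => // r; exists r.
exists L; split; rewrite -?lee_fin -?LE//.
have uC : `|u| <= `|u| + `|v| + M + 1 by rewrite -!addrA lerDl !addr_ge0.
have vC : `|v| <= `|u| + `|v| + M + 1.
  by rewrite -!addrA addrCA lerDl !addr_ge0.
have MC : M + 1 <= `|u| + `|v| + M + 1 by rewrite -addrA lerDr addr_ge0.
apply: (@vague (`|u| + `|v| + M + 1) (ramp u v) (fun y => g y * cut M y)).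
- exact: ramp_continuous.
- by move=> y; apply: cvgM; [exact: cg|exact: cut_continuous].
- exact: ramp_ge0.
- exact: gc0.
- move=> x xC; rewrite ramp0// (le_trans xC)// lerNl (le_trans _ uC)//.
  by rewrite -normrN ler_norm.
- move=> x xC; rewrite !ramp1//; last by rewrite (le_trans _ xC)// (le_trans _ vC)// ler_norm.
  by rewrite (le_trans _ vC)// ler_norm.
- move=> x xC; rewrite cut0 ?mulr0//.
  by rewrite -normrN (le_trans _ (ler_norm _))// (le_trans MC)// lerNr.
- move=> x xC; rewrite cut0 ?mulr0//.
  by rewrite (le_trans _ (ler_norm _))// (le_trans MC).
Qed.

(** From below, a ramp on [s, s + eta] and a cutoff in y suffice. From above, a ramp on [s - eta, s]
    handles the cut part of g, and what the cutoff removes is bounded through the uniform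
    integrability of y^2. *)
Lemma cvg_tail (s C G : R) (g : R -> R) : 0 < s -> continuous g ->
  (forall y, 0 <= g y) -> (forall y, g y <= C * (1 + y ^+ 2)) ->
  (\int[lsf]_y (g y)%:E = G%:E)%E ->
  (\int[mu_ n]_p ((s < p.1)%R%:R * g p.2)%:E)%E @[n --> \oo] --> (expR (- s) * G)%:E.
Proof.
move=> s0 cg g0 gC gG.
have mg : measurable_fun setT g by exact: continuous_measurable_fun.
have G0 : 0 <= G.
  by rewrite -lee_fin -gG; apply: integral_ge0 => y _; rewrite lee_fin.
have C0 : 0 <= C.
  by have := le_trans (g0 0) (gC 0); rewrite expr0n addr0 mulr1.
have cutG (M : R) : exists2 Gm, (\int[lsf]_y (g y * cut M y)%:E = Gm%:E)%E & Gm <= G.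
  have : (\int[lsf]_y (g y * cut M y)%:E <= \int[lsf]_y (g y)%:E)%E.
    apply: ge0_le_integral_fin => //; first by meas.
      by move=> y; rewrite mulr_ge0 ?cut_ge0.
    by move=> y; rewrite -[leRHS]mulr1 ler_wpM2l// cut_le1.
  have : (0 <= \int[lsf]_y (g y * cut M y)%:E)%E.
    by apply: integral_ge0 => y _; rewrite lee_fin mulr_ge0 ?cut_ge0.
  rewrite gG; case: integral => // r _; rewrite lee_fin => rG.
  by exists r.
have cutcvg : (\int[lsf]_y (g y * cut n%:R y)%:E)%E @[n --> \oo] --> G%:E.
  rewrite -gG; apply: ge0_integral_cutoff => //.
  - by move=> n; meas.
  - by move=> n y; exact: cut_ge0.
  - by move=> y n k nk; rewrite cut_homo// ler_nat.
  - by move=> y; exact: cut_near1.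
apply: cvge_squeeze_eps => e e0; near=> n; apply/andP; split; near: n.
- have [eta eta0 etaE] : exists2 eta, 0 < eta &
      expR (- s) * G - e / 2 <= expR (- (s + eta)) * (G - eta).
    have : (fun x => expR (- (s + x)) * (G - x)) x @[x --> (0:R)^'+] -->
        expR (- (s + 0)) * (G - 0).
      apply: cvg_at_right_filter; apply: cvgM; last first.
        by apply: cvgB; [exact: cvg_cst|exact: cvg_id].
      apply: continuous_comp; last exact: continuous_expR.
      by apply: cvgN; apply: cvgD; [exact: cvg_cst|exact: cvg_id].
    rewrite addr0 subr0 => /cvgrPdist_le /(_ (e / 2)).
    rewrite divr_gt0// => /(_ isT) nearE.
    near (0:R)^'+ => x; exists x => //.
    have : `|expR (- s) * G - expR (- (s + x)) * (G - x)| <= e / 2 by near: x.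
    by rewrite ler_norml => /andP[_]; lra.
  have /cvge_near_eps /(_ _ eta0) [M _ /(_ M (leqnn M))] := cutcvg.
  have [Gm GmE GmG] := cutG M%:R; rewrite GmE !lee_fin => /andP[Gm_ge _].
  have sseta : s < s + eta by rewrite ltrDl.
  have [L [L1 L2 Lcvg]] := @ramp_cut_cvg s (s + eta) M%:R Gm g
    sseta (ler0n _ _) cg g0 GmE.
  have e20 : 0 < e / 2 by rewrite divr_gt0.
  apply: filterS (cvge_near_eps Lcvg e20) => n /andP[h _].
  apply: (@le_trans _ _ (L - e / 2)%:E).
    rewrite lee_fin; suff : expR (- s) * G - e / 2 <= L by lra.
    apply: (le_trans etaE); apply: le_trans L1.
    by rewrite ler_wpM2l ?expR_ge0//; lra.
  apply: (le_trans h); apply: ge0_le_integral_fin; [by meas|by meas| |] => p.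
    by rewrite ?(g0, ramp_ge0, cut_ge0, mulr_ge0).
  have [sp|ps] := ltP s p.1; last by rewrite ramp0// !mul0r.
  rewrite mul1r -[leRHS]mul1r ler_pM ?ramp_ge0 ?ramp_le1 ?mulr_ge0 ?cut_ge0//.
  by rewrite -[leRHS]mulr1 ler_wpM2l// cut_le1.
- have e30 : 0 < e / 3 by rewrite divr_gt0.
  have [eta [eta0 etas etaE]] : exists eta, [/\ 0 < eta, eta < s &
      expR (- (s - eta)) * G <= expR (- s) * G + e / 3].
    have : (fun x => expR (- (s - x)) * G) x @[x --> (0:R)^'+] -->
        expR (- (s - 0)) * G.
      apply: cvg_at_right_filter; apply: cvgMl.
      apply: continuous_comp; last exact: continuous_expR.
      by apply: cvgN; apply: cvgB; [exact: cvg_cst|exact: cvg_id].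
    rewrite subr0 => /cvgrPdist_le /(_ _ e30) nearE.
    near (0:R)^'+ => x; exists x; split => //.
    have : `|expR (- s) * G - expR (- (s - x)) * G| <= e / 3 by near: x.
    by rewrite ler_norml => /andP[+ _]; lra.
  (* Where |y| >= 1, C (1 + y^2) <= 2 C y^2; the added 1 covers C = 0. *)
  pose del := e / 3 / (2 * C + 1).
  have C1 : 0 < 2 * C + 1 by rewrite ltr_wpDl// mulr_ge0.
  have del0 : 0 < del by rewrite divr_gt0.
  have [M0 nearM] := tail_second_moment_ui s0 del0.
  (* With M >= 1, |y| > 1 wherever [cut M] is below 1. *)
  pose M := maxn M0 1.
  have [Gm GmE GmG] := cutG M%:R.
  have seta : s - eta < s by rewrite ltrBlDr ltrDl.
  have [L [L1 L2 Lcvg]] := @ramp_cut_cvg (s - eta) s M%:R Gm g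
    seta (ler0n _ _) cg g0 GmE.
  apply: filterS2 nearM (cvge_near_eps Lcvg e30) => n nM /andP[_ nL].
  pose U (p : RR) := (s < p.1)%R%:R * (p.2 ^+ 2 * (1 - cut M0%:R p.2)).
  have U0 p : 0 <= U p.
    rewrite mulr_ge0// mulr_ge0 ?sqr_ge0//.
    by rewrite subr_ge0 cut_le1.
  have CU : ((2 * C)%:E * del%:E <= (e / 3)%:E)%E.
    rewrite -EFinM lee_fin /del mulrA ler_pdivrMr// mulrC ler_wpM2l ?ltW//.
    by rewrite ltrDl.
  apply: (@le_trans _ _ ((L + e / 3)%:E + (2 * C)%:E * del%:E)%E); last first.
    apply: (@le_trans _ _ ((L + e / 3)%:E + (e / 3)%:E)%E); first by rewrite leeD2l.
    rewrite -EFinD lee_fin.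
    have : L <= expR (- (s - eta)) * G.
      by apply: (le_trans L2); rewrite ler_wpM2l ?expR_ge0.
    lra.
  apply: le_trans; last first.
    apply: leeD; first exact: nL.
    by apply: lee_wpmul2l nM; rewrite lee_fin mulr_ge0.
  have C20 : 0 <= 2 * C by rewrite mulr_ge0.
  rewrite -ge0_integral_const//; last by rewrite /U; meas.
  rewrite -ge0_integralD_fin//; last 4 first.
  + by meas.
  + by meas.
  + by move=> p; rewrite ?(g0, ramp_ge0, cut_ge0, mulr_ge0).
  + by move=> p; rewrite mulr_ge0// U0.
  apply: ge0_le_integral_fin; [by meas|by meas|by move=> p; rewrite mulr_ge0|] => p.
  have [sp|ps] := ltP s p.1; last first.
    by rewrite !mul0r mulr0 addr0 ?(g0, ramp_ge0, cut_ge0, mulr_ge0).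
  rewrite (ramp1 seta (ltW sp)) !mul1r.
  apply: (@le_trans _ _ (g p.2 * cut M%:R p.2 + g p.2 * (1 - cut M%:R p.2))).
    by rewrite -mulrDr addrC subrK mulr1.
  rewrite lerD2l.
  have cM : 1 - cut M%:R p.2 <= 1 - cut M0%:R p.2.
    by rewrite lerD2l lerN2 cut_homo// ler_nat leq_maxl.
  have cM0 : 0 <= 1 - cut M%:R p.2 by rewrite subr_ge0 cut_le1.
  have [pM|Mp] := leP `|p.2| M%:R.
    rewrite cut1// subrr mulr0 ?(C20, sqr_ge0, mulr_ge0)// subr_ge0.
    exact: cut_le1.
  have p1 : 1 <= p.2 ^+ 2.
    rewrite -real_normK ?num_real// exprn_ege1// (le_trans _ (ltW Mp))//.
    by rewrite ler1n leq_maxr.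
  rewrite mulrA; apply: ler_pM => //.
  apply: (le_trans (gC _)); rewrite -mulrA mulrCA ler_wpM2l//; lra.
Unshelve. all: by end_near. Qed.

End tail_moments.

(** * The tail quantile function *)

Section quantile.
Context d (T : measurableType d) (R : realType) (P : probability T R).
Context (X : {RV P >-> R}) (b : R -> R).
Hypothesis endpoint : infinite_right_endpoint X.
Hypothesis quantile : forall t, 1 < t ->
  b t = generalized_inverse (fun x => (1 - dfun X x)^-1) t.

Lemma measurable_gt_rv (x : R) : measurable [set w | x < X w].
Proof.
rewrite -[X in measurable X]setTI -[mkset _]/((fun w => x < X w) @^-1` [set true]).
by apply: measurable_fun_ltr.
Qed.

Lemma dfunE (x : R) : (dfun X x)%:E = P [set w | X w <= x].
Proof.
rewrite /dfun fineK; last by rewrite fin_num_measure.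
by rewrite /cdf /distribution /pushforward; congr (P _); apply/seteqP; split => w /=;
  rewrite in_itv.
Qed.

Lemma tail_dfun (x : R) : P [set w | x < X w] = (1 - dfun X x)%:E.
Proof.
rewrite EFinB dfunE -probability_setC.
  by congr (P _); apply/seteqP; split => w /=; rewrite ltNge => /negP.
rewrite -[X in measurable X]setTI -[mkset _]/((fun w => X w <= x) @^-1` [set true]).
by apply: measurable_fun_ler.
Qed.

Lemma dfun_nd : {homo dfun X : x y / x <= y}.
Proof.
move=> x y xy; apply: fine_le; rewrite ?fin_num_measure//.
exact: cdf_nondecreasing.
Qed.

Lemma dfun_right_continuous (x : R) : dfun X y @[y --> x^'+] --> dfun X x.
Proof.
apply: fine_cvg; rewrite /dfun fineK ?fin_num_measure//.
exact: cdf_right_continuous.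
Qed.

Let S t := [set x | t <= (1 - dfun X x)^-1].

Let SE t x : 0 < t -> S t x <-> 1 - dfun X x <= t^-1.
Proof.
move=> t0; rewrite /S/= -[in t <= _](invrK t) lef_pV2 ?posrE ?invr_gt0//.
by rewrite subr_gt0.
Qed.

Let S_neq0 t : 0 < t -> S t !=set0.
Proof.
move=> t0; have : 1 - dfun X x @[x --> +oo] --> (1 - 1 : R).
  by apply: cvgB; [exact: cvg_cst|exact/fine_cvg/cvg_cdfy1].
rewrite subrr => /cvgrPdist_le /(_ t^-1); rewrite invr_gt0 => /(_ t0) [M [_ HM]].
exists (M + 1); apply/SE => //.
have := HM (M + 1); rewrite ltrDl ltr01 => /(_ isT).
by rewrite sub0r normrN; apply: le_trans; exact: ler_norm.
Qed.

(** Without a lower bound [inf] would take its default value 0. Since F tends to 0 at -oo, 1 - F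
    exceeds 1 / t far to the left as soon as t > 1. *)
Let S_lb t : 1 < t -> has_lbound (S t).
Proof.
move=> t1; have t0 : 0 < t by apply: lt_trans t1.
have : dfun X x @[x --> -oo] --> (0 : R) by exact/fine_cvg/cvg_cdfNy0.
have e0 : 0 < (1 - t^-1) / 2 by rewrite divr_gt0// subr_gt0 invf_lt1.
move=> /cvgrPdist_le /(_ _ e0) [M [_ HM]].
exists (M - 1) => x /SE-/(_ t0) xt; rewrite leNgt; apply/negP => xM.
have := HM x; rewrite sub0r normrN => /(_ _)/wrap[].
  by rewrite (lt_trans xM)// ltrBlDr ltrDl.
by move=> /(le_trans (ler_norm _)); lra.
Qed.

Lemma quantile_nd t u : 1 < t -> t <= u -> b t <= b u.
Proof.
move=> t1 tu; have u1 := lt_le_trans t1 tu.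
rewrite !quantile// /generalized_inverse.
apply: lb_le_inf; first by apply: S_neq0; apply: lt_trans u1.
by move=> x /= ux; apply: ge_inf; [exact: S_lb|exact: le_trans ux].
Qed.

(** F may jump, so [b] is not an exact inverse of the tail; this bound below [b t] and
    [quantile_tail] at [b t] take the place of P(X > b t) = 1 / t. *)
Lemma quantile_lt t x : 1 < t -> x < b t -> (t^-1%:E <= P [set w | (x < X w)%R])%E.
Proof.
move=> t1 xb; rewrite tail_dfun lee_fin leNgt; apply/negP => /ltW xt.
move: xb; rewrite quantile// ltNge => /negP; apply.
by apply: ge_inf; [exact: S_lb|apply/SE => //; exact: lt_trans t1].
Qed.

(** The bound holds strictly to the right of the infimum, and right continuity of F carries it to
    [b t] itself. *)
Lemma quantile_tail t : 1 < t -> (P [set w | (b t < X w)%R] <= t^-1%:E)%E.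
Proof.
move=> t1; have t0 : 0 < t by apply: lt_trans t1.
rewrite tail_dfun lee_fin.
have : 1 - dfun X x @[x --> (b t)^'+] --> 1 - dfun X (b t).
  by apply: cvgB; [exact: cvg_cst|exact: dfun_right_continuous].
move=> /cvgr_to_le; apply; near=> x.
have bx : b t < x by near: x; exact: nbhs_right_gt.
have [y /SE-/(_ t0) yt yx] : exists2 y, S t y & y < x.
  move: bx; rewrite quantile// /generalized_inverse => bx.
  by have [y] := inf_lt (S_neq0 t0) bx; exists y.
by rewrite (le_trans _ yt)// lerD2l lerN2 dfun_nd// ltW.
Unshelve. all: by end_near. Qed.

Lemma quantile_cvgy : b t @[t --> +oo] --> +oo.
Proof.
apply/cvgryPge => A; near=> t.
have t1 : 1 < t by near: t; exact: nbhs_pinfty_gt.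
have At : (1 - dfun X A)^-1 < t.
  by near: t; apply: nbhs_pinfty_gt; exact: num_real.
rewrite quantile// /generalized_inverse.
apply: lb_le_inf; first by apply: S_neq0; apply: lt_trans t1.
move=> x /= tx; rewrite leNgt; apply/negP => xA.
have := lt_le_trans At tx; rewrite ltNge => /negP; apply.
rewrite lef_pV2 ?posrE ?subr_gt0//.
by rewrite lerD2l lerN2 dfun_nd// ltW.
Unshelve. all: by end_near. Qed.

End quantile.

(** * Centering of Psi *)

Section centering.
Context {R : realType}.
Local Notation RR := (measurableTypeR R * measurableTypeR R)%type.
Context (mu : {measure set RR -> \bar R}) (Psi : cumulativeBounded (0:R) (1:R)).
Local Notation lsf := (lebesgue_stieltjes_measure Psi).
Hypothesis muE : forall x y : R,
  mu [set p | x <= p.1 /\ p.2 <= y] = (expR (- x) * Psi y)%:E.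
Hypothesis normalized : (\int[lsf]_y (y ^+ 2)%:E = 1)%E.

Lemma integral_Psi_cst (c : R) : (\int[lsf]_y c%:E = c%:E)%E.
Proof. by rewrite integral_cst// [X in (_ * X)%E]probability_setT mule1. Qed.

Lemma integral_Psi_sqr : (\int[lsf]_y (1 + y ^+ 2)%:E = (1 + 1)%:E)%E.
Proof.
have /= -> := ge0_integralD_fin lsf (measurable_cst (1 : R)) (exprn_measurable 2)
  (fun=> ler01) (@sqr_ge0 R).
by rewrite integral_Psi_cst normalized.
Qed.

Lemma integral_Psi_fin (g : R -> R) (C : R) : measurable_fun setT g ->
  (forall y, 0 <= g y) -> (forall y, g y <= C * (1 + y ^+ 2)) ->
  exists2 G, 0 <= G & (\int[lsf]_y (g y)%:E = G%:E)%E.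
Proof.
move=> mg g0 gC.
have C0 : 0 <= C.
  by have := le_trans (g0 0) (gC 0); rewrite expr0n addr0 mulr1.
have ms : measurable_fun setT (fun y : R => 1 + y ^+ 2) by meas.
have s0 (y : R) : 0 <= 1 + y ^+ 2 by rewrite addr_ge0// sqr_ge0.
have : (\int[lsf]_y (g y)%:E <= (C * (1 + 1))%:E)%E.
  apply: (@le_trans _ _ (\int[lsf]_y (C * (1 + y ^+ 2))%:E)%E).
    by apply: ge0_le_integral_fin => //; meas.
  by rewrite ge0_integral_const// integral_Psi_sqr EFinM.
have : (0 <= \int[lsf]_y (g y)%:E)%E by apply: integral_ge0 => y _; rewrite lee_fin.
by case: integral => // r r0 _; exists r.
Qed.

(** The lower mesh bound for [g] and the upper one for [h] share the factor t / (1 - exp (- t)).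
    Dividing it out and letting the mesh t tend to 0 transfers a relation between x-weighted
    integrals to Psi. *)
Let halves_le (g h : R -> R) (G H : R) :
  measurable_fun setT g -> (forall y, 0 <= g y) ->
  measurable_fun setT h -> (forall y, 0 <= h y) ->
  (\int[lsf]_y (g y)%:E = G%:E)%E -> (\int[lsf]_y (h y)%:E = H%:E)%E ->
  (\int[mu]_p ((0 <= p.1)%R%:R * (`|p.1| * g p.2))%:E =
   \int[mu]_p ((0 <= p.1)%R%:R * (`|p.1| * h p.2))%:E)%E -> G <= H.
Proof.
move=> mg g0 mh h0 gG hH gh.
have key t : 0 < t -> expR (- t) * G <= H.
  move=> t0.
  have /andP[lo _] := ge0_integral_mesh muE t0 mg g0 gG.
  have /andP[_ up] := ge0_integral_mesh muE t0 mh h0 hH.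
  rewrite gh in lo; have := le_trans lo up.
  have q1 : 0 < 1 - expR (- t) by rewrite subr_gt0 expR_lt1 oppr_lt0.
  rewrite lee_fin ler_pM2r ?invr_gt0// -mulrA ler_pM2l//.
have : expR (- t) * G @[t --> (0:R)^'+] --> expR (- 0) * G.
  apply: cvg_at_right_filter; apply: cvgMl.
  by apply: continuous_comp; [apply: cvgN; exact: cvg_id|exact: continuous_expR].
rewrite oppr0 expR0 mul1r => /cvgr_to_le; apply.
by near=> t; apply: key; near: t; exact: nbhs_right_gt.
Unshelve. all: by end_near. Qed.

(** Given int y^2 dPsi = 1, the conclusion says that Psi has mean 0, in terms of a nonnegative
    integrand: (1 + y)^2 + 2 y^- = 1 + y^2 + 2 y^+, and y^+ and y^- have the same finite mean. *)
Lemma Psi_centered :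
  (\int[mu]_p ((0 <= p.1)%R%:R * (`|p.1| * Num.max p.2 0))%:E =
   \int[mu]_p ((0 <= p.1)%R%:R * (`|p.1| * Num.max (- p.2) 0))%:E)%E ->
  (\int[lsf]_y ((1 + y) ^+ 2)%:E = 2%:E)%E.
Proof.
move=> cross; pose g (y : R) := Num.max y 0; pose h (y : R) := Num.max (- y) 0.
have mg : measurable_fun setT g by rewrite /g; meas.
have mh : measurable_fun setT h by rewrite /h; meas.
have mq : measurable_fun setT (fun y : R => (1 + y) ^+ 2) by meas.
have ms : measurable_fun setT (fun y : R => 1 + y ^+ 2) by meas.
have g0 y : 0 <= g y by rewrite le_max lexx orbT.
have h0 y : 0 <= h y by rewrite le_max lexx orbT.
have sq (y : R) : 0 <= (y - 1) ^+ 2 /\ 0 <= (y + 1) ^+ 2 /\ 0 <= y ^+ 2.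
  by rewrite !sqr_ge0.
have gC y : g y <= 1 * (1 + y ^+ 2).
  by have [s1 [s2 s3]] := sq y; rewrite /g ge_max; apply/andP; split; nra.
have hC y : h y <= 1 * (1 + y ^+ 2).
  by have [s1 [s2 s3]] := sq y; rewrite /h ge_max; apply/andP; split; nra.
have [G _ gG] := integral_Psi_fin mg g0 gC.
have [H _ hH] := integral_Psi_fin mh h0 hC.
have GH : G = H.
  by apply/eqP; rewrite eq_le (halves_le mg g0 mh h0 gG hH)//
    (halves_le mh h0 mg g0 hH gG).
have : (\int[lsf]_y ((1 + y) ^+ 2)%:E + (2 * G)%:E = 2%:E + (2 * G)%:E)%E.
  rewrite [in LHS]GH !EFinM -hH -gG -!ge0_integral_const//.
  have -> : (2%:E = \int[lsf]_y (1 + y ^+ 2)%:E)%E.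
    by rewrite integral_Psi_sqr.
  rewrite -!ge0_integralD_fin//; try solve [meas]; try exact: mq; try exact: ms;
    try solve [by move=> y; rewrite ?(sqr_ge0, addr_ge0, mulr_ge0)].
  apply: eq_integral => y _; congr (_%:E); rewrite /g /h.
  by have [y0|y0] := leP 0 y; rewrite ?(max_l y0) ?(max_r (ltW y0));
    [rewrite max_r ?oppr_le0|rewrite max_l ?oppr_ge0 ?ltW]; rewrite //; ring.
have : (0 <= \int[lsf]_y ((1 + y) ^+ 2)%:E)%E.
  by apply: integral_ge0 => y _; rewrite lee_fin sqr_ge0.
by case: integral => // r _ [] /addIr ->.
Qed.

End centering.

(** Every square of an affine function of y is a combination of 1, y^2 and (1 + y)^2; r - p - q is
    twice the first moment of y. *)
Lemma quadratic_moment (d : measure_display) (T : measurableType d) (R : realType)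
    (mu : {measure set T -> \bar R}) (f y : T -> R) (p q r al be : R) :
  measurable_fun setT f -> (forall w, 0 <= f w) -> measurable_fun setT y ->
  (\int[mu]_w (f w)%:E = p%:E)%E ->
  (\int[mu]_w (f w * y w ^+ 2)%:E = q%:E)%E ->
  (\int[mu]_w (f w * (1 + y w) ^+ 2)%:E = r%:E)%E ->
  (\int[mu]_w (f w * (al + be * y w) ^+ 2)%:E =
   (al ^+ 2 * p + al * be * (r - p - q) + be ^+ 2 * q)%:E)%E.
Proof.
move=> mf f0 my fp fq fr.
have int (g : T -> R) (c : R) : measurable_fun setT g -> (forall w, 0 <= g w) ->
    (\int[mu]_w (g w)%:E = c%:E)%E -> mu.-integrable setT (EFin \o g).
  move=> mg g0 gc; apply/integrableP; split; first exact/measurable_EFinP.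
  under eq_integral do rewrite /= ger0_norm//.
  by rewrite gc ltry.
have i1 := int _ _ mf f0 fp.
have i2 : mu.-integrable setT (EFin \o (fun w => f w * y w ^+ 2)).
  by apply: int fq => [|w]; [meas|rewrite ?(sqr_ge0, mulr_ge0)].
have i3 : mu.-integrable setT (EFin \o (fun w => f w * (1 + y w) ^+ 2)).
  by apply: int fr => [|w]; [meas|rewrite ?(sqr_ge0, mulr_ge0)].
have E : (\int[mu]_w (f w * (al + be * y w) ^+ 2)%:E =
    \int[mu]_w (((al ^+ 2 - al * be)%:E * (f w)%:E +
     (be ^+ 2 - al * be)%:E * (f w * y w ^+ 2)%:E) +
     (al * be)%:E * (f w * (1 + y w) ^+ 2)%:E))%E.
  apply: eq_integral => w _; rewrite -!EFinM -!EFinD; congr (_%:E); ring.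
rewrite E integralD//; last 2 first.
- apply: integrableD => //; exact: integrableZl.
- exact: integrableZl.
rewrite integralD//; last 2 first.
- exact: integrableZl.
- exact: integrableZl.
rewrite !integralZl// fp fq fr -!EFinM -!EFinD; congr (_%:E); ring.
Qed.

(** * Slow variation of the normalizing functions *)

Section normalizing.
Context d (T : measurableType d) (R : realType) (P : probability T R).
Context (X Y : {RV P >-> R}) (gamma : R) (a b m psi : R -> R).
Context (nu : {measure set (\bar R * \bar R) -> \bar R}) (rho : R)
  (Psi : cumulativeBounded (0:R) (1:R)).
Local Notation RR := (measurableTypeR R * measurableTypeR R)%type.
Local Notation lsf := (lebesgue_stieltjes_measure Psi).
Hypothesis right_endpoint : gamma = 0 -> infinite_right_endpoint X.
Hypothesis A1 : assumption1 X Y gamma a b m psi nu.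
Hypothesis A2 : assumption2 X Y gamma a b m psi nu 1 2.
Hypothesis A4 : assumption4 gamma m psi nu rho Psi.
Hypothesis normalized : (\int[lsf]_y (y ^+ 2)%:E = 1)%E.
Hypothesis mu0 : cross_moment nu = 0%E.

Let endpoint : infinite_right_endpoint X := right_endpoint (a4_gamma A4).
Let M (n : nat) : {measure set RR -> \bar R} := mu_ X Y a b m psi n.
Let x_ n w := (X w - b n%:R) / psi (b n%:R).
Let y_ n w := (Y w - m (b n%:R)) / a (b n%:R).

Let mu_second := fun e (e0 : 0 < e) => mu_second_moment A4 A2 e0.

Lemma tail_cvg (s C G : R) (g : R -> R) : 0 < s -> continuous g ->
  (forall y, 0 <= g y) -> (forall y, g y <= C * (1 + y ^+ 2)) ->
  (\int[lsf]_y (g y)%:E = G%:E)%E ->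
  (\int[M n]_p ((s < p.1)%R%:R * g p.2)%:E)%E @[n --> \oo] --> (expR (- s) * G)%:E.
Proof.
exact: (cvg_tail (mu_vague A1 A4) (real_part_quadrant A4) mu_second normalized).
Qed.

(** The tail integral is monotone in its threshold, so a moving threshold is squeezed between the
    fixed ones s - h and s + h. *)
Lemma tail_cvg_moving (phi : nat -> nat) (u : nat -> R) (s C G : R) (g : R -> R) :
  0 < s -> phi n @[n --> \oo] --> \oo -> u n @[n --> \oo] --> s -> continuous g ->
  (forall y, 0 <= g y) -> (forall y, g y <= C * (1 + y ^+ 2)) ->
  (\int[lsf]_y (g y)%:E = G%:E)%E ->
  (\int[M (phi n)]_p ((u n < p.1)%R%:R * g p.2)%:E)%E @[n --> \oo] -->
  (expR (- s) * G)%:E.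
Proof.
move=> s0 phioo us cg g0 gC gG.
have mg : measurable_fun setT g by exact: continuous_measurable_fun.
have le_tail k (v w : R) : v <= w ->
    (\int[M k]_p ((w < p.1)%R%:R * g p.2)%:E <=
     \int[M k]_p ((v < p.1)%R%:R * g p.2)%:E)%E.
  move=> vw; apply: ge0_le_integral_fin; [by meas|by meas| |] => p.
    by rewrite mulr_ge0.
  rewrite ler_wpM2r//; case: (ltP w p.1) => //= wp.
  by rewrite (le_lt_trans vw wp).
apply: cvge_squeeze_eps => e e0; have e20 : 0 < e / 2 by rewrite divr_gt0.
have ecvg : (fun x => expR (- (s + x)) * G) x @[x --> (0:R)] --> expR (- (s + 0)) * G.
  apply: cvgMl; apply: continuous_comp; last exact: continuous_expR.
  by apply: cvgN; apply: cvgD; [exact: cvg_cst|exact: cvg_id].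
move: ecvg; rewrite addr0 => /cvgrPdist_le /(_ _ e20) /nbhs_ballP[eta /= eta0 etaE].
move/cvgrPdist_le: us => us.
pose h := Num.min (eta / 2) (s / 2).
have h0 : 0 < h by rewrite lt_min !divr_gt0.
have hs : h < s by rewrite gt_min; apply/orP; right; lra.
have heta : h < eta by rewrite gt_min; apply/orP; left; lra.
have := etaE h; rewrite /ball/= sub0r normrN gtr0_norm// => /(_ heta).
rewrite ler_norml => /andP[h1 h2].
have := etaE (- h); rewrite /ball/= sub0r opprK gtr0_norm// => /(_ heta).
rewrite ler_norml => /andP[h3 h4].
have c1 := cvg_comp _ _ phioo (tail_cvg (addr_gt0 s0 h0) cg g0 gC gG).
have sh : 0 < s - h by rewrite subr_gt0.
have c2 := cvg_comp _ _ phioo (tail_cvg sh cg g0 gC gG).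
near=> n.
have un : `|s - u n| <= h by near: n; exact: us.
have /andP[n1 _] : ((expR (- (s + h)) * G - e / 2)%:E <=
   \int[M (phi n)]_p ((s + h < p.1)%R%:R * g p.2)%:E <=
   (expR (- (s + h)) * G + e / 2)%:E)%E by near: n; exact: (cvge_near_eps c1).
have /andP[_ n2] : ((expR (- (s - h)) * G - e / 2)%:E <=
   \int[M (phi n)]_p ((s - h < p.1)%R%:R * g p.2)%:E <=
   (expR (- (s - h)) * G + e / 2)%:E)%E by near: n; exact: (cvge_near_eps c2).
move: un; rewrite ler_norml => /andP[u1 u2].
apply/andP; split.
  have us1 : u n <= s + h by rewrite -lerBlDl -lerN2 opprB.
  apply: (le_trans _ (le_tail (phi n) (u n) (s + h) us1)).
  by apply: le_trans n1; rewrite lee_fin; lra.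
have us2 : s - h <= u n by rewrite lerBlDr -lerBlDl.
apply: (le_trans (le_tail (phi n) (s - h) (u n) us2)).
by apply: (le_trans n2); rewrite lee_fin; lra.
Unshelve. all: by end_near. Qed.

Lemma b_cvgy : b t @[t --> +oo] --> +oo.
Proof. exact: (quantile_cvgy endpoint (a1_quantile A1)). Qed.

Lemma normalizers_pos : exists x0 : R, [/\ 0 < x0,
  monotone_beyond x0 a, monotone_beyond x0 psi &
  forall x, x0 < x -> 0 < a x /\ 0 < psi x].
Proof.
have [x0 [ma _ _ mpsi pos]] := a1_monotone A1.
have x0M : x0 <= Num.max x0 1 by rewrite le_max lexx.
have sub f : monotone_beyond x0 f -> monotone_beyond (Num.max x0 1) f.
  by move=> [|] mf; [left|right] => x y; rewrite !in_itv/= !andbT => xx yy;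
    apply: mf; rewrite in_itv/= andbT; apply: le_lt_trans x0M _.
exists (Num.max x0 1); split; [by rewrite lt_max ltr01 orbT|exact: sub|exact: sub|].
by move=> x xx; apply: pos; apply: le_lt_trans x0M _.
Qed.

Lemma near_pos_real : \forall t \near +oo,
  [/\ 1 < t, 0 < b t, 0 < a (b t) & 0 < psi (b t)].
Proof.
have [x0 [x00 _ _ pos]] := normalizers_pos.
near=> t; have bt : x0 < b t.
  by near: t; move/cvgryPgt: b_cvgy; apply.
split; [|exact: lt_trans bt|exact: (pos _ bt).1|exact: (pos _ bt).2].
by near: t; apply: nbhs_pinfty_gt; exact: num_real.
Unshelve. all: by end_near. Qed.

Lemma near_pos : \forall n \near \oo,
  [/\ (1 < n)%N, 0 < b n%:R, 0 < a (b n%:R) & 0 < psi (b n%:R)].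
Proof.
have H : \forall n \near \oo, [/\ 1 < n%:R, 0 < b n%:R, 0 < a (b n%:R) &
    0 < psi (b n%:R)] := @cvgr_idn R _ near_pos_real.
by apply: filterS H => n [+ *]; rewrite ltr1n.
Qed.

Lemma integral_M n (f : RR -> R) : measurable_fun setT f -> (forall p, 0 <= f p) ->
  (\int[M n]_p (f p)%:E = n%:R%:E * \int[P]_w (f (x_ n w, y_ n w))%:E)%E.
Proof. exact: integral_mu_. Qed.

Lemma tail_M n s : 0 < psi (b n%:R) ->
  (\int[M n]_p ((s < p.1)%R%:R * 1)%:E =
   n%:R%:E * P [set w | (b n%:R + psi (b n%:R) * s < X w)%R])%E.
Proof.
move=> psi0; rewrite integral_M//; last by meas.
congr (_ * _)%E; set A := [set w | _].
have mA : measurable A by exact: measurable_gt_rv.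
transitivity (\int[P]_w (\1_A w)%:E)%E; last by rewrite integral_indic// setIT.
apply: eq_integral => w _; rewrite indicE mulr1 /= /x_; congr ((nat_of_bool _)%:R%:E).
rewrite ltr_pdivlMr// ltrBrDl [s * _]mulrC.
by apply/idP/idP => [?|/set_mem//]; exact/mem_set.
Qed.

Definition scaled_gap (j : R) n := (b (j * n%:R) - b n%:R) / psi (b n%:R).

(** P(X > b (j n)) is close to 1 / (j n), while n P(X > b n + psi (b n) s) tends to exp (- s). A gap
    that stays away from ln j would contradict one of the two quantile inequalities. *)
Lemma scaled_gap_cvg (j : R) : 1 < j -> scaled_gap j n @[n --> \oo] --> ln j.
Proof.
move=> j1; have j0 : 0 < j by apply: lt_trans j1.
have lj0 : 0 < ln j by rewrite ln_gt0.
have tcvg s : 0 < s ->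
    (\int[M n]_p ((s < p.1)%R%:R * 1)%:E)%E @[n --> \oo] --> (expR (- s) * 1)%:E.
  move=> s0; apply: (tail_cvg s0 (C := 1) (g := fun=> 1)) => //.
  - by move=> ?; exact: cvg_cst.
  - by move=> y; rewrite mul1r lerDl sqr_ge0.
  - exact: integral_Psi_cst.
apply/cvgrPdist_le => e e0; pose h := Num.min e (ln j / 2).
have h0 : 0 < h by rewrite lt_min e0/= divr_gt0.
have he : h <= e by rewrite ge_min lexx.
have hj : h < ln j by rewrite gt_min; apply/orP; right; lra.
have c1 : expR (- (ln j + h)) < j^-1.
  by rewrite -[X in _ < X^-1](lnK j0) -expRN ltr_expR; lra.
have c2 : j^-1 < expR (- (ln j - h)).
  by rewrite -[X in X^-1 < _](lnK j0) -expRN ltr_expR; lra.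
near=> n.
have [n1 b0 a0 psi0] : [/\ (1 < n)%N, 0 < b n%:R, 0 < a (b n%:R) & 0 < psi (b n%:R)].
  by near: n; exact: near_pos.
have n0 : 0 < n%:R :> R by rewrite ltr0n ltnW.
have jn1 : 1 < j * n%:R by rewrite mulr_egt1// ltr1n.
have jn0 : 0 < j * n%:R by rewrite mulr_gt0.
have lim1 : (\int[M n]_p ((ln j + h < p.1)%R%:R * 1)%:E < j^-1%:E)%E.
  near: n; apply: cvge_lt_near; last exact: tcvg (addr_gt0 lj0 h0).
  by rewrite mulr1.
have lim2 : (j^-1%:E < \int[M n]_p ((ln j - h < p.1)%R%:R * 1)%:E)%E.
  near: n; apply: cvge_gt_near; last by apply: tcvg; rewrite subr_gt0.
  by rewrite mulr1.
have nj : n%:R * (j * n%:R)^-1 = j^-1 by field; rewrite !gt_eqF.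
rewrite tail_M// in lim1; rewrite tail_M// in lim2.
rewrite ler_norml; apply/andP; split.
- rewrite lerBrDl -lerBrDr opprK; apply: le_trans (_ : ln j + h <= _); last lra.
  rewrite /scaled_gap ler_pdivrMr// leNgt; apply/negP => lt.
  have : (j^-1%:E <= n%:R%:E * P [set w | (b n%:R + psi (b n%:R) * (ln j + h) < X w)%R])%E.
    rewrite -nj EFinM lee_pmul2l//.
    apply: (quantile_lt endpoint (a1_quantile A1)) => //.
    by rewrite -ltrBrDl [psi _ * _]mulrC.
  by move=> /le_lt_trans /(_ lim1); rewrite ltxx.
- rewrite lerBlDl -lerBlDr; apply: le_trans (_ : ln j - h <= _); first lra.
  rewrite /scaled_gap ler_pdivlMr// leNgt; apply/negP => lt.
  have : (n%:R%:E * P [set w | (b n%:R + psi (b n%:R) * (ln j - h) < X w)%R] <= j^-1%:E)%E.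
    rewrite -nj EFinM lee_pmul2l//.
    apply: le_trans (quantile_tail endpoint (a1_quantile A1) jn1).
    apply: le_measure; [apply: mem_set; exact: measurable_gt_rv
      |apply: mem_set; exact: measurable_gt_rv|].
    move=> w /=; apply: lt_trans.
    by rewrite -ltrBlDl [psi _ * _]mulrC.
  by move=> /(lt_le_trans lim2); rewrite ltxx.
Unshelve. all: by end_near. Qed.

Local Notation gap := scaled_gap.

Lemma mul2n_cvg : (2 * n)%N @[n --> \oo] --> \oo.
Proof.
apply/cvgnyPge => N; near=> n; apply: (@leq_trans n); last by rewrite leq_pmull.
by near: n; exact: nbhs_infty_ge.
Unshelve. all: by end_near. Qed.

Lemma scaled_gap2_double n : 0 < psi (b n%:R) -> 0 < psi (b (2 * n)%:R) ->
  gap 4 n - gap 2 n =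
  gap 2 (2 * n) * (psi (b (2 * n)%:R) / psi (b n%:R)).
Proof.
move=> p1 p2; rewrite /scaled_gap natrM [2 * (2 * _)]mulrA (_ : 2 * 2 = 4 :> R); last by rewrite -natrM.
rewrite natrM in p2.
by field; rewrite !gt_eqF.
Qed.

(** The increment b (4 n) - b (2 n) is measured in two units: in the limit it is ln 4 - ln 2 in
    units of psi (b n) and ln 2 in units of psi (b (2 n)), and these numbers are equal. *)
Lemma psi_double_cvg : psi (b (2 * n)%:R) / psi (b n%:R) @[n --> \oo] --> (1 : R).
Proof.
have l20 : ln 2 != 0 :> R by rewrite gt_eqF// ln_gt0// ltr1n.
have lim1 : (ln 4 - ln 2) * (ln 2)^-1 = 1 :> R.
  rewrite (_ : 4 = 2 * 2 :> R); last by rewrite -natrM.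
  by rewrite lnM ?posrE// addrK divff.
have g4 := @scaled_gap_cvg 4; have g2 := @scaled_gap_cvg 2.
rewrite !ltr1n in g4 g2.
have g22 : gap 2 (2 * n) @[n --> \oo] --> (ln 2 : R).
  exact: (cvg_comp _ _ mul2n_cvg (g2 isT)).
have : (gap 4 n - gap 2 n) * (gap 2 (2 * n))^-1 @[n --> \oo] -->
    ((ln 4 - ln 2) * (ln 2)^-1 : R).
  by apply: cvgM; [apply: cvgB; [exact: g4|exact: g2]|exact: cvgV].
rewrite lim1; apply: cvg_trans; apply: near_eq_cvg; near=> n.
have [_ _ _ p1] : [/\ (1 < n)%N, 0 < b n%:R, 0 < a (b n%:R) & 0 < psi (b n%:R)].
  by near: n; exact: near_pos.
have [_ _ _ p2] : [/\ (1 < (2 * n))%N, 0 < b (2 * n)%:R, 0 < a (b (2 * n)%:R) &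
    0 < psi (b (2 * n)%:R)].
  by near: n; exact: (mul2n_cvg near_pos).
rewrite scaled_gap2_double// mulrAC divff ?mul1r//.
by near: n; exact: (cvgr_neq0 _ g22 l20).
Unshelve. all: by end_near. Qed.

(** The event { X > b (4 n) } is common to k = n and k = 2 n, while the normalization of Y changes
    with k. In the units of level k its threshold tends to ln (4 n / k), which is positive at both
    levels, as [tail_cvg_moving] requires. *)
Let tail_moment (k n : nat) (g : R -> R) : \bar R :=
  (k%:R%:E * \int[P]_w ((b (4 * n%:R) < X w)%R%:R * g (y_ k w))%:E)%E.

Lemma tail_moment_cvg (phi : nat -> nat) (j C G : R) (g : R -> R) : 1 < j ->
  phi n @[n --> \oo] --> \oo ->
  (forall n, j * (phi n)%:R = 4 * n%:R) -> continuous g ->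
  (forall y, 0 <= g y) -> (forall y, g y <= C * (1 + y ^+ 2)) ->
  (\int[lsf]_y (g y)%:E = G%:E)%E ->
  tail_moment (phi n) n g @[n --> \oo] --> (G / j)%:E.
Proof.
move=> j1 phioo phij cg g0 gC gG; have j0 : 0 < j by apply: lt_trans j1.
have mg : measurable_fun setT g by exact: continuous_measurable_fun.
have lj : 0 < ln j by rewrite ln_gt0.
have -> : G / j = expR (- ln j) * G by rewrite expRN lnK// mulrC.
have gapcvg : gap j (phi n) @[n --> \oo] --> ln j.
  exact: (cvg_comp _ _ phioo (scaled_gap_cvg j1)).
have := tail_cvg_moving lj phioo gapcvg cg g0 gC gG.
apply: cvg_trans; apply: near_eq_cvg; near=> n.
have [_ _ _ p1] : [/\ (1 < phi n)%N, 0 < b (phi n)%:R, 0 < a (b (phi n)%:R) &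
    0 < psi (b (phi n)%:R)].
  by near: n; exact: (phioo _ near_pos).
rewrite integral_M; [|by meas|by move=> p; rewrite mulr_ge0].
congr (_ * _)%E; apply: eq_integral => w _ /=; congr ((nat_of_bool _)%:R * _)%:E.
by rewrite /scaled_gap /x_ phij ltr_pM2r ?invr_gt0// ltrD2r.
Unshelve. all: by end_near. Qed.

Let moment_cvg (phi : nat -> nat) (j : R) : 1 < j -> phi n @[n --> \oo] --> \oo ->
  (forall n, j * (phi n)%:R = 4 * n%:R) ->
  [/\ tail_moment (phi n) n (fun=> 1) @[n --> \oo] --> (1 / j)%:E,
      tail_moment (phi n) n (fun y => y ^+ 2) @[n --> \oo] --> (1 / j)%:E &
      tail_moment (phi n) n (fun y => (1 + y) ^+ 2) @[n --> \oo] --> (2 / j)%:E].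
Proof.
move=> j1 phioo phij; split.
- apply: (tail_moment_cvg (C := 1) j1 phioo phij) => //.
  + by move=> ?; exact: cvg_cst.
  + by move=> y; rewrite mul1r lerDl sqr_ge0.
  + exact: integral_Psi_cst.
- apply: (tail_moment_cvg (C := 1) j1 phioo phij) => //.
  + exact: exprn_continuous.
  + exact: sqr_ge0.
  + by move=> y; rewrite mul1r lerDr.
- apply: (tail_moment_cvg (C := 2) j1 phioo phij) => //.
  + move=> y; apply: (@continuous_comp R R R (fun y => 1 + y) (fun y => y ^+ 2) y);
      last exact: exprn_continuous.
    by apply: cvgD; [exact: cvg_cst|exact: cvg_id].
  + by move=> y; exact: sqr_ge0.
  + by move=> y; have := sqr_ge0 (1 - y); nra.
  + exact: (Psi_centered (real_part_quadrant A4) normalized (cross_moment_real_part mu0)).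
Qed.

Let shift n := rho * (b n%:R - b (2 * n)%:R) / a (b (2 * n)%:R).
Let ratio n := a (b n%:R) / a (b (2 * n)%:R).

Lemma y_double n w : 0 < a (b n%:R) -> 0 < a (b (2 * n)%:R) ->
  y_ (2 * n) w = shift n + ratio n * y_ n w.
Proof.
move=> a1 a2; rewrite /y_ /shift /ratio !(a4_m A4).
by field; rewrite !gt_eqF.
Qed.

Lemma near_pos_double : \forall n \near \oo,
  [/\ (1 < n)%N, 0 < a (b n%:R), 0 < psi (b n%:R), 0 < a (b (2 * n)%:R) &
      0 < psi (b (2 * n)%:R)].
Proof.
near=> n; have [n1 _ a1 p1] : [/\ (1 < n)%N, 0 < b n%:R, 0 < a (b n%:R) &
    0 < psi (b n%:R)] by near: n; exact: near_pos.
have [_ _ a2 p2] : [/\ (1 < (2 * n))%N, 0 < b (2 * n)%:R, 0 < a (b (2 * n)%:R) &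
    0 < psi (b (2 * n)%:R)].
  by near: n; exact: (mul2n_cvg near_pos).
by split.
Unshelve. all: by end_near. Qed.

(** On a common event, the rescaled Y of level 2 n is [shift] + [ratio] times that of level n. The
    moments of order 0, 1 and 2 have known limits at both levels: the variances give [ratio]^2 -> 1,
    and then the means give [shift] -> 0. *)
Lemma cvg_types : ratio n @[n --> \oo] --> (1 : R) /\ shift n @[n --> \oo] --> (0 : R).
Proof.
have idoo : id n @[n --> \oo] --> \oo by exact: cvg_id.
have r41 : (1 : R) < 4 by rewrite ltr1n.
have r21 : (1 : R) < 2 by rewrite ltr1n.
have [c0 c2 c12] := moment_cvg r41 idoo (fun n => erefl).
have [d0 d2 d12] : [/\ tail_moment (2 * n) n (fun=> 1) @[n --> \oo] --> (1 / 2)%:E,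
      tail_moment (2 * n) n (fun y => y ^+ 2) @[n --> \oo] --> (1 / 2)%:E &
      tail_moment (2 * n) n (fun y => (1 + y) ^+ 2) @[n --> \oo] --> (2 / 2)%:E].
  apply: moment_cvg => // [|n]; first exact: mul2n_cvg.
  by rewrite natrM mulrA; congr (_ * _); rewrite -natrM.
pose u0 n := fine (tail_moment n n (fun=> 1)).
pose u2 n := fine (tail_moment n n (fun y => y ^+ 2)).
pose u12 n := fine (tail_moment n n (fun y => (1 + y) ^+ 2)).
pose v2 n := fine (tail_moment (2 * n) n (fun y => y ^+ 2)).
pose v12 n := fine (tail_moment (2 * n) n (fun y => (1 + y) ^+ 2)).
(* [k] is the first moment of y at level n, and [w] is half of the one at level 2 n, whose weight is
   2 n instead of n. The mass at level 2 n is exactly 2 [u0], which accounts for the term [u0] / 2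
   in [w]. *)
pose k n := (u12 n - u0 n - u2 n) / 2.
pose w n := (v12 n - v2 n) / 4 - u0 n / 2.
have /fine_cvgP[f0 u0c] := c0; have /fine_cvgP[f2 u2c] := c2.
have /fine_cvgP[f12 u12c] := c12.
have /fine_cvgP[_ v2c] := d2; have /fine_cvgP[_ v12c] := d12.
have kc : k n @[n --> \oo] --> (0 : R).
  rewrite [X in _ --> X](_ : _ = (2 / 4 - 1 / 4 - 1 / 4) / 2 :> R); last by field.
  by apply: cvgMl; apply: cvgB => //; apply: cvgB.
have wc : w n @[n --> \oo] --> (0 : R).
  rewrite [X in _ --> X](_ : _ = (2 / 2 - 1 / 2) / 4 - 1 / 4 / 2 :> R); last by field.
  by apply: cvgB; [apply: cvgMl; exact: cvgB|exact: cvgMl].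
have key : \forall n \near \oo, [/\ 0 < ratio n, u0 n != 0,
    u2 n * u0 n - k n ^+ 2 != 0,
    ratio n ^+ 2 * (u2 n * u0 n - k n ^+ 2) = v2 n / 2 * u0 n - w n ^+ 2 &
    shift n * u0 n = w n - ratio n * k n].
  have nz : u2 n * u0 n - k n ^+ 2 @[n --> \oo] --> (1 / 4 * (1 / 4) - 0 ^+ 2 : R).
    apply: cvgB; first exact: cvgM.
    exact: (continuous_cvg _ (@exprn_continuous _ 2 _)).
  have nz0 : 1 / 4 * (1 / 4) - 0 ^+ 2 != 0 :> R.
    by rewrite expr0n subr0; apply: lt0r_neq0; lra.
  have z0 : 1 / 4 != 0 :> R by apply: lt0r_neq0; lra.
  near=> n.
  have [n1 a1 p1 a2 p2] : [/\ (1 < n)%N, 0 < a (b n%:R), 0 < psi (b n%:R),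
      0 < a (b (2 * n)%:R) & 0 < psi (b (2 * n)%:R)] by near: n; exact: near_pos_double.
  have n0 : n%:R != 0 :> R by rewrite pnatr_eq0 -lt0n ltnW.
  have un0 : u0 n != 0 by near: n; exact: (cvgr_neq0 _ u0c z0).
  have dn0 : u2 n * u0 n - k n ^+ 2 != 0 by near: n; exact: (cvgr_neq0 _ nz nz0).
  have g0 : tail_moment n n (fun=> 1) \is a fin_num by near: n.
  have g2 : tail_moment n n (fun y => y ^+ 2) \is a fin_num by near: n.
  have g12 : tail_moment n n (fun y => (1 + y) ^+ 2) \is a fin_num by near: n.
  pose f w := (b (4 * n%:R) < X w)%R%:R : R.
  have mf : measurable_fun setT f.
    by apply: measurable_natr_bool; exact: measurable_fun_ltr.
  have my : measurable_fun setT (y_ n).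
    by apply: measurable_funM => //; exact: measurable_funB.
  have int (g : R -> R) : (forall y, 0 <= g y) -> tail_moment n n g \is a fin_num ->
      (\int[P]_w (f w * g (y_ n w))%:E = (n%:R^-1 * fine (tail_moment n n g))%:E)%E.
    move=> gg0; rewrite /tail_moment -/f.
    have : (0 <= \int[P]_w (f w * g (y_ n w))%:E)%E.
      by apply: integral_ge0 => ? _; rewrite lee_fin mulr_ge0.
    case: integral => [r _ _|_|]//=; first by rewrite mulrA mulVf// mul1r.
    by rewrite gt0_muley// lte_fin ltr0n ltnW.
  have i0 : (\int[P]_w (f w)%:E = (n%:R^-1 * u0 n)%:E)%E.
    by rewrite -int//; apply: eq_integral => ? _; rewrite mulr1.
  have i2 := int _ (@sqr_ge0 R) g2.
  have i12 := int _ (fun y => sqr_ge0 (1 + y)) g12.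
  have Q al be := @quadratic_moment _ _ _ P f (y_ n) _ _ _ al be mf
    (fun=> ler0n _ _) my i0 i2 i12.
  have V2 : v2 n = 2 * (shift n ^+ 2 * u0 n + 2 * shift n * ratio n * k n +
      ratio n ^+ 2 * u2 n).
    rewrite /v2 /tail_moment.
    under eq_integral do rewrite y_double//.
    rewrite Q /= natrM /k -/(u2 n) -/(u12 n); field.
    by rewrite n0.
  have V12 : v12 n = 2 * ((1 + shift n) ^+ 2 * u0 n + 2 * (1 + shift n) * ratio n * k n +
      ratio n ^+ 2 * u2 n).
    rewrite /v12 /tail_moment.
    under eq_integral do rewrite y_double// addrA.
    rewrite Q /= natrM /k -/(u2 n) -/(u12 n); field.
    by rewrite n0.
  have W : w n = shift n * u0 n + ratio n * k n by rewrite /w V2 V12; field.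
  split => //; first by rewrite divr_gt0.
    by rewrite W V2; field.
  by rewrite W; ring.
have rc : ratio n @[n --> \oo] --> (1 : R).
  have : Num.sqrt ((v2 n / 2 * u0 n - w n ^+ 2) / (u2 n * u0 n - k n ^+ 2))
      @[n --> \oo] --> Num.sqrt ((1 / 2 / 2 * (1 / 4) - 0 ^+ 2) / (1 / 4 * (1 / 4) - 0 ^+ 2) : R).
    apply: continuous_cvg; first exact: sqrt_continuous.
    apply: cvgM.
      apply: cvgB; first by apply: cvgM => //; exact: cvgMl.
      exact: (continuous_cvg _ (@exprn_continuous _ 2 _)).
    apply: cvgV; first by rewrite expr0n subr0; apply: lt0r_neq0; lra.
    apply: cvgB; first exact: cvgM.
    exact: (continuous_cvg _ (@exprn_continuous _ 2 _)).
  rewrite (_ : _ / _ = 1); last by field.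
  rewrite sqrtr1; apply: cvg_trans; apply: near_eq_cvg; apply: filterS key.
  move=> n [r0 un0 dn0 E _]; rewrite -E mulfK// sqrtr_sqr gtr0_norm//.
split => //.
have : (w n - ratio n * k n) / u0 n @[n --> \oo] --> ((0 - 1 * 0) / (1 / 4) : R).
  apply: cvgM; first by apply: cvgB => //; exact: cvgM.
  by apply: cvgV => //; apply: lt0r_neq0; lra.
rewrite mulr0 subr0 mul0r; apply: cvg_trans; apply: near_eq_cvg; apply: filterS key.
by move=> n [_ un0 _ _ E]; rewrite -E mulfK.
Unshelve. all: by end_near. Qed.

Lemma psi_b_cvg : psi (b n%:R) / b n%:R @[n --> \oo] --> (0 : R).
Proof.
have bn : b n%:R @[n --> \oo] --> +oo by exact: (cvg_comp _ _ cvgr_idn b_cvgy).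
exact: (cvg_comp _ _ bn (a4_psi A4)).
Qed.

(** As m is linear, [shift] is - rho psi (b n) / a (b n) multiplied by [ratio] and by a gap that
    tends to ln 2, which is nonzero. *)
Lemma rho_psi_cvg : rho * psi (b n%:R) / a (b n%:R) @[n --> \oo] --> (0 : R).
Proof.
have [rc sc] := cvg_types.
have l2 : ln 2 != 0 :> R by rewrite gt_eqF// ln_gt0// ltr1n.
have g2 := @scaled_gap_cvg 2; rewrite ltr1n in g2; have {}g2 := g2 isT.
have : - (rho * (b n%:R - b (2 * n)%:R) / a (b (2 * n)%:R)) /
    (a (b n%:R) / a (b (2 * n)%:R)) / gap 2 n @[n --> \oo] --> (- 0 / 1 / ln 2 : R).
  apply: cvgM; last exact: cvgV.
  by apply: cvgM; [exact: cvgN|apply: cvgV => //; exact: oner_neq0].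
rewrite oppr0 !mul0r; apply: cvg_trans; apply: near_eq_cvg; near=> n.
have [n1 a1 p1 a2 p2] : [/\ (1 < n)%N, 0 < a (b n%:R), 0 < psi (b n%:R),
    0 < a (b (2 * n)%:R) & 0 < psi (b (2 * n)%:R)] by near: n; exact: near_pos_double.
have : gap 2 n != 0 by near: n; exact: (cvgr_neq0 _ g2 l2).
rewrite /scaled_gap mulf_eq0 invr_eq0 (gt_eqF p1) orbF => bb0.
rewrite natrM in a2 *; field.
by rewrite bb0 !gt_eqF.
Unshelve. all: by end_near. Qed.

(** 8 is a power of two above e (N + 1) / N for all N >= 1, so that n / k will lie between the
    chosen level N and 8 N. *)
Lemma b_8_cvg : b (8 * n%:R) / b n%:R @[n --> \oo] --> (1 : R).
Proof.
have g8 := @scaled_gap_cvg 8; rewrite ltr1n in g8; have {}g8 := g8 isT.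
have : 1 + psi (b n%:R) / b n%:R * gap 8 n @[n --> \oo] --> (1 + 0 * ln 8 : R).
  by apply: cvgD; [exact: cvg_cst|apply: cvgM => //; exact: psi_b_cvg].
rewrite mul0r addr0; apply: cvg_trans; apply: near_eq_cvg; near=> n.
have [_ b0 _ p1] : [/\ (1 < n)%N, 0 < b n%:R, 0 < a (b n%:R) &
    0 < psi (b n%:R)] by near: n; exact: near_pos.
by rewrite /scaled_gap; field; rewrite !gt_eqF.
Unshelve. all: by end_near. Qed.

Lemma a_8_cvg : a (b (8 * n%:R)) / a (b n%:R) @[n --> \oo] --> (1 : R).
Proof.
have [rc _] := cvg_types.
have r2 := cvg_comp _ _ mul2n_cvg rc.
have r4 := cvg_comp _ _ mul2n_cvg r2.
pose r n := a (b n%:R) / a (b (2 * n)%:R).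
have : (r n * r (2 * n)%N * r (2 * (2 * n))%N)^-1 @[n --> \oo] --> ((1 * 1 * 1)^-1 : R).
  apply: cvgV; first by rewrite !mulr1 oner_neq0.
  by apply: cvgM; [apply: cvgM; [exact: rc|exact: r2]|exact: r4].
rewrite !mulr1 invr1; apply: cvg_trans; apply: near_eq_cvg; near=> n.
have [_ a1 _ a2 _] : [/\ (1 < n)%N, 0 < a (b n%:R), 0 < psi (b n%:R),
    0 < a (b (2 * n)%:R) & 0 < psi (b (2 * n)%:R)] by near: n; exact: near_pos_double.
have [_ _ _ a4 _] : [/\ (1 < 2 * n)%N, 0 < a (b (2 * n)%:R), 0 < psi (b (2 * n)%:R),
    0 < a (b (2 * (2 * n))%:R) & 0 < psi (b (2 * (2 * n))%:R)].
  by near: n; exact: (mul2n_cvg near_pos_double).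
have [_ _ _ a8 _] : [/\ (1 < 2 * (2 * n))%N, 0 < a (b (2 * (2 * n))%:R),
    0 < psi (b (2 * (2 * n))%:R),
    0 < a (b (2 * (2 * (2 * n)))%:R) & 0 < psi (b (2 * (2 * (2 * n)))%:R)].
  by near: n; exact: (mul2n_cvg (mul2n_cvg near_pos_double)).
have -> : 8 * n%:R = (2 * (2 * (2 * n)))%:R :> R.
  by rewrite !natrM !mulrA; congr (_ * _); rewrite -!natrM.
by rewrite /r; field; rewrite !gt_eqF.
Unshelve. all: by end_near. Qed.

Section intermediate_level.
Context (N : nat -> nat) (tau : nat -> R).
Hypothesis Noo : N n @[n --> \oo] --> \oo.
Hypothesis Ntau : \forall n \near \oo, (N n)%:R <= tau n <= 8 * (N n)%:R.

Lemma b_level_cvg : b (tau n) / b (N n)%:R @[n --> \oo] --> (1 : R).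
Proof.
apply: (@squeeze_cvgr _ _ _ _ (fun=> 1) (fun n => b (8 * (N n)%:R) / b (N n)%:R));
  [|exact: cvg_cst|exact: (cvg_comp _ _ Noo b_8_cvg)].
near=> n.
have [n1 b0 _ _] : [/\ (1 < N n)%N, 0 < b (N n)%:R, 0 < a (b (N n)%:R) &
    0 < psi (b (N n)%:R)] by near: n; exact: (Noo near_pos).
have /andP[t1 t2] : (N n)%:R <= tau n <= 8 * (N n)%:R by near: n.
have N1 : 1 < (N n)%:R :> R by rewrite ltr1n.
rewrite /= ler_pdivlMr// mul1r ler_pM2r ?invr_gt0//.
rewrite (quantile_nd endpoint (a1_quantile A1))//.
by rewrite (quantile_nd endpoint (a1_quantile A1))// (lt_le_trans N1).
Unshelve. all: by end_near. Qed.

(** [tau] need not be an integer. Monotonicity of [a] and [b], in either direction for [a], traps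
    the ratio between 1 and its value at 8 N. *)
Lemma a_level_cvg : a (b (tau n)) / a (b (N n)%:R) @[n --> \oo] --> (1 : R).
Proof.
have [x0 [x00 ma _ pos]] := normalizers_pos.
have a8 := cvg_comp _ _ Noo a_8_cvg.
apply/cvgrPdist_le => e e0; move/cvgrPdist_le : a8 => /(_ _ e0) a8.
have bk0 : \forall k \near \oo, x0 < b k%:R.
  have bk : b k%:R @[k --> \oo] --> +oo by exact: (cvg_comp _ _ cvgr_idn b_cvgy).
  by move/cvgryPgt: bk; apply.
near=> n.
have [n1 b0 a0 _] : [/\ (1 < N n)%N, 0 < b (N n)%:R, 0 < a (b (N n)%:R) &
    0 < psi (b (N n)%:R)] by near: n; exact: (Noo near_pos).
have /andP[t1 t2] : (N n)%:R <= tau n <= 8 * (N n)%:R by near: n.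
have N1 : 1 < (N n)%:R :> R by rewrite ltr1n.
have bx0 : x0 < b (N n)%:R.
  by near: n; exact: (Noo bk0).
have b1 : b (N n)%:R <= b (tau n) by exact: (quantile_nd endpoint (a1_quantile A1)).
have b2 : b (tau n) <= b (8 * (N n)%:R).
  by apply: (quantile_nd endpoint (a1_quantile A1)) => //; exact: lt_le_trans t1.
have : `|1 - a (b (8 * (N n)%:R)) / a (b (N n)%:R)| <= e by near: n.
apply: le_trans.
have i1 : b (N n)%:R \in `]x0, +oo[ by rewrite in_itv/= andbT.
have i2 : b (tau n) \in `]x0, +oo[ by rewrite in_itv/= andbT (lt_le_trans bx0).
have i3 : b (8 * (N n)%:R) \in `]x0, +oo[.
  by rewrite in_itv/= andbT (lt_le_trans bx0)// (le_trans b1).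
case: ma => mono.
  have m1 := mono _ _ i1 i2 b1; have m2 := mono _ _ i2 i3 b2.
  have q1 : 1 <= a (b (tau n)) / a (b (N n)%:R) by rewrite ler_pdivlMr// mul1r.
  have q2 : a (b (tau n)) / a (b (N n)%:R) <= a (b (8 * (N n)%:R)) / a (b (N n)%:R).
    by rewrite ler_pM2r// invr_gt0.
  by rewrite !ler0_norm; lra.
have m1 := mono _ _ i1 i2 b1; have m2 := mono _ _ i2 i3 b2.
have q1 : a (b (tau n)) / a (b (N n)%:R) <= 1 by rewrite ler_pdivrMr// mul1r.
have q2 : a (b (8 * (N n)%:R)) / a (b (N n)%:R) <= a (b (tau n)) / a (b (N n)%:R).
  by rewrite ler_pM2r// invr_gt0.
by rewrite !ger0_norm; lra.
Unshelve. all: by end_near. Qed.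

End intermediate_level.

(** * Moment bounds for the rescaled pair *)

Lemma xy2_bounded : exists C : R, \forall n \near \oo,
  (\int[M n]_p ((0 < p.1)%R%:R * (`|p.1| * p.2 ^+ 2))%:E <= C%:E)%E.
Proof.
have [c cE] := strip_moment_fin (real_part_quadrant A4) normalized (ltr01 (R := R)).
have := mu_second_moment A4 A2 (ltr01 (R := R)); rewrite cE => mc.
exists (c + 1); apply: filterS (cvge_near_eps mc ltr01) => n /andP[_].
apply: le_trans; apply: ge0_le_integral_fin; [by meas|by meas| |] => p.
  by rewrite ?(sqr_ge0, mulr_ge0).
have [p0|p0] := ltP 0 p.1; last by rewrite mul0r ?(sqr_ge0, mulr_ge0).
by rewrite (_ : -1 <= p.1)//; lra.
Qed.

(** The constant 8 makes D j + 2 (5 / 4)^j = D (j + 1) exact. The ratio 5 / 4 exceeds 1, so it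
    eventually dominates psi (b (2 k)) / psi (b k), and its square is below 2, so the series of D (j
    + 1)^2 2^-j converges. *)
Let D (j : nat) : R := 8 * (5 / 4) ^+ j.

Let D_gt0 j : 0 < D j.
Proof. by rewrite /D mulr_gt0// exprn_gt0. Qed.

Let D_unbounded (x : R) : exists j, x <= D j.
Proof.
have ge j : 1 + j%:R / 4 <= (5 / 4 : R) ^+ j.
  elim: j => [|j IH]; first by rewrite expr0 mul0r addr0.
  rewrite exprS -natr1; have : 0 <= j%:R :> R by []; nra.
exists (Num.truncn `|x|).+1; apply: le_trans (ler_norm x) _.
set J := (Num.truncn `|x|).+1; apply: (@le_trans _ _ (8 * (1 + J%:R / 4))).
  have : `|x| < J%:R by exact: truncnS_gt.
  have : 0 <= J%:R :> R by []; lra.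
by rewrite /D ler_pM2l.
Qed.

(** The rank from which one doubling is controlled also serves for all further doublings, since 2^j
    n >= n; hence the uniformity in j. Each doubling adds at most 2 psi to b, as ln 2 < 2. *)
Lemma dyadic_growth : \forall n \near \oo, forall j,
  psi (b (2 ^ j * n)%:R) <= (5 / 4) ^+ j * psi (b n%:R) /\
  b (2 ^ j * n)%:R - b n%:R <= D j * psi (b n%:R).
Proof.
have l21 : ln 2 < 2 :> R by exact: ln_sublinear.
have g2 := @scaled_gap_cvg 2; rewrite ltr1n in g2; have {}g2 := g2 isT.
have [N0 _ HN] : \forall k \near \oo, [/\ 0 < psi (b k%:R),
    b (2 * k)%:R - b k%:R <= 2 * psi (b k%:R) &
    psi (b (2 * k)%:R) <= 5 / 4 * psi (b k%:R)].
  near=> k; have [k1 _ _ p1] : [/\ (1 < k)%N, 0 < b k%:R, 0 < a (b k%:R) &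
    0 < psi (b k%:R)] by near: k; exact: near_pos.
  split => //.
    have : gap 2 k <= 2 by near: k; exact: cvgr_le g2 _ l21.
    by rewrite /scaled_gap ler_pdivrMr// natrM.
  have : psi (b (2 * k)%:R) / psi (b k%:R) <= 5 / 4.
    near: k; apply: cvgr_le psi_double_cvg _ _; lra.
  by rewrite ler_pdivrMr.
near=> n; have nN : (N0 <= n)%N by near: n; exact: nbhs_infty_ge.
have [p0 _ _] := HN n nN; elim=> [|j [IH1 IH2]].
  by rewrite expn0 mul1n expr0 mul1r subrr; split => //; rewrite mulr_ge0// ltW.
have kN : (N0 <= 2 ^ j * n)%N by rewrite (leq_trans nN)// leq_pmull// expn_gt0.
have [pk bk pk2] := HN _ kN.
rewrite expnS -mulnA; split.
  by rewrite exprS -mulrA; apply: (le_trans pk2); rewrite ler_pM2l.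
by move: IH2; rewrite /D exprS; nra.
Unshelve. all: by end_near. Qed.

(** For x > 0, x^2 is dominated by (D 0)^2 plus the sum of D (j + 1)^2 over the j with D j < x. By
    the growth bound { x > D j } lies in { X > b (2^j n) }, which has rescaled mass at most 2^-j. *)
Lemma x2_bounded : exists C : R, \forall n \near \oo,
  (\int[M n]_p ((0 < p.1)%R%:R * p.1 ^+ 2)%:E <= C%:E)%E.
Proof.
(* D (j + 1)^2 2^-j = 100 (25 / 32)^j. *)
exists (D 0 ^+ 2 + 100 / (1 - 25 / 32)).
near=> n.
have [n1 b0 a0 p0] : [/\ (1 < n)%N, 0 < b n%:R, 0 < a (b n%:R) &
    0 < psi (b n%:R)] by near: n; exact: near_pos.
have dg : forall j, psi (b (2 ^ j * n)%:R) <= (5 / 4) ^+ j * psi (b n%:R) /\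
  b (2 ^ j * n)%:R - b n%:R <= D j * psi (b n%:R) by near: n; exact: dyadic_growth.
have n0 : 0 < n%:R :> R by rewrite ltr0n ltnW.
have tail j s : b (2 ^ j * n)%:R - b n%:R <= s * psi (b n%:R) ->
    (\int[M n]_p ((s < p.1)%R%:R * 1)%:E <= ((2 ^- j : R))%:E)%E.
  move=> bs; rewrite tail_M//.
  have jn1 : 1 < (2 ^ j * n)%:R :> R.
    by rewrite ltr1n (leq_trans n1)// leq_pmull// expn_gt0.
  have -> : 2 ^- j = n%:R * (2 ^ j * n)%:R^-1 :> R.
    by rewrite natrM natrX; field; rewrite expf_neq0// gt_eqF.
  rewrite EFinM lee_pmul2l//.
  apply: le_trans (quantile_tail endpoint (a1_quantile A1) jn1).
  apply: le_measure; [apply: mem_set; exact: measurable_gt_rv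
      |apply: mem_set; exact: measurable_gt_rv|].
  move=> w /=; apply: le_lt_trans; lra.
pose f j (p : RR) := D j.+1 ^+ 2 * ((D j < p.1)%R%:R * 1).
have mf j : measurable_fun setT (fun p => (f j p)%:E) by rewrite /f; meas.
have f0 j p : (0 <= (f j p)%:E)%E by rewrite lee_fin mulr_ge0 ?sqr_ge0// mulr1.
pose g (p : RR) := (0 < p.1)%R%:R * 1 : R.
have mg : measurable_fun setT g by rewrite /g; meas.
have g0 p : 0 <= g p by rewrite /g mulr1.
have mser : measurable_fun setT (fun p => \sum_(0 <= j <oo) (f j p)%:E)%E.
  exact: ge0_emeasurable_sum.
have ser0 p : (0 <= \sum_(0 <= j <oo) (f j p)%:E)%E by exact: nneseries_ge0.
apply: (@le_trans _ _ (\int[M n]_p ((D 0 ^+ 2 * g p)%:E +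
    \sum_(0 <= j <oo) (f j p)%:E))%E).
  apply: ge0_le_integral => //.
  - by move=> p _; rewrite lee_fin ?(sqr_ge0, mulr_ge0).
  - by meas.
  - by apply: emeasurable_funD => //; meas.
  move=> p _; have [p1|p1] := ltP 0 p.1; last first.
    by rewrite mul0r adde_ge0// lee_fin mulr_ge0// sqr_ge0.
  rewrite mul1r /g p1 mulr1.
  have [[|J] pJ Jmin] := ex_minnP (D_unbounded p.1).
    rewrite mulr1 -[leLHS]adde0 leeD// lee_fin.
    by rewrite ler_pXn2r// ?nnegrE ?ltW.
  rewrite -[leLHS]add0e leeD//; first by rewrite lee_fin mulr1 sqr_ge0.
  apply: le_trans (nneseries_lim_ge J.+1 _); last by [].
  rewrite big_nat_recr//= -[leLHS]add0e leeD//; first by rewrite sume_ge0.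
  rewrite /f ltNge; case: (leP p.1 (D J)) => [pDJ|_].
    by have := Jmin _ pDJ; rewrite ltnn.
  by rewrite /= !mulr1 lee_fin ler_pXn2r// ?nnegrE ?ltW.
rewrite ge0_integralD//; last 2 first.
- by move=> p _; rewrite lee_fin mulr_ge0// sqr_ge0.
- by meas.
rewrite EFinD leeD//.
  rewrite ge0_integral_const ?sqr_ge0// -[leRHS]mule1 lee_wpmul2l ?lee_fin ?sqr_ge0//.
  rewrite (le_trans (tail 0 0 _))//.
    by rewrite expn0 mul1n subrr mul0r.
  by rewrite expr0 invr1.
rewrite integral_nneseries// -nneseries_geometric; [|lra|lra].
apply: lee_nneseries => [j _ _|j _]; first exact: integral_ge0.
rewrite /f ge0_integral_const ?sqr_ge0//; last by meas.
apply: (@le_trans _ _ ((D j.+1 ^+ 2)%:E * (2 ^- j)%:E)%E).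
  by rewrite lee_wpmul2l ?lee_fin ?sqr_ge0//; apply: tail; have [] := dg j.
rewrite -EFinM lee_fin.
have -> : (25 / 32) ^+ j = ((5 / 4) ^+ j) ^+ 2 * 2 ^- j :> R.
  rewrite -exprM mulnC exprM -exprVn -exprMn; congr (_ ^+ _); lra.
rewrite /D [(5 / 4) ^+ j.+1]exprS le_eqVlt; apply/orP; left; apply/eqP.
move: ((5 / 4) ^+ j) (2 ^- j) => Q t.
by field.
Unshelve. all: by end_near. Qed.

End normalizing.

(** * Convergence in probability and the weak law *)

Section with_high_probability.
Context d (T : measurableType d) (R : realType) (P : probability T R).

(* Convergence in probability is convergence along this filter. *)
Definition whp : set_system (nat * T) := [set Q | forall del : R, 0 < del ->
  \forall n \near \oo, exists E : set T,
    [/\ measurable E, (P E <= del%:E)%E & forall w, ~ E w -> Q (n, w)]].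

Global Instance whp_filter : Filter whp.
Proof.
split.
- by move=> del del0; near=> n; exists set0; rewrite measure0 lee_fin ltW.
- move=> A B FA FB del del0.
  have del20 : 0 < del / 2 by rewrite divr_gt0.
  apply: filterS2 (FA _ del20) (FB _ del20) => n [E [mE PE EA]] [F [mF PF FB']].
  exists (E `|` F); split; first exact: measurableU.
    apply: le_trans (measureU2 _ _ _) _ => //.
    by rewrite [del]splitr EFinD leeD.
  by move=> w /not_orP[nE nF]; split; [exact: EA|exact: FB'].
- move=> A B AB FA del del0; apply: filterS (FA _ del0) => n [E [mE PE EA]].
  by exists E; split => // w nE; apply: AB; exact: EA.
Unshelve. all: by end_near. Qed.

Global Instance nbhs_whp_filter : Filter (nbhs whp) := whp_filter.

Lemma whp_fst (A : set nat) : (\forall n \near \oo, A n) -> \forall p \near whp, A p.1.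
Proof.
move=> nA del del0; apply: filterS nA => n An; exists set0.
by rewrite measure0 lee_fin ltW.
Qed.

Lemma whp_imply (A B : set (nat * T)) : (\forall p \near whp, A p) ->
  (forall n w, A (n, w) -> B (n, w)) -> \forall p \near whp, B p.
Proof. by move=> nA AB; apply: (filterS (P := A)) nA => -[n w]; exact: AB. Qed.

Lemma whp_imply2 (A B C : set (nat * T)) : (\forall p \near whp, A p) ->
  (\forall p \near whp, B p) ->
  (forall n w, A (n, w) -> B (n, w) -> C (n, w)) -> \forall p \near whp, C p.
Proof.
move=> nA nB ABC; have nAB : \forall p \near whp, (A `&` B) p by exact: (filterI (F := whp) nA nB).
refine (@whp_imply (A `&` B) C nAB _) => n w [Anw Bnw]; exact: ABC.
Qed.

Lemma whp_imply3 (A B C D : set (nat * T)) : (\forall p \near whp, A p) ->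
  (\forall p \near whp, B p) -> (\forall p \near whp, C p) ->
  (forall n w, A (n, w) -> B (n, w) -> C (n, w) -> D (n, w)) ->
  \forall p \near whp, D p.
Proof.
move=> nA nB nC ABCD; have nAB : \forall p \near whp, (A `&` B) p by exact: (filterI (F := whp) nA nB).
refine (@whp_imply2 (A `&` B) C D nAB nC _) => n w [Anw Bnw] ?; exact: ABCD.
Qed.

Lemma whp_cvg_fst (U : topologicalType) (u : nat -> U) (l : U) :
  u n @[n --> \oo] --> l -> u p.1 @[p --> whp] --> l.
Proof. by move=> ul A lA; exact: (@whp_fst (u @^-1` A) (ul _ lA)). Qed.

(** [whp] asks only for a measurable exceptional set, so intermediate quantities may be handled
    without measurability. The final estimator must be measurable, since P is evaluated on its own
    deviation event. *)
Lemma cvg_whp_in_prob (Z : nat -> T -> R) (c : R) :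
  (forall n, measurable_fun setT (Z n)) ->
  Z p.1 p.2 @[p --> whp] --> c -> cvg_in_prob P Z c.
Proof.
move=> mZ Zc eps eps0.
apply: cvge_squeeze_eps => del del0.
move/cvgrPdist_lt : Zc => /(_ _ eps0) /(_ _ del0); apply: filterS => n [E [mE PE EZ]].
have mA : measurable [set w | eps <= `|Z n w - c|].
  rewrite -[X in measurable X]setTI -[mkset _]/((fun w => eps <= `|Z n w - c|) @^-1` [set true]).
  apply: measurable_fun_ler => //; apply: measurableT_comp => //.
  exact: measurable_funB.
rewrite sub0r add0r; apply/andP; split.
  by apply: (@le_trans _ _ 0%E); rewrite ?measure_ge0// lee_fin oppr_le0 ltW.
apply: le_trans PE; apply: le_measure; [exact: mem_set|exact: mem_set|].
move=> w /= epsZ; apply: contrapT => nE.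
by have := EZ _ nE; rewrite /= distrC ltNge epsZ.
Qed.

(** Serves arguments whose truncation level depends on the tolerated probability: for each [del], Q
    may be derived from a different event of high probability, up to an exceptional set of mass
    [del]. *)
Lemma whp_approx (Q : set (nat * T)) :
  (forall del : R, 0 < del -> exists2 Q' : set (nat * T), whp Q' &
     \forall n \near \oo, exists E : set T,
    [/\ measurable E, (P E <= del%:E)%E & forall w, ~ E w -> Q' (n, w) -> Q (n, w)]) ->
  whp Q.
Proof.
move=> H del del0; have del20 : 0 < del / 2 by rewrite divr_gt0.
have [Q' whpQ' nearE] := H _ del20.
apply: filterS2 nearE (whpQ' _ del20) => n [E [mE PE EA]] [F [mF PF FB]].
exists (E `|` F); split; first exact: measurableU.
  apply: le_trans (measureU2 _ _ _) _ => //.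
  by rewrite [del]splitr EFinD leeD.
by move=> w /not_orP[nE nF]; apply: EA => //; exact: FB.
Qed.

Lemma markov_fin (f : T -> R) (K C : R) : measurable_fun setT f ->
  (forall w, 0 <= f w) -> 0 < K -> (\int[P]_w (f w)%:E <= (K * C)%:E)%E ->
  measurable [set w | K <= f w] /\ (P [set w | (K <= f w)%R] <= C%:E)%E.
Proof.
move=> mf f0 K0 fC.
have mA : measurable [set w | K <= f w].
  rewrite -[X in measurable X]setTI -[mkset _]/((fun w => K <= f w) @^-1` [set true]).
  by apply: measurable_fun_ler.
split => //; rewrite -(@lee_pmul2l _ K%:E)// -EFinM; apply: le_trans fC.
have mfe : measurable_fun setT (fun w => (f w)%:E) by exact/measurable_EFinP.
have := le_integral_abse P measurableT mfe K0.
under [X in (_ <= X)%E -> _]eq_integral do rewrite /= ger0_norm//.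
apply: le_trans; rewrite setTI lee_pmul2l// le_eqVlt; apply/orP; left.
apply/eqP; congr (P _); by apply/seteqP; split => w /=; rewrite lee_fin ger0_norm.
Qed.

Lemma whp_bounded_mean (c : nat -> R) (S : nat -> T -> R) (C : R) :
  c n @[n --> \oo] --> 0 -> (forall n, measurable_fun setT (S n)) ->
  (forall n w, 0 <= S n w) ->
  (\forall n \near \oo, (\int[P]_w (S n w)%:E <= C%:E)%E) ->
  c p.1 * S p.1 p.2 @[p --> whp] --> 0.
Proof.
move=> c0 mS S0 SC; apply/cvgrPdist_lt => e e0 del del0.
have C1 : 0 < `|C| + 1 by rewrite ltr_wpDl.
have h0 : 0 < e * del / (`|C| + 1) by rewrite divr_gt0// mulr_gt0.
move/cvgrPdist_le : c0 => /(_ _ h0) c0.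
apply: filterS2 c0 SC => n; rewrite sub0r normrN => cn Sn.
have mf : measurable_fun setT (fun w => `|c n| * S n w) by exact: measurable_funM.
have fC : (\int[P]_w (`|c n| * S n w)%:E <= (e * del)%:E)%E.
  rewrite ge0_integral_const//.
  apply: (@le_trans _ _ (`|c n|%:E * (`|C| + 1)%:E)%E).
    rewrite lee_wpmul2l ?lee_fin//; apply: (le_trans Sn).
    by rewrite lee_fin (le_trans (ler_norm C))// lerDl.
  by rewrite -EFinM lee_fin -ler_pdivlMr.
have [mA PA] := markov_fin mf (fun w => mulr_ge0 (normr_ge0 _) (S0 n w)) e0 fC.
exists [set w | e <= `|c n| * S n w]; split => // w /= /negP; rewrite -ltNge.
by rewrite sub0r normrN normrM (ger0_norm (S0 n w)).
Qed.

End with_high_probability.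

(** * A weak law for sums whose summands vary with n *)

Section weak_law.
Context d (T : measurableType d) (R : realType) (P : probability T R).
Local Notation RR := (measurableTypeR R * measurableTypeR R)%type.

Definition rv_pair (X Y : {RV P >-> R}) (w : T) : RR := (X w, Y w).

Lemma measurable_rv_pair X Y : measurable_fun setT (rv_pair X Y).
Proof.
have m (Z : {RV P >-> R}) : measurable_fun setT (Z : T -> R) by [].
apply: measurable_fun_pair; [exact: (m X)|exact: (m Y)].
Qed.

HB.instance Definition _ X Y :=
  isMeasurableFun.Build _ _ _ _ (rv_pair X Y) (measurable_rv_pair X Y).

Definition rv_pair2 (X Y X' Y' : {RV P >-> R}) (w : T) : RR * RR :=
  (rv_pair X Y w, rv_pair X' Y' w).

Lemma measurable_rv_pair2 X Y X' Y' : measurable_fun setT (rv_pair2 X Y X' Y').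
Proof. by apply: measurable_fun_pair; exact: measurable_rv_pair. Qed.

HB.instance Definition _ X Y X' Y' :=
  isMeasurableFun.Build _ _ _ _ (rv_pair2 X Y X' Y') (measurable_rv_pair2 X Y X' Y').

Context (X Y : {RV P >-> R}) (Xs Ys : nat -> {RV P >-> R}).
Hypothesis iid : iid_copies X Y Xs Ys.

Let L : probability RR R := distribution P (rv_pair X Y).

Lemma sample_law i (A : set RR) : measurable A ->
  distribution P (rv_pair (Xs i) (Ys i)) A = L A.
Proof. by move=> mA; exact: (iid.1 i A mA). Qed.

Lemma integral_sample i (f : RR -> R) : measurable_fun setT f ->
  (forall p, 0 <= f p) ->
  (\int[P]_w (f (Xs i w, Ys i w))%:E = \int[P]_w (f (X w, Y w))%:E)%E.
Proof.
move=> mf f0; have mfe : measurable_fun setT (fun p => (f p)%:E).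
  exact/measurable_EFinP.
have f0e (p : RR) : (0 <= (f p)%:E)%E by rewrite lee_fin.
rewrite -(ge0_integral_distribution (P := P) (rv_pair (Xs i) (Ys i)) mfe f0e).
rewrite -(ge0_integral_distribution (P := P) (rv_pair X Y) mfe f0e).
by apply: eq_measure_integral => A mA _; exact: sample_law.
Qed.

Lemma sample_pair_law i j (A B : set RR) : i != j -> measurable A -> measurable B ->
  distribution P (rv_pair2 (Xs i) (Ys i) (Xs j) (Ys j)) (A `*` B) = (L A * L B)%E.
Proof.
move=> ij mA mB.
pose C k : set RR := if k == i then A else B.
have mC k : measurable (C k) by rewrite /C; case: ifP.
have := iid.2 [fset i; j]%fset C mC.
rewrite big_fsetU1/= ?inE// big_seq_fset1 {2}/C eqxx {2}/C eq_sym (negbTE ij).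
rewrite -(sample_law i mA) -(sample_law j mB) => <-.
congr (P _); apply/seteqP; split => w /=.
  move=> [Aw Bw] k; rewrite !inE => /orP[/eqP ->|/eqP ->].
    by rewrite /C eqxx.
  by rewrite /C eq_sym (negbTE ij).
move=> H; split.
  by have := H i; rewrite !inE eqxx /C eqxx; exact.
by have := H j; rewrite !inE eqxx orbT /C eq_sym (negbTE ij); exact.
Qed.

(** Independence gives the joint law of two sample points on rectangles; uniqueness of the product
    measure extends it, and Tonelli applies. *)
Lemma integral_sample_pair i j (f : RR -> R) (mu : R) : i != j ->
  measurable_fun setT f -> (forall p, 0 <= f p) ->
  (\int[P]_w (f (X w, Y w))%:E = mu%:E)%E ->
  (\int[P]_w (f (Xs i w, Ys i w) * f (Xs j w, Ys j w))%:E = (mu * mu)%:E)%E.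
Proof.
move=> ij mf f0 fmu.
have mfe : measurable_fun setT (fun p => (f p)%:E) by exact/measurable_EFinP.
have f0e (p : RR) : (0 <= (f p)%:E)%E by rewrite lee_fin.
have mff : measurable_fun setT (fun q : RR * RR => (f q.1 * f q.2)%:E).
  apply/measurable_EFinP; apply: measurable_funM.
    exact: (measurableT_comp mf).
  exact: (measurableT_comp mf).
have ff0 (q : RR * RR) : (0 <= (f q.1 * f q.2)%:E)%E by rewrite lee_fin mulr_ge0.
have fL : (\int[L]_p (f p)%:E = mu%:E)%E.
  by rewrite (ge0_integral_distribution (P := P) (rv_pair X Y) mfe f0e).
have := ge0_integral_distribution (P := P) (rv_pair2 (Xs i) (Ys i) (Xs j) (Ys j)) mff ff0.
move=> /= <-.
rewrite (eq_measure_integral (L \x L)%E); last first.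
  move=> A mA _; apply/esym; apply: product_measure_unique mA => B C mB mC.
  exact: sample_pair_law.
rewrite fubini_tonelli1// /fubini_F/=.
under eq_integral => p _.
  under eq_integral do rewrite EFinM.
  rewrite ge0_integralZl_EFin// fL.
  over.
rewrite ge0_integralZr//; last by rewrite lee_fin -lee_fin -fmu integral_ge0.
by rewrite fL.
Qed.

Let mXY i : measurable_fun setT (fun w => (Xs i w, Ys i w) : RR).
Proof. exact: measurable_rv_pair. Qed.

(** Independence cancels the off-diagonal covariances, and the diagonal terms are at most B mu
    because 0 <= f <= B. A bound B^2 would be too weak: mu will be at most of order k / n. *)
Lemma sample_variance_le (n : nat) (f : RR -> R) (B mu : R) :
  measurable_fun setT f -> (forall p, 0 <= f p) -> (forall p, f p <= B) ->
  (\int[P]_w (f (X w, Y w))%:E = mu%:E)%E ->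
  (\int[P]_w ((\sum_(0 <= i < n) f (Xs i w, Ys i w) - n%:R * mu) ^+ 2)%:E <=
   (n%:R * (B * mu))%:E)%E.
Proof.
move=> mf f0 fB fmu.
have mu0 : 0 <= mu by rewrite -lee_fin -fmu; apply: integral_ge0 => w _; rewrite lee_fin.
have B0 : 0 <= B by apply: le_trans (fB point).
pose g i w := f (Xs i w, Ys i w).
have mg i : measurable_fun setT (g i) by exact: (measurableT_comp mf (mXY i)).
have mge i : measurable_fun setT (fun w => (g i w)%:E) by exact/measurable_EFinP.
have g0 i w : 0 <= g i w by exact: f0.
have gmu i : (\int[P]_w (g i w)%:E = mu%:E)%E by rewrite -fmu; exact: integral_sample.
pose S w := \sum_(0 <= i < n) g i w.
have mS : measurable_fun setT S by apply: measurable_sum => i; exact: mg.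
have S0 w : 0 <= S w by apply: sumr_ge0.
have intS : (\int[P]_w (S w)%:E = (n%:R * mu)%:E)%E.
  rewrite /S; under eq_integral do rewrite -sumEFin.
  rewrite ge0_integral_sum//; last by move=> i w _; rewrite lee_fin.
  under eq_bigr do rewrite gmu.
  by rewrite sumEFin sumr_const_nat subn0 mulr_natl.
have intgg i j : (\int[P]_w (g i w * g j w)%:E <=
    ((i == j)%:R * (B * mu) + mu * mu)%:E)%E.
  have [<-|ij] := eqVneq i j.
    apply: (@le_trans _ _ (B * mu)%:E); last first.
      by rewrite lee_fin mul1r lerDl mulr_ge0.
    rewrite EFinM -(gmu i) -ge0_integral_const//.
    apply: ge0_le_integral_fin => [||w|w].
    - exact: measurable_funM.
    - exact: measurable_funM.
    - by rewrite mulr_ge0.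
    - by rewrite ler_wpM2r//; exact: fB.
  by rewrite (integral_sample_pair ij mf f0 fmu) mul0r add0r.
have intS2 : (\int[P]_w (S w ^+ 2)%:E <=
    (n%:R * (B * mu) + (n%:R * mu) ^+ 2)%:E)%E.
  rewrite (_ : (\int[P]_w (S w ^+ 2)%:E =
    \sum_(0 <= i < n) \sum_(0 <= j < n) \int[P]_w (g i w * g j w)%:E)%E); last first.
    have E w : ((S w ^+ 2)%:E = \sum_(0 <= i < n) \sum_(0 <= j < n) (g i w * g j w)%:E)%E.
      rewrite expr2 /S mulr_suml -sumEFin; apply: eq_bigr => i _.
      by rewrite mulr_sumr sumEFin.
    under eq_integral do rewrite E.
    have mgg i j : measurable_fun setT (fun w => (g i w * g j w)%:E).
      by apply/measurable_EFinP; exact: measurable_funM.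
    have gg0 i j w : (0 <= (g i w * g j w)%:E)%E by rewrite lee_fin mulr_ge0.
    rewrite ge0_integral_sum//; last 2 first.
    - by move=> i; apply: emeasurable_sum => j.
    - by move=> i w _; apply: sume_ge0.
    by apply: eq_bigr => i _; rewrite ge0_integral_sum.
  apply: (@le_trans _ _ (\sum_(0 <= i < n) \sum_(0 <= j < n)
      ((i == j)%:R * (B * mu) + mu * mu)%:E)%E).
    by apply: lee_sum => i _; apply: lee_sum => j _.
  under eq_bigr do rewrite sumEFin.
  rewrite sumEFin lee_fin.
  rewrite (eq_big_nat _ _ (F2 := fun=> B * mu + n%:R * (mu * mu))); last first.
    move=> i /andP[_ iN]; rewrite big_split/= sumr_const_nat subn0 mulr_natl.
    congr (_ + _); rewrite -mulr_suml (bigD1_seq i) ?iota_uniq//=; last first.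
      by rewrite mem_index_iota.
    rewrite eqxx big1 ?addr0 ?mul1r// => j; rewrite eq_sym => /negbTE ->.
    by [].
  rewrite sumr_const_nat subn0 -[X in X <= _]mulr_natl.
  by rewrite le_eqVlt; apply/orP; left; apply/eqP; ring.
(* The square is expanded with its cross term moved to the left, so that only nonnegative integrals
   are added. *)
have id : (\int[P]_w ((S w - n%:R * mu) ^+ 2)%:E + (2 * (n%:R * mu) * (n%:R * mu))%:E =
    \int[P]_w (S w ^+ 2)%:E + ((n%:R * mu) ^+ 2)%:E)%E.
  have nmu0 : 0 <= 2 * (n%:R * mu) by rewrite !mulr_ge0.
  have -> : ((2 * (n%:R * mu) * (n%:R * mu))%:E =
      \int[P]_w (2 * (n%:R * mu) * S w)%:E)%E.
    by rewrite ge0_integral_const// intS EFinM.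
  have -> : (((n%:R * mu) ^+ 2)%:E = \int[P]_w ((n%:R * mu) ^+ 2)%:E)%E.
    by rewrite integral_cst// [X in (_ * X)%E]probability_setT mule1.
  have mSn : measurable_fun setT (fun w => (S w - n%:R * mu) ^+ 2).
    by apply: measurable_funX; apply: measurable_funB.
  have mS2 : measurable_fun setT (fun w => S w ^+ 2) by exact: measurable_funX.
  have mcS : measurable_fun setT (fun w => 2 * (n%:R * mu) * S w).
    exact: measurable_funM.
  rewrite -!ge0_integralD_fin//; try by [move=> w; exact: sqr_ge0|move=> w; rewrite mulr_ge0].
  by apply: eq_integral => w _; congr (_%:E); ring.
move: id intS2; have : (0 <= \int[P]_w ((S w - n%:R * mu) ^+ 2)%:E)%E.
  by apply: integral_ge0 => w _; rewrite lee_fin sqr_ge0.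
have : (0 <= \int[P]_w (S w ^+ 2)%:E)%E.
  by apply: integral_ge0 => w _; rewrite lee_fin sqr_ge0.
rewrite -/(S _).
case: (\int[P]_w (S w ^+ 2)%:E)%E => [r||]//; case: integral => [t||]// _ _.
by move=> [tr]; rewrite !lee_fin; lra.
Qed.

Definition sample_mean (k : nat -> nat) (f : nat -> RR -> R) (n : nat) (w : T) : R :=
  (k n)%:R^-1 * \sum_(0 <= i < n) f n (Xs i w, Ys i w).

End weak_law.

Section weak_law_cvg.
Context d (T : measurableType d) (R : realType) (P : probability T R).
Local Notation RR := (measurableTypeR R * measurableTypeR R)%type.
Context (X Y : {RV P >-> R}) (Xs Ys : nat -> {RV P >-> R}).
Hypothesis iid : iid_copies X Y Xs Ys.
Context (k : nat -> nat).
Hypothesis koo : k n @[n --> \oo] --> \oo.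
Let kpos : \forall n \near \oo, (0 < k n)%N.
Proof. exact: (koo (nbhs_infty_gt 0)). Qed.

Local Notation mean := (sample_mean Xs Ys k).

Let mXY i : measurable_fun setT (fun w => (Xs i w, Ys i w) : RR).
Proof. exact: measurable_rv_pair. Qed.

Lemma measurable_sample_mean (f : nat -> RR -> R) n :
  measurable_fun setT (f n) -> measurable_fun setT (mean f n).
Proof.
move=> mf; apply: measurable_funM => //; apply: measurable_sum => i.
exact: (measurableT_comp mf (mXY i)).
Qed.

Lemma sample_mean_ge0 (f : nat -> RR -> R) n w : (forall p, 0 <= f n p) ->
  0 <= mean f n w.
Proof. by move=> f0; rewrite mulr_ge0// sumr_ge0. Qed.

Lemma integral_sample_mean (f : nat -> RR -> R) n : measurable_fun setT (f n) ->
  (forall p, 0 <= f n p) ->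
  (\int[P]_w (mean f n w)%:E =
   (n%:R / (k n)%:R)%:E * \int[P]_w (f n (X w, Y w))%:E)%E.
Proof.
move=> mf f0; have mg i : measurable_fun setT (fun w => (f n (Xs i w, Ys i w))%:E).
  by apply/measurable_EFinP; exact: (measurableT_comp mf (mXY i)).
rewrite /sample_mean ge0_integral_const//; last 2 first.
- apply: measurable_sum => i; exact: (measurableT_comp mf (mXY i)).
- by move=> w; rewrite sumr_ge0.
under eq_integral do rewrite -sumEFin.
rewrite ge0_integral_sum//; last by move=> i w _; rewrite lee_fin.
under eq_bigr do rewrite (integral_sample iid _ mf f0).
rewrite -[X in (_ * X)%E](_ : (n%:R%:E * \int[P]_w (f n (X w, Y w))%:E)%E = _).
  by rewrite muleA -EFinM [_^-1 * _]mulrC.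
have : (0 <= \int[P]_w (f n (X w, Y w))%:E)%E.
  by apply: integral_ge0 => w _; rewrite lee_fin.
case: integral => [r _|_|]//.
  by rewrite sumEFin sumr_const_nat subn0 -EFinM mulr_natl.
case: n {mf f0 mg} => [|n]; first by rewrite mul0e big_geq.
rewrite gt0_muley ?lte_fin ?ltr0n// big_nat_recr//=.
set s := (\sum_(0 <= i < n) _)%E.
have : (0 <= s)%E by exact: sume_ge0.
by case: s.
Qed.

(** Chebyshev's inequality: the variance is at most k^-2 n B mu = (B / k) (n mu / k), where n mu / k
    converges and k tends to infinity. *)
Lemma sample_mean_cvg (f : nat -> RR -> R) (B c : R) :
  (forall n, measurable_fun setT (f n)) -> (forall n p, 0 <= f n p) ->
  (forall n p, f n p <= B) ->
  ((n%:R / (k n)%:R)%:E * \int[P]_w (f n (X w, Y w))%:E)%E @[n --> \oo] --> c%:E ->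
  mean f p.1 p.2 @[p --> whp P] --> c.
Proof.
move=> mf f0 fB fc.
have B0 : 0 <= B by apply: le_trans (fB 0 point).
pose mu n := fine (\int[P]_w (f n (X w, Y w))%:E)%E.
have muE n : (\int[P]_w (f n (X w, Y w))%:E = (mu n)%:E)%E.
  rewrite fineK// ge0_fin_numE; last by apply: integral_ge0 => w _; rewrite lee_fin.
  apply: (@le_lt_trans _ _ (\int[P]_w B%:E)%E); last first.
    by rewrite integral_cst// [X in (_ * X)%E]probability_setT mule1 ltry.
  apply: ge0_le_integral_fin => //.
  by apply: measurableT_comp (mf n) _; exact: measurable_rv_pair.
have mc : n%:R / (k n)%:R * mu n @[n --> \oo] --> c.
  by move: fc; under eq_fun do rewrite muE -EFinM; move/fine_cvg.
have kinv : (k n)%:R^-1 @[n --> \oo] --> (0 : R).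
  rewrite gtr0_cvgV0; first exact: (cvg_comp _ _ koo cvgr_idn).
  by apply: filterS kpos => n kn; rewrite ltr0n.
have Bk : (k n)%:R^-1 * (B * (n%:R / (k n)%:R * mu n)) @[n --> \oo] --> 0 * (B * c).
  by apply: cvgM => //; apply: cvgMr.
rewrite mul0r in Bk.
apply/cvgrPdist_lt => e e0 del del0.
have K0 : 0 < (e / 2) ^+ 2 by rewrite exprn_gt0// divr_gt0.
have Kd : 0 < (e / 2) ^+ 2 * del by rewrite mulr_gt0.
have e2 : 0 < e / 2 by rewrite divr_gt0.
move/cvgrPdist_lt : mc => /(_ _ e2) mc; move/cvgrPdist_le : Bk => /(_ _ Kd) Bk.
apply: filterS3 mc Bk kpos => n mcn Bkn kn.
have k0 : 0 < (k n)%:R :> R by rewrite ltr0n.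
pose V w := (k n)%:R^-2 * (\sum_(0 <= i < n) f n (Xs i w, Ys i w) - n%:R * mu n) ^+ 2 : R.
have mV0 : measurable_fun setT (fun w =>
    (\sum_(0 <= i < n) f n (Xs i w, Ys i w) - n%:R * mu n) ^+ 2 : R).
  apply: measurable_funX; apply: measurable_funB => //.
  by apply: measurable_sum => i; exact: (measurableT_comp (mf n) (mXY i)).
have mV : measurable_fun setT V by exact: measurable_funM.
have V0 w : 0 <= V w by rewrite mulr_ge0 ?sqr_ge0// invr_ge0 exprn_ge0.
have VC : (\int[P]_w (V w)%:E <= ((e / 2) ^+ 2 * del)%:E)%E.
  rewrite ge0_integral_const//; last by move=> w; exact: sqr_ge0.
  apply: (@le_trans _ _ (((k n)%:R^-2)%:E * (n%:R * (B * mu n))%:E)%E).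
    rewrite lee_wpmul2l ?lee_fin ?invr_ge0 ?exprn_ge0//.
    exact: (sample_variance_le iid n (mf n) (f0 n) (fB n) (muE n)).
  rewrite -EFinM lee_fin; move: Bkn; rewrite sub0r normrN => /(le_trans (ler_norm _)).
  apply: le_trans; rewrite le_eqVlt; apply/orP; left; apply/eqP.
  by field; rewrite gt_eqF.
have [mA PA] := markov_fin mV V0 K0 VC.
exists [set w | (e / 2) ^+ 2 <= V w]; split => // w /= /negP; rewrite -ltNge => Vw.
have Vsq : V w = (mean f n w - n%:R / (k n)%:R * mu n) ^+ 2.
  by rewrite /V /sample_mean; field; rewrite gt_eqF.
move: Vw; rewrite Vsq -[ltLHS]real_normK ?num_real// ltr_pXn2r ?nnegrE ?normr_ge0 ?(ltW e2)// => Vw.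
rewrite (_ : c - _ = (c - n%:R / (k n)%:R * mu n) -
  (mean f n w - n%:R / (k n)%:R * mu n)); last by ring.
apply: le_lt_trans (ler_normB _ _) _.
by rewrite [e]splitr ltrD.
Unshelve. all: by end_near. Qed.

End weak_law_cvg.

(** * Order statistics *)

Section sorted_suffix.
Context {R : realType}.
Implicit Types (S : seq (R * R)) (u : R).
Local Notation le1 := (fun p q : R * R => p.1 <= q.1).

(** In ascending order the points above u form a suffix, so comparing the upper k points with { x >
    u } amounts to comparing two suffix lengths. *)
Lemma sorted_filter_gt S u : sorted le1 S ->
  [seq z <- S | u < z.1] = drop (size S - count (fun z => u < z.1) S) S.
Proof.
have tr : transitive le1 by move=> ? ? ?; exact: le_trans.
elim: S => [|z S IH]//= zS; have sS := path_sorted zS.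
rewrite IH//; have [uz|zu] := ltP u z.1.
  have -> : count (fun z => u < z.1) S = size S.
    apply/eqP; rewrite -all_count; apply/allP => t tS.
    have /allP/(_ t tS) := order_path_min tr zS.
    exact: lt_le_trans.
  by rewrite subnn drop0 add1n subnn.
by rewrite add0n subSn// count_size.
Qed.

Lemma big_drop_le S i j (f : R * R -> R) : (i <= j)%N -> (forall z, 0 <= f z) ->
  \sum_(z <- drop j S) f z <= \sum_(z <- drop i S) f z.
Proof.
move=> ij f0; rewrite -(subnKC ij) addnC -drop_drop.
rewrite -[X in _ <= \sum_(z <- X) _](cat_take_drop (j - i)) big_cat/= lerDr.
by rewrite sumr_ge0.
Qed.

Lemma suffix_ge S u k (f : R * R -> R) : sorted le1 S ->
  (count (fun z => (u < z.1)%R) S <= k)%N -> (forall z, 0 <= f z) ->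
  \sum_(z <- S | u < z.1) f z <= \sum_(z <- drop (size S - k) S) f z.
Proof.
move=> sS ck f0; have := sorted_filter_gt u sS; rewrite -[X in X <= _]big_filter => ->.
by apply: big_drop_le => //; rewrite leq_sub2l.
Qed.

Lemma suffix_le S u k (f : R * R -> R) : sorted le1 S ->
  (k <= count (fun z => (u < z.1)%R) S)%N -> (forall z, 0 <= f z) ->
  \sum_(z <- drop (size S - k) S) f z <= \sum_(z <- S | u < z.1) f z.
Proof.
move=> sS ck f0; have := sorted_filter_gt u sS; rewrite -[X in _ <= X]big_filter => ->.
by apply: big_drop_le => //; rewrite leq_sub2l.
Qed.

Lemma suffix_gt S u k : sorted le1 S ->
  (k <= count (fun z => (u < z.1)%R) S)%N ->
  {in drop (size S - k) S, forall z, u < z.1}.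
Proof.
move=> sS ck z zk.
suff : z \in [seq z <- S | u < z.1] by rewrite mem_filter => /andP[].
rewrite sorted_filter_gt//; move: zk.
have h : (size S - count (fun z => (u < z.1)%R) S <= size S - k)%N by rewrite leq_sub2l.
by rewrite -(subnKC h) addnC -drop_drop => /mem_drop.
Qed.

(** Counted from 0, position (size S - k).-1 holds the (k + 1)-th largest value; hence the strict
    inequality on the count. *)
Lemma nth_suffix_gt S u k x0 : sorted le1 S -> (k < size S)%N ->
  (k < count (fun z => (u < z.1)%R) S)%N -> u < (nth x0 S (size S - k).-1).1.
Proof.
move=> sS kS ck; apply: (suffix_gt sS ck).
rewrite -subnS (_ : nth x0 S _ = nth x0 (drop (size S - k.+1) S) 0); last first.
  by rewrite nth_drop addn0.
by apply: mem_nth; rewrite size_drop subKn.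
Qed.

Lemma nth_suffix_le S u k x0 : sorted le1 S -> (k < size S)%N ->
  (count (fun z => (u < z.1)%R) S <= k)%N -> (nth x0 S (size S - k).-1).1 <= u.
Proof.
move=> sS kS ck; rewrite leNgt; apply/negP => un.
suff : (k.+1 <= count (fun z => (u < z.1)%R) S)%N by rewrite ltnNge ck.
have tr : transitive le1 by move=> ? ? ?; exact: le_trans.
rewrite -[X in count _ X](cat_take_drop (size S - k.+1)) count_cat.
rewrite (_ : count _ (drop _ _) = k.+1) ?leq_addl//.
have sz : size (drop (size S - k.+1) S) = k.+1 by rewrite size_drop subKn.
rewrite -[RHS]sz; apply/eqP; rewrite -all_count; apply/(all_nthP x0) => i.
rewrite sz => ik; rewrite nth_drop; apply: (lt_le_trans un); rewrite -subnS.
apply: (sorted_leq_nth tr _ x0 sS) => //.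
- by change (size S - k.+1 < size S)%N; lia.
- by change (size S - k.+1 + i < size S)%N; lia.
- by rewrite leq_addr.
Qed.

Lemma big_top S k x0 (f : R * R -> R) : (k <= size S)%N ->
  \sum_(1 <= i < k.+1) f (nth x0 S (size S - i + 1).-1) =
  \sum_(z <- drop (size S - k) S) f z.
Proof.
move=> kS; rewrite (big_nth x0) size_drop subKn// big_add1/= big_nat_rev/= add0n.
apply: eq_big_nat => i /andP[_ ik]; rewrite nth_drop addn1/=; congr (f (nth _ _ _)).
have := ltnW ik; lia.
Qed.

End sorted_suffix.

(** Inversion is not continuous at 0; it is written with a measurable power of |x|, in a form that
    also respects 0^-1 = 0. *)
Lemma measurable_inv (R : realType) : measurable_fun setT (fun x : R => x^-1).
Proof.
rewrite (_ : (fun x => _) = (fun x : R => x * (`|x| `^ (-1)) ^+ 2)).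
  apply: measurable_funM => //; apply: measurable_funX.
  exact: (measurableT_comp (@measurable_powR R (-1))).
apply/funext => x; rewrite powR_inv1// exprVn real_normK ?num_real//.
have [->|x0] := eqVneq x 0; first by rewrite invr0 mul0r.
by field.
Qed.

(** * Measurability of the estimators *)

Section measurability.
Context d (T : measurableType d) (R : realType) (P : probability T R).
Context (Xs Ys : nat -> {RV P >-> R}).

(** The sorting permutation depends on w only through this finite table. On each of the finitely
    many events that fix the table, order statistics and concomitants are read off at a fixed
    index. *)
Definition comparisons n (w : T) : {ffun 'I_n * 'I_n -> bool} :=
  [ffun ij : 'I_n * 'I_n => Xs ij.1 w <= Xs ij.2 w].

Lemma measurable_comparisons n (c : {ffun 'I_n * 'I_n -> bool}) :
  measurable [set w | comparisons n w = c].
Proof.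
rewrite (_ : mkset _ =
    \big[setI/setT]_(ij : 'I_n * 'I_n) [set w | (Xs ij.1 w <= Xs ij.2 w) = c ij]).
  apply: bigsetI_measurable => ij _.
  rewrite -[X in measurable X]setTI.
  rewrite -[mkset _]/((fun w => Xs ij.1 w <= Xs ij.2 w) @^-1` [set c ij]).
  exact: (measurable_fun_ler (measurable_funP (Xs ij.1)) (measurable_funP (Xs ij.2))).
apply/seteqP; split => w /=.
  by move=> <-; rewrite -bigcap_seq => ij _ /=; rewrite ffunE.
move=> H; apply/ffunP => ij; rewrite ffunE.
by move: H; rewrite -bigcap_seq => /(_ ij); apply; rewrite /= mem_index_enum.
Qed.

Definition sorting_of n (c : {ffun 'I_n * 'I_n -> bool}) : seq 'I_n :=
  sort (fun i j => c (i, j)) (enum 'I_n).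

Lemma ordered_sampleE n w : ordered_sample Xs Ys n w =
  [seq (Xs (val i) w, Ys (val i) w) | i <- sorting_of (comparisons n w)].
Proof.
rewrite /ordered_sample -val_enum_ord -map_comp sort_map /sorting_of; congr map.
by congr (sort _ _); apply/funext => i; apply/funext => j; rewrite ffunE.
Qed.

Lemma measurable_of_comparisons n (h : {ffun 'I_n * 'I_n -> bool} -> T -> R) :
  (forall c, measurable_fun setT (h c)) ->
  measurable_fun setT (fun w => h (comparisons n w) w).
Proof.
move=> mh _ B mB; rewrite setTI.
rewrite (_ : _ @^-1` _ =
    \big[setU/set0]_c ([set w | comparisons n w = c] `&` (h c @^-1` B))).
  apply: bigsetU_measurable => c _; apply: measurableI.
    exact: measurable_comparisons.
  by rewrite -[X in measurable X]setTI; exact: mh.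
apply/seteqP; split => w /=.
  move=> hB; rewrite -bigcup_seq; exists (comparisons n w) => //=.
  by rewrite mem_index_enum.
by rewrite -bigcup_seq => -[c _ [/= <-]].
Qed.

Lemma measurable_order_stat n i : measurable_fun setT (order_stat Xs Ys n i).
Proof.
rewrite (_ : order_stat Xs Ys n i = fun w =>
  (nth (0, 0) [seq (Xs (val j) w, Ys (val j) w) | j <- sorting_of (comparisons n w)] i.-1).1).
  apply: (measurable_of_comparisons (h := fun c w =>
    (nth (0, 0) [seq (Xs (val j) w, Ys (val j) w) | j <- sorting_of c] i.-1).1)) => c.
  have [ic|ci] := ltnP i.-1 (size (sorting_of c)).
    have j0 : 'I_n by case: (sorting_of c) ic => [|j] //.
    rewrite (_ : (fun w => _) = (Xs (nth j0 (sorting_of c) i.-1) : T -> R))//.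
    by apply/funext => w; rewrite (nth_map j0).
  rewrite (_ : (fun w => _) = (fun=> 0))//.
  by apply/funext => w; rewrite nth_default ?size_map.
by apply/funext => w; rewrite /order_stat ordered_sampleE.
Qed.

Lemma measurable_concomitant n i : measurable_fun setT (concomitant Xs Ys n i).
Proof.
rewrite (_ : concomitant Xs Ys n i = fun w =>
  (nth (0, 0) [seq (Xs (val j) w, Ys (val j) w) | j <- sorting_of (comparisons n w)] i.-1).2).
  apply: (measurable_of_comparisons (h := fun c w =>
    (nth (0, 0) [seq (Xs (val j) w, Ys (val j) w) | j <- sorting_of c] i.-1).2)) => c.
  have [ic|ci] := ltnP i.-1 (size (sorting_of c)).
    have j0 : 'I_n by case: (sorting_of c) ic => [|j] //.
    rewrite (_ : (fun w => _) = (Ys (nth j0 (sorting_of c) i.-1) : T -> R))//.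
    by apply/funext => w; rewrite (nth_map j0).
  rewrite (_ : (fun w => _) = (fun=> 0))//.
  by apply/funext => w; rewrite nth_default ?size_map.
by apply/funext => w; rewrite /concomitant ordered_sampleE.
Qed.

Lemma measurable_rho_hat n k : measurable_fun setT (rho_hat Xs Ys n k).
Proof.
have mo := measurable_order_stat; have mc := measurable_concomitant.
apply: measurable_funM.
  by apply: measurable_sum => i; apply: measurable_funM => //; exact: measurable_funB.
apply: (measurableT_comp (f := @GRing.inv R)); first exact: measurable_inv.
by apply: measurable_sum => i; apply: measurable_funM => //; exact: measurable_funB.
Qed.

Lemma measurable_a_check n k : measurable_fun setT (a_check Xs Ys n k).
Proof.
have mo := measurable_order_stat; have mc := measurable_concomitant.
have mr := measurable_rho_hat.
have ms : measurable_fun setT (@Num.sqrt R).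
  by apply: continuous_measurable_fun; exact: sqrt_continuous.
apply: (measurableT_comp (g := fun w => k%:R^-1 * \sum_(1 <= i < k.+1)
    (concomitant Xs Ys n (n - i + 1) w
     - rho_hat Xs Ys n k w * order_stat Xs Ys n (n - i + 1) w) ^+ 2) ms).
apply: measurable_funM => //; apply: measurable_sum => i.
apply: measurable_funX; apply: measurable_funB => //; exact: measurable_funM.
Qed.

Lemma measurable_Psi_check n k z : measurable_fun setT (Psi_check Xs Ys n k z).
Proof.
have mo := measurable_order_stat; have mc := measurable_concomitant.
have mr := measurable_rho_hat; have ma := measurable_a_check.
apply: measurable_funM => //; apply: measurable_sum => i.
apply: measurable_natr_bool; apply: measurable_fun_ler => //.
by apply: measurable_funD; exact: measurable_funM.
Qed.

End measurability.

(** * The intermediate sample *)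

Section intermediate_sample.
Context d (T : measurableType d) (R : realType) (P : probability T R).
Context (X Y : {RV P >-> R}) (Xs Ys : nat -> {RV P >-> R}).
Context (gamma : R) (a b m psi : R -> R).
Context (nu : {measure set (\bar R * \bar R) -> \bar R}) (rho : R)
  (Psi : cumulativeBounded (0:R) (1:R)).
Local Notation RR := (measurableTypeR R * measurableTypeR R)%type.
Local Notation lsf := (lebesgue_stieltjes_measure Psi).
Hypothesis iid : iid_copies X Y Xs Ys.
Hypothesis right_endpoint : gamma = 0 -> infinite_right_endpoint X.
Hypothesis A1 : assumption1 X Y gamma a b m psi nu.
Hypothesis A2 : assumption2 X Y gamma a b m psi nu 1 2.
Hypothesis A4 : assumption4 gamma m psi nu rho Psi.
Hypothesis normalized : (\int[lsf]_y (y ^+ 2)%:E = 1)%E.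
Hypothesis mu0 : cross_moment nu = 0%E.
Context (k : nat -> nat).
Hypothesis k_intermediate : intermediate R k.

Definition level n : nat := Num.truncn (n%:R / (k n)%:R / expR 1 : R).
Local Notation N := level.
Local Notation tau n := (n%:R / (k n)%:R : R).

Lemma expR1_le4 : expR 1 <= 4 :> R.
Proof.
have h : 2^-1 <= expR (- 2^-1) :> R.
  by apply: le_trans (expR_ge1Dx _); lra.
have : 4^-1 <= expR (- 1) :> R.
  rewrite (_ : - 1 = - 2^-1 + - 2^-1 :> R); last by field.
  rewrite expRD (_ : 4^-1 = 2^-1 * 2^-1 :> R); last by field.
  by rewrite ler_pM// invr_ge0.
by rewrite expRN lef_pV2 ?posrE ?expR_gt0.
Qed.

Lemma level_cvgy : N n @[n --> \oo] --> \oo.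
Proof.
have [_ tauoo] := k_intermediate.
apply/cvgnyPge => A; move/cvgryPge : tauoo => /(_ (A%:R * expR 1)).
apply: filterS => n tn; rewrite /level.
have e0 := expR_gt0 (1 : R).
have t0 : 0 <= tau n / expR 1 by apply: divr_ge0; [exact: divr_ge0|exact: ltW].
by rewrite truncn_ge_nat// ler_pdivlMr.
Qed.

Lemma level_gt0 : \forall n \near \oo, (0 < N n)%N.
Proof. exact: (level_cvgy (nbhs_infty_gt 0)). Qed.

Lemma level_bounds : \forall n \near \oo,
  (N n)%:R <= tau n <= 8 * (N n)%:R /\ (N n)%:R * expR 1 <= tau n <= ((N n)%:R + 1) * expR 1.
Proof.
apply: filterS level_gt0 => n /= N0.
have e0 := expR_gt0 (1 : R); have e4 := expR1_le4.
have e1 : 1 <= expR 1 :> R by rewrite -[X in X <= _]expR0 ler_expR.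
have t0 : 0 <= tau n / expR 1 by rewrite divr_ge0 ?expR_ge0// divr_ge0.
have h1 : (N n)%:R * expR 1 <= tau n by rewrite -ler_pdivlMr// truncn_le.
have h2 : tau n <= ((N n)%:R + 1) * expR 1.
  by rewrite -ler_pdivrMr// natr1 ltW// truncnS_gt.
have N1 : 1 <= (N n)%:R :> R by rewrite ler1n.
split; last by rewrite h1 h2.
by apply/andP; split; nra.
Qed.

(** This factor e turns the limit exp (- s) of the tail mass into exp (1 - s), which equals 1
    exactly at s = 1. *)
Lemma tau_level_cvg : tau n / (N n)%:R @[n --> \oo] --> expR 1.
Proof.
have inv0 : (N n)%:R^-1 @[n --> \oo] --> (0 : R).
  rewrite gtr0_cvgV0; first exact: (cvg_comp _ _ level_cvgy cvgr_idn).
  by apply: filterS level_gt0 => n /= kn; rewrite ltr0n.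
have up : expR 1 + (N n)%:R^-1 * expR 1 @[n --> \oo] --> (expR 1 + 0 * expR 1 : R).
  by apply: cvgD; [exact: cvg_cst|exact: cvgMl].
rewrite mul0r addr0 in up.
apply: (@squeeze_cvgr _ _ _ _ (fun=> expR 1) (fun n => expR 1 + (N n)%:R^-1 * expR 1));
  [|exact: cvg_cst|exact: up].
apply: filterS2 level_bounds level_gt0 => n [_ /andP[h1 h2]] /= N0.
have N0r : 0 < (N n)%:R :> R by rewrite ltr0n.
rewrite ler_pdivlMr// mulrC h1/= ler_pdivrMr// (le_trans h2)//.
rewrite le_eqVlt; apply/orP; left; apply/eqP; field; by rewrite gt_eqF.
Qed.

Definition xi n (z : R * R) : R := (z.1 - b (N n)%:R) / psi (b (N n)%:R).
Definition eta n (z : R * R) : R := (z.2 - m (b (N n)%:R)) / a (b (N n)%:R).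

Lemma measurable_xi n : measurable_fun setT (xi n : RR -> R).
Proof. by rewrite /xi; meas. Qed.

Lemma measurable_eta n : measurable_fun setT (eta n : RR -> R).
Proof. by rewrite /eta; meas. Qed.

(** The sum runs over the whole sample but is divided by k: for the functions F of interest, only a
    number of points of order k contributes. *)
Definition rescaled_mean (F : RR -> R) : nat -> T -> R :=
  sample_mean Xs Ys k (fun n z => F (xi n z, eta n z)).

Lemma integral_rescaled_mean (F : RR -> R) n : measurable_fun setT F ->
  (forall p, 0 <= F p) -> (0 < N n)%N ->
  (\int[P]_w (rescaled_mean F n w)%:E =
   (tau n / (N n)%:R)%:E * \int[mu_ X Y a b m psi (N n)]_p (F p)%:E)%E.
Proof.
move=> mF F0 N0.
rewrite (integral_sample_mean iid); last 2 first.
- apply: (measurableT_comp mF); apply: measurable_fun_pair.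
    exact: measurable_xi.
  exact: measurable_eta.
- by move=> p; exact: F0.
rewrite integral_mu_// muleA -EFinM; congr (_%:E * _)%E.
by rewrite divfK// pnatr_eq0 -lt0n.
Qed.

Lemma measurable_rescaled_mean F n : measurable_fun setT F ->
  measurable_fun setT (rescaled_mean F n).
Proof.
move=> mF; apply: (@measurable_sample_mean _ _ _ P Xs Ys k (fun n z => F (xi n z, eta n z))).
apply: (measurableT_comp mF); apply: measurable_fun_pair.
  exact: measurable_xi.
exact: measurable_eta.
Qed.

Definition tail_mean (s : R) (g : R -> R) : nat -> T -> R :=
  rescaled_mean (fun p => (s < p.1)%R%:R * g p.2).

Section tail_mean.
Context (s C G : R) (g : R -> R).
Hypotheses (s0 : 0 < s) (cg : continuous g) (g0 : forall y, 0 <= g y).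
Hypothesis gG : (\int[lsf]_y (g y)%:E = G%:E)%E.

Let mg : measurable_fun setT g.
Proof. exact: continuous_measurable_fun. Qed.

Lemma measurable_tail n : measurable_fun setT (tail_mean s g n).
Proof. by apply: measurable_rescaled_mean; meas. Qed.

Lemma tail_mean_ge0 n w : 0 <= tail_mean s g n w.
Proof.
apply: (@sample_mean_ge0 _ _ _ P Xs Ys k
  (fun n z => (s < xi n z)%R%:R * g (eta n z)) n w) => p.
exact: mulr_ge0.
Qed.

Lemma integral_tail_mean_cvg : (forall y, g y <= C * (1 + y ^+ 2)) ->
  (\int[P]_w (tail_mean s g n w)%:E)%E @[n --> \oo] --> (expR (1 - s) * G)%:E.
Proof.
move=> gC.
have c1 : (\int[mu_ X Y a b m psi (N n)]_p ((s < p.1)%R%:R * g p.2)%:E)%E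
    @[n --> \oo] --> (expR (- s) * G)%:E.
  exact: (cvg_comp _ _ level_cvgy (tail_cvg A1 A2 A4 normalized s0 cg g0 gC gG)).
have c2 : (tau n / (N n)%:R)%:E @[n --> \oo] --> (expR 1)%:E.
  by apply/fine_cvgP; split; [exact: nearW|exact: tau_level_cvg].
rewrite expRD -mulrA EFinM.
have := cvgeM _ c2 c1; rewrite mule_def_fin// => /(_ _ isT).
apply: cvg_trans; apply: near_eq_cvg; apply: filterS level_gt0 => n N0.
have mF : measurable_fun setT (fun p : RR => (s < p.1)%R%:R * g p.2) by meas.
by rewrite [RHS](integral_rescaled_mean mF)// => p; exact: mulr_ge0.
Qed.

Lemma tail_mean_cvg_bounded (B : R) : (forall y, g y <= B) ->
  (forall y, g y <= C * (1 + y ^+ 2)) ->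
  tail_mean s g p.1 p.2 @[p --> whp P] --> expR (1 - s) * G.
Proof.
move=> gB gC.
have mf n : measurable_fun setT (fun z : RR => (s < xi n z)%R%:R * g (eta n z)).
  apply: measurable_funM.
    by apply: measurable_natr_bool; apply: measurable_fun_ltr => //; exact: measurable_xi.
  by apply: measurableT_comp mg _; exact: measurable_eta.
have f0 n (z : RR) : 0 <= (s < xi n z)%R%:R * g (eta n z) by exact: mulr_ge0.
apply: (sample_mean_cvg iid k_intermediate.1 (B := B) mf f0) => [n p|].
  have B0 : 0 <= B by exact: le_trans (g0 0) (gB 0).
  by case: ltP => _; rewrite ?mul1r ?mul0r.
have := integral_tail_mean_cvg gC.
apply: cvg_trans; apply: near_eq_cvg; near=> n.
exact: (integral_sample_mean iid k
  (f := fun n z => (s < xi n z)%R%:R * g (eta n z)) (mf n) (f0 n)).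
Unshelve. all: by end_near. Qed.

End tail_mean.

(** The weak law covers the bounded part g [cut] M. The expectation of the discarded part also
    converges, to a limit that is small for large M, and Markov's inequality makes that part small
    off an event of probability [del]. *)
Lemma tail_mean_cvg (s C G : R) (g : R -> R) : 0 < s -> continuous g ->
  (forall y, 0 <= g y) -> (forall y, g y <= C * (1 + y ^+ 2)) ->
  (\int[lsf]_y (g y)%:E = G%:E)%E ->
  tail_mean s g p.1 p.2 @[p --> whp P] --> expR (1 - s) * G.
Proof.
move=> s0 cg g0 gC gG.
have mg : measurable_fun setT g by exact: continuous_measurable_fun.
have C0 : 0 <= C.
  by have := le_trans (g0 0) (gC 0); rewrite expr0n addr0 mulr1.
pose gi (M : nat) y := g y * cut M%:R y.
pose go (M : nat) y := g y * (1 - cut M%:R y).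
have cgi M : continuous (gi M).
  by move=> y; apply: cvgM; [exact: cg|exact: cut_continuous].
have cgo M : continuous (go M).
  move=> y; apply: cvgM; first exact: cg.
  by apply: cvgB; [exact: cvg_cst|exact: cut_continuous].
have c1 M y : 0 <= 1 - cut M y :> R by rewrite subr_ge0 cut_le1.
have gi0 M y : 0 <= gi M y by rewrite mulr_ge0// cut_ge0.
have go0 M y : 0 <= go M y by rewrite mulr_ge0.
have giC M y : gi M y <= C * (1 + y ^+ 2).
  by apply: le_trans (gC y); rewrite /gi ler_piMr// cut_le1.
have goC M y : go M y <= C * (1 + y ^+ 2).
  by apply: le_trans (gC y); rewrite /go ler_piMr// gerBl cut_ge0.
have giB M y : gi M y <= C * (1 + (M%:R + 1) ^+ 2).
  have [yM|My] := leP (M%:R + 1) `|y|.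
    by rewrite /gi cut0// mulr0 mulr_ge0// addr_ge0// sqr_ge0.
  apply: le_trans (giC M y) _; rewrite ler_wpM2l// lerD2l.
  by rewrite -[leLHS]real_normK ?num_real// lerXn2r ?nnegrE// ?addr_ge0// ltW.
have mgi M : measurable_fun setT (gi M) by exact: continuous_measurable_fun.
have mgo M : measurable_fun setT (go M) by exact: continuous_measurable_fun.
have GiE M : exists Gi, (\int[lsf]_y (gi M y)%:E = Gi%:E)%E.
  by have [Gi _ ?] := integral_Psi_fin normalized (mgi M) (gi0 M) (giC M); exists Gi.
have GoE M Gi : (\int[lsf]_y (gi M y)%:E = Gi%:E)%E ->
    (\int[lsf]_y (go M y)%:E = (G - Gi)%:E)%E.
  move=> iGi; have [Go _ iGo] := integral_Psi_fin normalized (mgo M) (go0 M) (goC M).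
  have := ge0_integralD_fin lsf (mgi M) (mgo M) (gi0 M) (go0 M).
  under eq_integral do rewrite /gi /go -mulrDr addrCA subrr addr0 mulr1.
  by rewrite gG iGi iGo -EFinD => -[->]; rewrite addrAC subrr add0r.
have cut_cvg : (\int[lsf]_y (gi M y)%:E)%E @[M --> \oo] --> G%:E.
  rewrite -gG; apply: ge0_integral_cutoff => //.
  - by move=> M; exact: measurable_cut.
  - by move=> M y; exact: cut_ge0.
  - by move=> y i j ij; apply: cut_homo; rewrite ler_nat.
  - by move=> y; exact: cut_near1.
apply/cvgrPdist_lt => e e0; apply: whp_approx => del del0.
set q := expR (1 - s); have q0 : 0 < q by exact: expR_gt0.
have e3 : 0 < e / 3 by rewrite divr_gt0.
(* The limit expectation of the discarded part becomes at most e / 3, which controls the bias, and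
   at most half of e del / 3, which leaves room to apply Markov's inequality for finite n. *)
pose e' := Num.min (e / 3) (e / 3 * del / 2) / q.
have e'0 : 0 < e' by rewrite divr_gt0// lt_min e3/= divr_gt0// mulr_gt0.
have [M _ /(_ M (leqnn M))] := cvge_near_eps cut_cvg e'0.
have [Gi iGi] := GiE M; rewrite iGi !lee_fin => /andP[Gi1 _].
have qG : q * (G - Gi) <= Num.min (e / 3) (e / 3 * del / 2).
  by rewrite mulrC -ler_pdivlMr// lerBlDr addrC -lerBlDr.
have GGi : 0 <= G - Gi.
  by rewrite -lee_fin -(GoE M _ iGi); apply: integral_ge0 => y _; rewrite lee_fin.
have vi := tail_mean_cvg_bounded s0 (cgi M) (gi0 M) iGi (giB M) (giC M).
exists [set p | `|q * Gi - tail_mean s (gi M) p.1 p.2| < e / 3].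
  by move/cvgrPdist_lt : vi; exact.
have vo := integral_tail_mean_cvg s0 (cgo M) (go0 M) (GoE M _ iGi) (goC M).
have d2 : 0 < e / 3 * del / 2 by rewrite divr_gt0// mulr_gt0.
apply: filterS (cvge_near_eps vo d2) => n /andP[_ hn].
have hn' : (\int[P]_w (tail_mean s (go M) n w)%:E <= (e / 3 * del)%:E)%E.
  apply: le_trans hn _; rewrite lee_fin.
  by move: qG; rewrite le_min => /andP[_]; rewrite -/q; lra.
have [mA PA] := markov_fin (measurable_tail s (cgo M) n) (tail_mean_ge0 s (go0 M) n) e3 hn'.
exists [set w | e / 3 <= tail_mean s (go M) n w]; split => // w /= /negP.
rewrite -ltNge => V1 V2.
have VE : tail_mean s g n w = tail_mean s (gi M) n w + tail_mean s (go M) n w.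
  rewrite /tail_mean /rescaled_mean /sample_mean -mulrDr -big_split/=; congr (_ * _).
  by apply: eq_bigr => i _; rewrite /gi /go; ring.
have V0 := tail_mean_ge0 s (go0 M) n w.
have q3 : q * (G - Gi) <= e / 3 by move: qG; rewrite le_min => /andP[].
have q4 : 0 <= q * (G - Gi) by rewrite mulr_ge0// ltW.
rewrite VE; move: V2; rewrite !ltr_norml => /andP[V2 V3].
by apply/andP; split; lra.
Qed.

(** * Means over the upper k points *)

Local Notation S := (ordered_sample Xs Ys).
Local Notation bN n := (b (N n)%:R).
Local Notation psiN n := (psi (b (N n)%:R)).
Local Notation aN n := (a (b (N n)%:R)).

Definition top n w : seq (R * R) := drop (size (S n w) - k n) (S n w).

Definition top_mean n w (h : R * R -> R) : R := (k n)%:R^-1 * \sum_(z <- top n w) h z.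

Definition threshold n w : R := (order_stat Xs Ys n (n - k n) w - bN n) / psiN n.

Lemma size_ordered_sample n w : size (S n w) = n.
Proof. by rewrite size_sort size_map size_iota. Qed.

Lemma sorted_ordered_sample n w :
  sorted (fun p q : R * R => p.1 <= q.1) (S n w).
Proof. by apply: sort_sorted => p q; exact: le_total. Qed.

Lemma rescaled_mean_ordered (F : RR -> R) n w :
  rescaled_mean F n w = (k n)%:R^-1 * \sum_(z <- S n w) F (xi n z, eta n z).
Proof.
rewrite /rescaled_mean /sample_mean; congr (_ * _).
rewrite (perm_big [seq (Xs i w, Ys i w) | i <- iota 0 n]); last first.
  by apply/permPl; exact: perm_sort.
by rewrite big_map /index_iota subn0.
Qed.

Lemma top_meanD n w h1 h2 :
  top_mean n w (fun z => h1 z + h2 z) = top_mean n w h1 + top_mean n w h2.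
Proof. by rewrite /top_mean big_split mulrDr. Qed.

Lemma top_meanZ n w c h : top_mean n w (fun z => c * h z) = c * top_mean n w h.
Proof. by rewrite /top_mean -mulr_sumr mulrCA. Qed.

Lemma eq_top_mean n w h1 h2 : {in top n w, h1 =1 h2} ->
  top_mean n w h1 = top_mean n w h2.
Proof.
by move=> h12; rewrite /top_mean; congr (_ * _); apply: eq_big_seq => z /h12.
Qed.

Lemma top_mean_le n w h1 h2 : {in top n w, forall z, h1 z <= h2 z} ->
  top_mean n w h1 <= top_mean n w h2.
Proof.
move=> h12; rewrite /top_mean ler_wpM2l// big_seq [leRHS]big_seq.
by apply: ler_sum => z /h12.
Qed.

Lemma top_mean_ge0 n w h : {in top n w, forall z, 0 <= h z} -> 0 <= top_mean n w h.
Proof.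
by move=> h0; rewrite /top_mean mulr_ge0// big_seq sumr_ge0// => z /h0.
Qed.

Lemma top_mean_norm n w h : `|top_mean n w h| <= top_mean n w (fun z => `|h z|).
Proof.
rewrite /top_mean normrM ger0_norm ?invr_ge0// ler_wpM2l//.
exact: ler_norm_sum.
Qed.

Lemma top_mean_sum n w J (h : nat -> R * R -> R) :
  top_mean n w (fun z => \sum_(0 <= j < J) h j z) = \sum_(0 <= j < J) top_mean n w (h j).
Proof. by rewrite /top_mean exchange_big mulr_sumr. Qed.

(** The count at 1 - e exceeds k strictly, so that the (k + 1)-th largest point, which defines
    [threshold], also lies above 1 - e. *)
Definition bracketed (e : R) n w := [/\ (0 < k n < n)%N, 0 < bN n, 0 < aN n,
  0 < psiN n & (count (fun z => (1 + e < xi n z)%R) (S n w) <= k n <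
                count (fun z => (1 - e < xi n z)%R) (S n w))%N].

Section bracketed.
Context (e : R) (n : nat) (w : T) (br : bracketed e n w).

Let psi0 : 0 < psiN n. Proof. by case: br. Qed.
Let k0 : (0 < k n)%N. Proof. by case: br => /andP[]. Qed.
Let kn : (k n < n)%N. Proof. by case: br => /andP[]. Qed.

Let xi_gt s z : (s < xi n z) = (bN n + psiN n * s < z.1).
Proof. by rewrite /xi ltr_pdivlMr// ltrBrDl mulrC. Qed.

Let count_xi s : count (fun z => (s < xi n z)%R) (S n w) =
  count (fun z => (bN n + psiN n * s < z.1)%R) (S n w).
Proof. by apply: eq_count => z; rewrite xi_gt. Qed.

Lemma size_top : size (top n w) = k n.
Proof. by rewrite size_drop size_ordered_sample subKn// ltnW. Qed.

Lemma top_mean_cst c : top_mean n w (fun=> c) = c.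
Proof.
rewrite /top_mean big_const_seq count_predT size_top iter_addr_0 -[c *+ _]mulr_natl mulrA.
by rewrite mulVf ?mul1r// pnatr_eq0 -lt0n.
Qed.

Lemma top_xi_gt : {in top n w, forall z, 1 - e < xi n z}.
Proof.
case: br => _ _ _ _ /andP[_ kc] z zt; rewrite xi_gt.
apply: (suffix_gt (sorted_ordered_sample n w) _ zt).
by rewrite -count_xi ltnW.
Qed.

Lemma threshold_bounds : 1 - e < threshold n w <= 1 + e.
Proof.
case: br => _ _ _ _ /andP[ck kc]; apply/andP; split.
  rewrite /threshold -/(xi n (order_stat Xs Ys n (n - k n) w, 0)) xi_gt /=.
  rewrite /order_stat -[X in (X - k n)%N](size_ordered_sample n w).
  apply: nth_suffix_gt; rewrite ?size_ordered_sample ?sorted_ordered_sample//.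
  by rewrite -count_xi.
rewrite leNgt /threshold -/(xi n (order_stat Xs Ys n (n - k n) w, 0)) xi_gt /= -leNgt.
rewrite /order_stat -[X in (X - k n)%N](size_ordered_sample n w).
apply: nth_suffix_le; rewrite ?size_ordered_sample ?sorted_ordered_sample//.
by rewrite -count_xi.
Qed.

Lemma top_xi_ge_threshold : {in top n w, forall z, threshold n w <= xi n z}.
Proof.
have tr : transitive (fun p q : R * R => p.1 <= q.1) by move=> ? ? ?; exact: le_trans.
move=> z; rewrite /top size_ordered_sample => zt; rewrite /threshold /xi ler_pM2r ?invr_gt0// lerD2r.
rewrite -(nth_index (0, 0) zt) nth_drop /order_stat.
apply: (sorted_leq_nth tr _ (0, 0) (sorted_ordered_sample n w)) => //.
- by change ((n - k n).-1 < size (S n w))%N; rewrite size_ordered_sample; lia.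
- change (n - k n + index z (drop (n - k n) (S n w)) < size (S n w))%N.
  rewrite size_ordered_sample; move: zt; rewrite -index_mem size_drop size_ordered_sample.
  by move: kn; lia.
- by move: kn; lia.
Qed.

Lemma top_mean_upper (F : RR -> R) : (forall p, 0 <= F p) ->
  top_mean n w (fun z => F (xi n z, eta n z)) <=
  rescaled_mean (fun p => (1 - e < p.1)%R%:R * F p) n w.
Proof.
case: br => _ _ _ _ /andP[_ kc] F0; rewrite rescaled_mean_ordered ler_wpM2l//.
under [leRHS]eq_bigr do rewrite xi_gt mulr_natl mulrb.
rewrite -big_mkcond; apply: suffix_le; rewrite ?sorted_ordered_sample//.
by rewrite -count_xi ltnW.
Qed.

Lemma top_mean_lower (F : RR -> R) : (forall p, 0 <= F p) ->
  rescaled_mean (fun p => (1 + e < p.1)%R%:R * F p) n w <=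
  top_mean n w (fun z => F (xi n z, eta n z)).
Proof.
case: br => _ _ _ _ /andP[ck _] F0; rewrite rescaled_mean_ordered ler_wpM2l//.
under [leLHS]eq_bigr do rewrite xi_gt mulr_natl mulrb.
rewrite -big_mkcond; apply: suffix_ge; rewrite ?sorted_ordered_sample//.
by rewrite -count_xi.
Qed.

End bracketed.

(** For g = 1 the tail means are the counts divided by k; at 1 + e and 1 - e they tend to exp (- e)
    < 1 and exp e > 1. *)
Lemma near_bracketed (e : R) : 0 < e -> e < 1 ->
  \forall p \near whp P, bracketed e p.1 p.2.
Proof.
move=> e0 e1.
have c1 (s : R) : 0 < s -> tail_mean s (fun=> 1) p.1 p.2 @[p --> whp P] --> expR (1 - s).
  move=> s0; rewrite -[expR _]mulr1.
  have one0 (y : R) : 0 <= (fun=> 1 : R) y by [].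
  have oneC (y : R) : (fun=> 1 : R) y <= 1 * (1 + y ^+ 2).
    by rewrite mul1r lerDl sqr_ge0.
  have cone : continuous (fun _ : R => 1 : R) by move=> y; exact: cvg_cst.
  exact: (tail_mean_cvg s0 cone one0 oneC (integral_Psi_cst Psi 1)).
have up : \forall p \near whp P, tail_mean (1 + e) (fun=> 1) p.1 p.2 < 1.
  have p1 : 0 < 1 + e by lra.
  by apply: (cvgr_lt _ (c1 _ p1)); rewrite expR_lt1; lra.
have lo : \forall p \near whp P, 1 < tail_mean (1 - e) (fun=> 1) p.1 p.2.
  have p1 : 0 < 1 - e by lra.
  by apply: (cvgr_gt _ (c1 _ p1)); rewrite expR_gt1; lra.
have det : \forall n \near \oo, [/\ (0 < k n < n)%N, 0 < bN n, 0 < aN n & 0 < psiN n].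
  have koo : k n @[n --> \oo] --> \oo := k_intermediate.1.
  have tauoo := k_intermediate.2.
  have pos : \forall n \near \oo, [/\ (1 < N n)%N, 0 < bN n, 0 < aN n & 0 < psiN n].
    exact: (level_cvgy (near_pos right_endpoint A1 A4)).
  have k0 : \forall n \near \oo, (0 < k n)%N by move/cvgnyPgt : koo; exact.
  have t1 : \forall n \near \oo, 1 < tau n by move/cvgryPgt : tauoo; exact.
  apply: filterS3 pos k0 t1 => n [_ ? ? ?] k0; rewrite ltr_pdivlMr ?ltr0n// mul1r ltr_nat.
  by move=> kn; split => //; rewrite k0.
apply: filterS3 (whp_fst P det) up lo => -[n w] /= [kn b0 a0 p0] up lo; split => //.
have k0 : 0 < (k n)%:R :> R by rewrite ltr0n; case/andP: kn.
have cE s : tail_mean s (fun=> 1) n w = (k n)%:R^-1 * (count (fun z => (s < xi n z)%R) (S n w))%:R.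
  rewrite /tail_mean rescaled_mean_ordered; congr (_ * _).
  rewrite -sum1_count natr_sum [RHS]big_mkcond; apply: eq_bigr => z _.
  by rewrite mulr1; case: ifP.
move: up lo; rewrite !cE ![_^-1 * _]mulrC ltr_pdivrMr// ltr_pdivlMr// !mul1r !ltr_nat.
by move=> h1 h2; rewrite ltnW.
Qed.

Local Notation TM := (fun (h : nat -> R * R -> R) (p : nat * T) => top_mean p.1 p.2 (h p.1)).

Lemma near_threshold (e : R) : 0 < e ->
  \forall p \near whp P, `|threshold p.1 p.2 - 1| <= e.
Proof.
move=> e0; have e'0 : 0 < Num.min e 2^-1 by rewrite lt_min e0 invr_gt0 ltr0n.
have e'1 : Num.min e 2^-1 < 1 by rewrite gt_min invf_lt1 ?ltr1n ?orbT.
have H := near_bracketed e'0 e'1; refine (whp_imply H _) => n w {}H.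
have := threshold_bounds H.
have : Num.min e 2^-1 <= e by rewrite ge_min lexx.
by move=> ? /andP[? ?]; rewrite ler_norml; apply/andP; split; lra.
Qed.

Lemma threshold_cvg : threshold p.1 p.2 @[p --> whp P] --> (1 : R).
Proof.
apply/cvgrPdist_le => e /near_threshold H; refine (whp_imply H _) => n w.
by rewrite distrC.
Qed.

(** As s > 1, with high probability all points with xi > s are among the upper k, and the top mean
    coincides with the tail mean. *)
Lemma top_tail_cvg (s C G : R) (g : R -> R) : 1 < s -> continuous g ->
  (forall y, 0 <= g y) -> (forall y, g y <= C * (1 + y ^+ 2)) ->
  (\int[lsf]_y (g y)%:E = G%:E)%E ->
  TM (fun n z => (s < xi n z)%R%:R * g (eta n z)) p @[p --> whp P] --> expR (1 - s) * G.
Proof.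
move=> s1 cg g0 gC gG; have s0 : 0 < s by apply: lt_trans s1.
have e0 : 0 < Num.min (s - 1) 2^-1 by rewrite lt_min subr_gt0 s1 invr_gt0 ltr0n.
have e1 : Num.min (s - 1) 2^-1 < 1 by rewrite gt_min invf_lt1 ?ltr1n ?orbT.
have es : 1 + Num.min (s - 1) 2^-1 <= s by rewrite -lerBrDl ge_min lexx.
apply: cvg_trans (tail_mean_cvg s0 cg g0 gC gG); apply: near_eq_cvg.
refine (whp_imply (near_bracketed e0 e1) _) => n w /= br.
pose F (p : RR) := (s < p.1)%R%:R * g p.2.
have F0 p : 0 <= F p by exact: mulr_ge0.
have tailE u : u <= s -> (fun p : RR => (u < p.1)%R%:R * F p) = F.
  move=> us; apply/funext => p; rewrite /F; case: (ltP s p.1) => sp.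
    by rewrite (le_lt_trans us sp) !mul1r.
  by rewrite mul0r mulr0.
have := top_mean_upper br F0; have := top_mean_lower br F0.
rewrite !tailE//; last by lra.
by move=> h1 h2; apply/eqP; rewrite eq_le h1 h2.
Qed.

(** Squeezed between the tail means at 1 + t and 1 - t, whose limits exp (- t) G and exp t G are
    close to G for small t. *)
Lemma top_cvg (C G : R) (g : R -> R) : continuous g ->
  (forall y, 0 <= g y) -> (forall y, g y <= C * (1 + y ^+ 2)) ->
  (\int[lsf]_y (g y)%:E = G%:E)%E ->
  TM (fun n z => g (eta n z)) p @[p --> whp P] --> G.
Proof.
move=> cg g0 gC gG; apply/cvgrPdist_le => eps eps0.
have eps2 : 0 < eps / 2 by rewrite divr_gt0.
have c1 : expR t * G @[t --> 0^'+] --> G.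
  apply: cvg_at_right_filter; rewrite -[X in _ --> X]mul1r -[X in X * _]expR0.
  by apply: cvgMl; exact: continuous_expR.
have c2 : expR (- t) * G @[t --> 0^'+] --> G.
  rewrite -[X in _ --> X]mul1r -expR0 -[X in expR X](@oppr0 R).
  apply: cvg_at_right_filter; apply: cvgMl.
  by apply: continuous_comp; [apply: cvgN; exact: cvg_id|exact: continuous_expR].
near (0 : R)^'+ => t.
have t0 : 0 < t by near: t; exact: nbhs_right_gt.
have t1 : t < 1 by near: t; exact: nbhs_right_lt.
have h1 : `|G - expR t * G| <= eps / 2.
  by near: t; move/cvgrPdist_le : c1; exact.
have h2 : `|G - expR (- t) * G| <= eps / 2.
  by near: t; move/cvgrPdist_le : c2; exact.
have u0 : 0 < 1 + t by lra.
have l0 : 0 < 1 - t by lra.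
have cu := tail_mean_cvg u0 cg g0 gC gG.
have cl := tail_mean_cvg l0 cg g0 gC gG.
rewrite opprD addNKr in cu; rewrite opprB addrCA subrr addr0 in cl.
move/cvgrPdist_le : cu => /(_ _ eps2) cu; move/cvgrPdist_le : cl => /(_ _ eps2) cl.
refine (whp_imply3 (near_bracketed t0 t1) cu cl _) => n w /= br {}cu {}cl.
have F0 (p : RR) : 0 <= g p.2 by [].
have up := top_mean_upper br F0; have lo := top_mean_lower br F0.
move: h1 h2 cu cl up lo; rewrite /tail_mean !ler_norml.
by move=> /andP[? ?] /andP[? ?] /andP[? ?] /andP[? ?] /= ? ?; apply/andP; split; lra.
Unshelve. all: by end_near. Qed.

Let sq_cont (c : R) : continuous (fun y : R => (c + y) ^+ 2).
Proof.
move=> y; apply: (@continuous_comp _ _ _ (fun y => c + y) (fun t => t ^+ 2)).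
  by apply: cvgD; [exact: cvg_cst|exact: cvg_id].
exact: exprn_continuous.
Qed.

Let int_sq0 : (\int[lsf]_y ((0 + y) ^+ 2)%:E = (1 : R)%:E)%E.
Proof. by under eq_integral do rewrite add0r; exact: normalized. Qed.

Let int_sq1 : (\int[lsf]_y ((1 + y) ^+ 2)%:E = (2 : R)%:E)%E.
Proof.
exact: (Psi_centered (real_part_quadrant A4) normalized (cross_moment_real_part mu0)).
Qed.

Let int_one : (\int[lsf]_y (1 : R)%:E = (1 : R)%:E)%E.
Proof. exact: integral_Psi_cst. Qed.

Let sq0_le (y : R) : (0 + y) ^+ 2 <= 1 * (1 + y ^+ 2).
Proof. by rewrite add0r mul1r lerDr. Qed.

Let sq1_le (y : R) : (1 + y) ^+ 2 <= 2 * (1 + y ^+ 2).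
Proof. by have := sqr_ge0 (1 - y); nra. Qed.

Let one_le (y : R) : 1 <= 1 * (1 + y ^+ 2).
Proof. by rewrite mul1r lerDl sqr_ge0. Qed.

Lemma top_eta_sqr_cvg : TM (fun n z => eta n z ^+ 2) p @[p --> whp P] --> (1 : R).
Proof.
have := top_cvg (@sq_cont 0) (fun y => sqr_ge0 _) sq0_le int_sq0.
apply: cvg_trans; apply: near_eq_cvg; apply: nearW => p.
by apply: eq_top_mean => z _; rewrite add0r.
Qed.

(* [eta] is signed: it is a combination of nonnegative functions of [eta] *)
Lemma top_eta_cvg : TM (fun n z => eta n z) p @[p --> whp P] --> (0 : R).
Proof.
have c0 := top_eta_sqr_cvg.
have c1 := top_cvg (@sq_cont 1) (fun y => sqr_ge0 _) sq1_le int_sq1.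
have c2 : TM (fun n z => 1) p @[p --> whp P] --> (1 : R).
  by apply: (top_cvg _ _ one_le int_one) => // y; exact: cvg_cst.
have : 2^-1 * (TM (fun n z => (1 + eta n z) ^+ 2) p + - 1 * TM (fun n z => 1) p +
    - 1 * TM (fun n z => eta n z ^+ 2) p) @[p --> whp P] -->
    (2^-1 * (2 + - 1 * 1 + - 1 * 1) : R).
  by apply: cvgMr; apply: cvgD; [apply: cvgD => //|]; apply: cvgMr.
rewrite (_ : 2^-1 * (2 + - 1 * 1 + - 1 * 1) = 0 :> R); last by field.
apply: cvg_trans; apply: near_eq_cvg; apply: nearW => p.
rewrite -!top_meanZ -!top_meanD -top_meanZ; apply: eq_top_mean => z _ /=.
by field.
Qed.

Lemma top_tail_eta_cvg (s : R) : 1 < s ->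
  TM (fun n z => (s < xi n z)%R%:R * eta n z) p @[p --> whp P] --> (0 : R).
Proof.
move=> s1.
have c0 := top_tail_cvg s1 (@sq_cont 0) (fun y => sqr_ge0 _) sq0_le int_sq0.
have c1 := top_tail_cvg s1 (@sq_cont 1) (fun y => sqr_ge0 _) sq1_le int_sq1.
have c2 : TM (fun n z => (s < xi n z)%R%:R * 1) p @[p --> whp P] --> expR (1 - s) * 1.
  by apply: (top_tail_cvg s1 _ _ one_le int_one) => // y; exact: cvg_cst.
have : 2^-1 * (TM (fun n z => (s < xi n z)%R%:R * (1 + eta n z) ^+ 2) p +
    - 1 * TM (fun n z => (s < xi n z)%R%:R * 1) p +
    - 1 * TM (fun n z => (s < xi n z)%R%:R * (0 + eta n z) ^+ 2) p) @[p --> whp P] -->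
    (2^-1 * (expR (1 - s) * 2 + - 1 * (expR (1 - s) * 1) + - 1 * (expR (1 - s) * 1))).
  by apply: cvgMr; apply: cvgD; [apply: cvgD => //|]; apply: cvgMr.
rewrite (_ : 2^-1 * (_ + _) = 0 :> R); last by field.
apply: cvg_trans; apply: near_eq_cvg; apply: nearW => p.
rewrite -!top_meanZ -!top_meanD -top_meanZ; apply: eq_top_mean => z _ /=.
by field.
Qed.

Let mean_le8 (F : RR -> R) (C : R) : measurable_fun setT F -> (forall p, 0 <= F p) ->
  (\forall n \near \oo, (\int[mu_ X Y a b m psi n]_p (F p)%:E <= C%:E)%E) ->
  \forall n \near \oo, (\int[P]_w (rescaled_mean F n w)%:E <= (8 * C)%:E)%E.
Proof.
move=> mF F0 FC; have FCN : \forall n \near \oo, (\int[mu_ X Y a b m psi (N n)]_p (F p)%:E <= C%:E)%E.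
  exact: (level_cvgy FC).
apply: filterS3 FCN level_bounds level_gt0 => n FCn [/andP[_ h] _] N0.
rewrite (integral_rescaled_mean mF F0 N0) [X in (_ <= X)%E]EFinM.
apply: (@le_trans _ _ ((8 : R)%:E * \int[mu_ X Y a b m psi (N n)]_p (F p)%:E)%E).
  have tN : tau n / (N n)%:R <= 8 by rewrite ler_pdivrMr// ltr0n.
  rewrite lee_wpmul2r ?lee_fin//.
  by apply: integral_ge0 => p _; rewrite lee_fin.
have e8 : (0 <= (8 : R)%:E)%E by rewrite lee_fin.
exact: (lee_wpmul2l e8 FCn).
Qed.

(** The mean of xi^2 is only known to be bounded in expectation; a vanishing deterministic factor
    makes the product negligible. *)
Lemma top_xi_sqr_cvg (c : nat -> R) : c n @[n --> \oo] --> 0 ->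
  c p.1 * TM (fun n z => xi n z ^+ 2) p @[p --> whp P] --> (0 : R).
Proof.
move=> c0; have [C xC] := x2_bounded right_endpoint A1 A2 A4 normalized.
pose F (p : RR) := (0 < p.1)%R%:R * p.1 ^+ 2.
have mF : measurable_fun setT F by rewrite /F; meas.
have F0 p : 0 <= F p by rewrite mulr_ge0// sqr_ge0.
have := whp_bounded_mean c0 (fun n => measurable_rescaled_mean n mF)
  (fun n w => @sample_mean_ge0 _ _ _ P Xs Ys k (fun n z => F (xi n z, eta n z)) n w
    (fun z => F0 (xi n z, eta n z))) (mean_le8 mF F0 xC).
move/cvgrPdist_le => H; apply/cvgrPdist_le => e /H {}H.
have h0 : 0 < 2^-1 :> R by rewrite invr_gt0.
have h1 : 2^-1 < 1 :> R by rewrite invf_lt1 ?ltr1n.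
refine (whp_imply2 (near_bracketed h0 h1) H _) => n w /= br {H}; rewrite !sub0r !normrN.
apply: le_trans; rewrite [X in X <= _]normrM [X in _ <= X]normrM ler_wpM2l//.
have Q0 : 0 <= top_mean n w (fun z => xi n z ^+ 2).
  by apply: top_mean_ge0 => z _; exact: sqr_ge0.
rewrite (ger0_norm Q0); apply: le_trans (ler_norm _).
rewrite (eq_top_mean (h2 := fun z => F (xi n z, eta n z))); last first.
  by move=> z /(top_xi_gt br) xz; rewrite /F (_ : 0 < _) ?mul1r//=; lra.
apply: (le_trans (top_mean_upper br F0)).
rewrite /rescaled_mean /sample_mean ler_wpM2l// ler_sum// => i _.
by case: (_ < _); rewrite ?mul1r ?mul0r.
Qed.

(** The condition 1 - h <= x, rather than 1 <= x, allows for top points slightly below 1. Beyond the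
    last step the staircase is constant and the error is bounded crudely by x. *)
Lemma mesh_error (h x : R) J : 0 < h -> 1 - h <= x ->
  `|x - 1 - h * \sum_(0 <= j < J) (1 + j.+1%:R * h < x)%R%:R| <=
  h + (1 + J%:R * h < x)%R%:R * x.
Proof.
move=> h0 hx; set r := fun J => x - 1 - h * \sum_(0 <= j < J) (1 + j.+1%:R * h < x)%R%:R.
rewrite -/(r J).
have : (x <= 1 + J%:R * h -> `|r J| <= h) /\ (1 + J%:R * h < x -> r J = x - 1 - J%:R * h).
  elim: J => [|J [IH1 IH2]].
    rewrite /r big_geq// mul0r addr0 mulr0 !subr0; split => // x1.
    by rewrite ler0_norm; lra.
  have rS : r J.+1 = r J - h * (1 + J.+1%:R * h < x)%R%:R.
    by rewrite /r big_nat_recr//=; ring.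
  have J1 : J.+1%:R = J%:R + 1 :> R by rewrite natr1.
  split=> xJ; rewrite rS.
    rewrite ltNge xJ mulr0 subr0; have [/IH1//|Jx] := leP x (1 + J%:R * h).
    rewrite IH2// ger0_norm; last by lra.
    by move: xJ; rewrite J1; lra.
  rewrite xJ mulr1 IH2; first by rewrite J1; ring.
  by apply: lt_trans xJ; rewrite J1; lra.
have J0 : 0 <= J%:R * h by rewrite mulr_ge0// ltW.
case: (leP x (1 + J%:R * h)) => [xJ [/(_ isT) + _]|xJ [_ /(_ isT) ->]].
  by rewrite mul0r addr0.
by rewrite mul1r ger0_norm; lra.
Qed.

(** What the staircase leaves is at most h (1 + eta^2) and, where xi > 1 + J h, also |eta| xi. For
    xi >= q^2 one has 2 q |eta| xi <= xi eta^2 + xi^2, whose mean is bounded in expectation, so a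
    large q makes this term negligible. *)
Lemma top_eta_xi_cvg : TM (fun n z => eta n z * (xi n z - 1)) p @[p --> whp P] --> (0 : R).
Proof.
apply/cvgrPdist_le => eps eps0.
have [C1 xyC] := xy2_bounded A2 A4 normalized.
have [C2 xC] := x2_bounded right_endpoint A1 A2 A4 normalized.
pose F (p : RR) := (0 < p.1)%R%:R * (`|p.1| * p.2 ^+ 2) + (0 < p.1)%R%:R * p.1 ^+ 2.
have mF1 : measurable_fun setT (fun p : RR => (0 < p.1)%R%:R * (`|p.1| * p.2 ^+ 2)) by meas.
have mF2 : measurable_fun setT (fun p : RR => (0 < p.1)%R%:R * p.1 ^+ 2) by meas.
have mF : measurable_fun setT F by rewrite /F; meas.
have F0 p : 0 <= F p by rewrite addr_ge0// ?(sqr_ge0, mulr_ge0).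
have FC : \forall n \near \oo, (\int[mu_ X Y a b m psi n]_p (F p)%:E <= (C1 + C2)%:E)%E.
  apply: filterS2 xyC xC => n h1 h2.
  rewrite (ge0_integralD_fin _ mF1 mF2) => [|p|p]; first by rewrite EFinD leeD.
    by rewrite ?(sqr_ge0, mulr_ge0).
  by rewrite ?(sqr_ge0, mulr_ge0).
have SC := mean_le8 mF F0 FC.
(* The mean of 1 + eta^2 will be at most 3, so eps / 9 yields an error of at most eps / 3. *)
pose h := Num.min (eps / 9) 2^-1.
have h0 : 0 < h by rewrite lt_min divr_gt0//= invr_gt0.
have h1 : h < 1 by rewrite gt_min invf_lt1 ?ltr1n ?orbT.
have h9 : h <= eps / 9 by rewrite ge_min lexx.
apply: whp_approx => del del0.
(* [C'] bounds the expectation of the mean of F, and q is such that C' <= 2 q (eps / 3) del, as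
   Markov's inequality requires. *)
pose C' := `|8 * (C1 + C2)|; pose q := 2 * C' / (eps * del) + 1.
have ed : 0 < eps * del by exact: mulr_gt0.
have C'0 : 0 <= C' by exact: normr_ge0.
have q0 : 0 < q.
  by apply: ltr_wpDl => //; apply: divr_ge0; [exact: mulr_ge0|exact: ltW].
pose J := (Num.truncn (q ^+ 2 / h)).+1.
have qJ : q ^+ 2 <= J%:R * h.
  by rewrite -ler_pdivrMr//; apply/ltW/truncnS_gt.
have cJ : h * \sum_(0 <= j < J) TM (fun n z => (1 + j.+1%:R * h < xi n z)%R%:R * eta n z) p
    @[p --> whp P] --> h * 0.
  have c s : \sum_(j <- s) TM (fun n z => (1 + j.+1%:R * h < xi n z)%R%:R * eta n z) p
      @[p --> whp P] --> (0 : R).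
    elim: s => [|j s IH].
      by apply: cvg_near_cst; apply: nearW => p; rewrite big_nil.
    have s1 : 1 < 1 + j.+1%:R * h by rewrite ltrDl mulr_gt0.
    have : TM (fun n z => (1 + j.+1%:R * h < xi n z)%R%:R * eta n z) p +
        \sum_(j <- s) TM (fun n z => (1 + j.+1%:R * h < xi n z)%R%:R * eta n z) p
        @[p --> whp P] --> (0 + 0 : R).
      by apply: cvgD; [exact: top_tail_eta_cvg|exact: IH].
    rewrite addr0; apply: cvg_trans; apply: near_eq_cvg; apply: nearW => p.
    by rewrite big_cons.
  by apply: cvgMr; exact: c.
rewrite mulr0 in cJ; have eps3 : 0 < eps / 3 by rewrite divr_gt0.
move/cvgrPdist_le : cJ => /(_ _ eps3) cJ.
have c2 : \forall p \near whp P, TM (fun n z => eta n z ^+ 2) p <= 2.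
  by apply: (cvgr_le _ top_eta_sqr_cvg); rewrite ltr1n.
exists [set p | [/\ bracketed h p.1 p.2, TM (fun n z => eta n z ^+ 2) p <= 2 &
  `|h * \sum_(0 <= j < J) TM (fun n z => (1 + j.+1%:R * h < xi n z)%R%:R * eta n z) p|
   <= eps / 3]].
  refine (whp_imply3 (near_bracketed h0 h1) c2 cJ _) => n w /= ? ?.
  by rewrite sub0r normrN.
have K0 : 0 < 2 * q * (eps / 3) by rewrite !mulr_gt0.
apply: filterS SC => n Sn.
have Sn' : (\int[P]_w (rescaled_mean F n w)%:E <= (2 * q * (eps / 3) * del)%:E)%E.
  apply: le_trans Sn _; rewrite lee_fin; apply: le_trans (ler_norm _) _; rewrite -/C'.
  have qE : q * (eps * del) = 2 * C' + eps * del.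
    by rewrite /q mulrDl mul1r divfK// gt_eqF// mulr_gt0.
  rewrite (_ : 2 * q * (eps / 3) * del = 2 / 3 * (q * (eps * del))); last by field.
  by rewrite qE; lra.
have R0 w : 0 <= rescaled_mean F n w.
  exact: (@sample_mean_ge0 _ _ _ P Xs Ys k (fun n z => F (xi n z, eta n z)) n w
    (fun z => F0 (xi n z, eta n z))).
have [mE PE] := markov_fin (measurable_rescaled_mean n mF) R0 K0 Sn'.
exists [set w | 2 * q * (eps / 3) <= rescaled_mean F n w]; split => // w /= /negP.
rewrite -ltNge => Sw [br e2 hS]; rewrite sub0r normrN.
have top0 : {in top n w, forall z, 1 - h < xi n z} := top_xi_gt br.
rewrite (eq_top_mean (h2 := fun z => eta n z * (xi n z - 1 -
    h * \sum_(0 <= j < J) (1 + j.+1%:R * h < xi n z)%R%:R) +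
    h * \sum_(0 <= j < J) (1 + j.+1%:R * h < xi n z)%R%:R * eta n z)); last first.
  move=> z _; rewrite -mulr_suml; ring.
rewrite top_meanD top_meanZ top_mean_sum.
apply: (le_trans (ler_normD _ _)); rewrite (_ : eps = eps / 3 * 2 + eps / 3); last by field.
apply: lerD; last exact: hS.
apply: (le_trans (top_mean_norm _ _ _)).
apply: (@le_trans _ _ (top_mean n w (fun z => h * (1 + eta n z ^+ 2) +
    (2 * q)^-1 * F (xi n z, eta n z)))).
  apply: top_mean_le => z /top0 xz; rewrite normrM.
  have x0 : 0 < xi n z by apply: lt_trans xz; rewrite subr_gt0.
  have := mesh_error J h0 (ltW xz); set r := `|_ - _|.
  move=> rh; apply: (@le_trans _ _ (`|eta n z| *
    (h + (1 + J%:R * h < xi n z)%R%:R * xi n z))).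
    exact: ler_wpM2l.
  rewrite mulrDr /F /= x0 !mul1r (gtr0_norm x0).
  set y := eta n z; rewrite -[y ^+ 2]real_normK ?num_real//; set t := `|y|.
  have t0 : 0 <= t by exact: normr_ge0.
  apply: lerD.
    rewrite mulrC ler_pM2l//; have := sqr_ge0 (t - 1); have := sqr_ge0 t; nra.
  case: ltP => xJ; last first.
    rewrite mul0r mulr0; apply: mulr_ge0; first by rewrite invr_ge0 mulr_ge0// ltW.
    by apply: addr_ge0; [apply: mulr_ge0; [exact: ltW|exact: sqr_ge0]|exact: sqr_ge0].
  rewrite mul1r ler_pdivlMl ?mulr_gt0//.
  (* xi (|eta| - q)^2 >= 0 gives 2 q |eta| xi <= xi eta^2 + xi q^2, and q^2 <= J h < xi. *)
  have s := mulr_ge0 (ltW x0) (sqr_ge0 (t - q)).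
  have : xi n z * q ^+ 2 <= xi n z * xi n z by rewrite ler_pM2l//; lra.
  by move: s; rewrite -/(xi n z); nra.
rewrite top_meanD !top_meanZ top_meanD (top_mean_cst br).
have up : top_mean n w (fun z => F (xi n z, eta n z)) <= rescaled_mean F n w.
  apply: (le_trans (top_mean_upper br F0)).
  rewrite /rescaled_mean /sample_mean ler_wpM2l// ler_sum// => i _.
  by case: (_ < _); rewrite ?mul1r ?mul0r.
have l1 : (2 * q)^-1 * top_mean n w (fun z => F (xi n z, eta n z)) <= eps / 3.
  by rewrite ler_pdivrMl ?mulr_gt0//; apply: (le_trans up); exact: ltW.
move: e2 => /= e2; apply: (@le_trans _ _ (h * (1 + 2) + eps / 3)); last by lra.
by apply: lerD => //; rewrite ler_pM2l// lerD2l.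
Qed.

Lemma top_eta_spacing_cvg :
  top_mean p.1 p.2 (fun z => eta p.1 z * (xi p.1 z - threshold p.1 p.2))
    @[p --> whp P] --> (0 : R).
Proof.
have : TM (fun n z => eta n z * (xi n z - 1)) p +
    (1 - threshold p.1 p.2) * TM (fun n z => eta n z) p @[p --> whp P] --> (0 + (1 - 1) * 0 : R).
  apply: cvgD; first exact: top_eta_xi_cvg.
  by apply: cvgM; [apply: cvgB; [exact: cvg_cst|exact: threshold_cvg]|exact: top_eta_cvg].
rewrite mulr0 addr0; apply: cvg_trans; apply: near_eq_cvg; apply: nearW => p.
by rewrite -top_meanZ -top_meanD; apply: eq_top_mean => z _; ring.
Qed.

(** The threshold is at most 3 / 2, so each point with xi > 2 contributes at least 1 / 2, and the
    proportion of such points tends to exp (- 1). *)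
Lemma near_top_spacing : \forall p \near whp P,
  expR (- 1) / 4 <= top_mean p.1 p.2 (fun z => xi p.1 z - threshold p.1 p.2).
Proof.
have h0 : 0 < 2^-1 :> R by rewrite invr_gt0.
have h1 : 2^-1 < 1 :> R by rewrite invf_lt1 ?ltr1n.
have s1 : 1 < 2 :> R by rewrite ltr1n.
have e0 := expR_gt0 (- 1 : R).
have c2 : TM (fun n z => (2 < xi n z)%R%:R * 1) p @[p --> whp P] --> expR (1 - 2) * 1.
  by apply: (top_tail_cvg s1 _ _ one_le int_one) => // y; exact: cvg_cst.
rewrite (_ : 1 - 2 = - 1 :> R) ?mulr1 in c2; last by lra.
have {}c2 : \forall p \near whp P, expR (- 1) / 2 <= TM (fun n z => (2 < xi n z)%R%:R * 1) p.
  by apply: (cvgr_ge _ c2); lra.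
refine (whp_imply2 (near_bracketed h0 h1) c2 _) => n w /= br {}c2.
have /andP[_ xu] := threshold_bounds br.
apply: (@le_trans _ _ (2^-1 * top_mean n w (fun z => (2 < xi n z)%R%:R * 1))); first by lra.
rewrite -top_meanZ; apply: top_mean_le => z zt.
have := top_xi_ge_threshold br zt; case: ltP => x2 ?; rewrite ?mul0r ?mulr0 ?mulr1; lra.
Qed.

(** The continuity in Assumption 1 is used along the line x = 0, where the mass of the quadrant is
    Psi. It is needed because [Psi_check] averages indicators, which can only be sandwiched between
    continuous functions. *)
Lemma Psi_continuous : continuous Psi.
Proof.
move=> z.
have E y : nu (quadrant 0%E y%:E) = (Psi y)%:E.
  transitivity ((expR (- 0) * Psi y)%:E); last by rewrite oppr0 expR0 mul1r.
  rewrite -(real_part_quadrant A4) /real_part/= /pushforward /mrestr; congr (nu _).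
  apply/seteqP; split => -[u v] /=.
    by move=> [/andP[u0 uf] /andP[vf vy]]; move: u v u0 uf vf vy => [u||] [v||].
  move=> [[u0 vy] [/= uf vf]]; move: u v uf vf u0 vy => [u||] [v||]//= _ _ u0 vy.
  by rewrite /quadrant/= !lee_fin u0 vy ltry ltNyr.
have hp y : half_plane gamma (0%E, y%:E : \bar R).
  by rewrite /half_plane/= (a4_gamma A4) inve0 ltNyr.
have H : nu (quadrant p.1 p.2) @[p --> within (half_plane gamma)
    (nbhs (0%E : \bar R, z%:E : \bar R))] --> (Psi z)%:E.
  by rewrite -E; exact: ((subspace_continuousP _ _).1 (a1_continuous A1) _ (hp z)).
have G : (0%E, y%:E : \bar R) @[y --> z] -->
    within (half_plane gamma) (nbhs (0%E : \bar R, z%:E : \bar R)).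
  move=> B nB.
  have c : (0%E : \bar R, y%:E : \bar R) @[y --> z] --> (0%E : \bar R, z%:E : \bar R).
    have c2 : y%:E @[y --> z] --> (z%:E : \bar R).
      by apply/fine_cvgP; split; [exact: nearW|exact: cvg_id].
    exact: (@cvg_pair _ _ _ (nbhs z) (nbhs (0%E : \bar R)) (nbhs (z%:E : \bar R)) _ _ _
      (fun=> 0%E) _ (cvg_cst _) c2).
  have nz : \forall y \near z, half_plane gamma (0%E, y%:E) -> B (0%E, y%:E) := c _ nB.
  change (\forall y \near z, B (0%E : \bar R, y%:E : \bar R)).
  by apply: filterS nz => y; apply; exact: hp.
have := cvg_comp _ _ G H.
rewrite (_ : _ \o _ = EFin \o Psi); first by move/fine_cvg.
by apply/funext => y /=; rewrite E.
Qed.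

Lemma integral_Psi_le c : (\int[lsf]_y ((y <= c)%R%:R)%:E = (Psi c)%:E)%E.
Proof.
have mg : measurable_fun setT (fun y : R => (y <= c)%R%:R : R) by meas.
have := ge0_integral_tail (real_part_quadrant A4) 0 mg (fun y => ler0n _ _).
rewrite oppr0 expR0 mul1e => <-.
transitivity (real_part nu [set p | 0 <= p.1 /\ p.2 <= c]); last first.
  by rewrite (real_part_quadrant A4) oppr0 expR0 mul1r.
have mA : measurable ([set p | 0 <= p.1 /\ p.2 <= c] : set RR).
  rewrite (_ : mkset _ = right_of 0 `&` [set p | p.2 <= c])//.
  apply: measurableI; first exact: measurable_right_of.
  rewrite -[X in measurable X]setTI -[mkset _]/((fun p : RR => p.2 <= c) @^-1` [set true]).
  by apply: measurable_fun_ler; [meas|meas|exact: measurableT|].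
rewrite -(setIT ([set p | 0 <= p.1 /\ p.2 <= c] : set RR)).
rewrite -(integral_indic _ measurableT mA); apply: eq_integral => p _.
rewrite indicE -natrM mulnb; congr (_%:R%:E); congr nat_of_bool.
by apply/idP/idP => [/andP[? ?]|/set_mem [-> ->]//]; exact: mem_set.
Qed.

(** * The slope estimator and the residuals *)

Definition slope n w := bN n * (rho_hat Xs Ys n (k n) w - rho) / aN n.
Local Notation kap n := (rho * psiN n / aN n).
Local Notation lam n := (psiN n / bN n).
Local Notation W n w := (top_mean n w (fun z => xi n z - threshold n w)).
Local Notation V n w := (top_mean n w (fun z => xi n z * (xi n z - threshold n w))).
Local Notation U n w := (top_mean n w (fun z => eta n z * (xi n z - threshold n w))).
Local Notation Q n w := (top_mean n w (fun z => xi n z ^+ 2)).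

Lemma kap_cvg : kap n @[n --> \oo] --> (0 : R).
Proof.
exact: (cvg_comp _ _ level_cvgy (rho_psi_cvg right_endpoint A1 A2 A4 normalized mu0)).
Qed.

Lemma lam_cvg : lam n @[n --> \oo] --> (0 : R).
Proof. exact: (cvg_comp _ _ level_cvgy (psi_b_cvg right_endpoint A1 A4)). Qed.

(** Equals (rho_hat x - rho b N) / a (b N), the fitted value recentered and rescaled like Y, once x
    is written as b N + psi (b N) xi. *)
Definition drift n w z : R := slope n w + (kap n + slope n w * lam n) * xi n z.

Section estimators_top.
Context (e : R) (n : nat) (w : T) (br : bracketed e n w).

Let kR0 : (k n)%:R != 0 :> R.
Proof. by case: br => /andP[kn _] *; rewrite pnatr_eq0 -lt0n. Qed.
Let b0 : bN n != 0. Proof. by case: br => _ bp *; rewrite gt_eqF. Qed.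
Let a0 : aN n != 0. Proof. by case: br => _ _ ap *; rewrite gt_eqF. Qed.
Let psi0 : psiN n != 0. Proof. by case: br => _ _ _ pp _; rewrite gt_eqF. Qed.

Lemma sum_top (f : R -> R -> R) :
  \sum_(1 <= i < (k n).+1) f (order_stat Xs Ys n (n - i + 1) w)
    (concomitant Xs Ys n (n - i + 1) w) =
  (k n)%:R * top_mean n w (fun z => f z.1 z.2).
Proof.
rewrite /top_mean mulrA divff// mul1r.
have kS : (k n <= size (S n w))%N.
  by case: br => /andP[_ kn] *; rewrite size_ordered_sample ltnW.
rewrite -(big_top (0, 0) (fun z => f z.1 z.2) kS).
by rewrite size_ordered_sample.
Qed.

Let xE z : z.1 = bN n + psiN n * xi n z.
Proof. by rewrite /xi; field. Qed.

Let yE z : z.2 = rho * bN n + aN n * eta n z.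
Proof. by rewrite /eta (a4_m A4); field. Qed.

Let tE : order_stat Xs Ys n (n - k n) w = bN n + psiN n * threshold n w.
Proof. by rewrite /threshold; field. Qed.

Lemma residualE z : z.2 - rho_hat Xs Ys n (k n) w * z.1 = aN n * (eta n z - drift n w z).
Proof.
rewrite {1}yE {1}xE /drift /slope; set r := rho_hat _ _ _ _ _.
by field; rewrite a0 b0.
Qed.

(** Substituting the rescaled variables turns rho_hat - rho into (a U - rho psi V) / (b W + psi V).
    Only V involves a second moment of xi, and after normalization its coefficients [kap] and [lam]
    tend to 0. *)
Lemma slopeE : 0 < W n w -> 0 <= V n w ->
  slope n w = (U n w - kap n * V n w) / (W n w + lam n * V n w).
Proof.
move=> W0 V0; set t := order_stat Xs Ys n (n - k n) w.
have num : \sum_(1 <= i < (k n).+1) concomitant Xs Ys n (n - i + 1) w *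
     (order_stat Xs Ys n (n - i + 1) w - t) =
    (k n)%:R * (psiN n * rho * bN n * W n w + psiN n * aN n * U n w).
  rewrite (sum_top (fun x y => y * (x - t))); congr (_ * _).
  rewrite -!top_meanZ -top_meanD; apply: eq_top_mean => z _.
  by rewrite /t tE {1}xE {1}yE; ring.
have den : \sum_(1 <= i < (k n).+1) order_stat Xs Ys n (n - i + 1) w *
     (order_stat Xs Ys n (n - i + 1) w - t) =
    (k n)%:R * (psiN n * bN n * W n w + psiN n * psiN n * V n w).
  rewrite (sum_top (fun x y => x * (x - t))); congr (_ * _).
  rewrite -!top_meanZ -top_meanD; apply: eq_top_mean => z _.
  by rewrite /t tE !xE; ring.
rewrite /slope /rho_hat -/t num den.
have bW : bN n * W n w + psiN n * V n w != 0.
  case: br => _ bp _ pp _; rewrite gt_eqF//; apply: ltr_pwDl; first exact: mulr_gt0.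
  by apply: mulr_ge0 => //; exact: ltW.
move: kR0 b0 a0 psi0 bW; move: (W n w) (V n w) (U n w) => W' V' U'.
move: (bN n) (aN n) (psiN n) ((k n)%:R : R) => B A p K K0 B0 A0 p0 D0.
have -> : K * (p * rho * B * W' + p * A * U') / (K * (p * B * W' + p * p * V')) - rho =
    (A * U' - rho * p * V') / (B * W' + p * V').
  have -> : K * (p * rho * B * W' + p * A * U') = K * p * (rho * B * W' + A * U') by ring.
  have -> : K * (p * B * W' + p * p * V') = K * p * (B * W' + p * V') by ring.
  rewrite -mulf_div divff ?mulf_neq0// mul1r.
  by apply: (mulIf D0); rewrite mulrBl !divfK//; ring.
have -> : W' + p / B * V' = (B * W' + p * V') / B by field.
move: D0; move: (B * W' + p * V') => D D0.
by field; rewrite ?B0 ?A0 ?D0.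
Qed.

Lemma a_checkE : a_check Xs Ys n (k n) w / aN n =
  Num.sqrt (top_mean n w (fun z => (eta n z - drift n w z) ^+ 2)).
Proof.
have ap : 0 < aN n by case: br.
rewrite /a_check (sum_top (fun x y => (y - rho_hat Xs Ys n (k n) w * x) ^+ 2)).
rewrite mulrA mulVf// mul1r.
rewrite (eq_top_mean (h2 := fun z => aN n ^+ 2 * (eta n z - drift n w z) ^+ 2)).
  rewrite top_meanZ sqrtrM ?sqr_ge0// sqrtr_sqr gtr0_norm//.
  by rewrite mulrAC divff// mul1r.
by move=> z _; rewrite residualE exprMn.
Qed.

Lemma Psi_checkE y : Psi_check Xs Ys n (k n) y w = top_mean n w (fun z =>
  (eta n z <= a_check Xs Ys n (k n) w / aN n * y + drift n w z)%R%:R).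
Proof.
have ap : 0 < aN n by case: br.
rewrite /Psi_check (sum_top (fun x' y' => (y' <= rho_hat Xs Ys n (k n) w * x' +
  a_check Xs Ys n (k n) w * y)%R%:R)).
rewrite mulrA mulVf// mul1r; apply: eq_top_mean => z _; congr (_%:R); congr nat_of_bool.
rewrite -lerBlDl residualE -[RHS]lerBlDr -[in RHS](ler_pM2l ap); congr (_ <= _).
by rewrite mulrA mulrCA divff// mulr1.
Qed.

Lemma top_mean_spacing_le : e < 1 -> 0 <= V n w <= Q n w.
Proof.
move=> e1; have /andP[x0 _] := threshold_bounds br.
apply/andP; split; [apply: top_mean_ge0|apply: top_mean_le] => z zt.
  have := top_xi_gt br zt; have := top_xi_ge_threshold br zt => ? ?.
  by rewrite mulr_ge0//; lra.
have := top_xi_gt br zt => ?.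
by rewrite expr2 ler_wpM2l//; lra.
Qed.

End estimators_top.

Let half0 : 0 < 2^-1 :> R. Proof. by rewrite invr_gt0. Qed.
Let half1 : 2^-1 < 1 :> R. Proof. by rewrite invf_lt1 ?ltr1n. Qed.

Lemma slope_cvg : slope p.1 p.2 @[p --> whp P] --> (0 : R).
Proof.
pose c : R := expR (- 1) / 4.
have c0 : 0 < c by rewrite divr_gt0// expR_gt0.
apply/cvgrPdist_le => eps eps0.
have h0 : 0 < eps * c / 2 by rewrite divr_gt0// mulr_gt0.
have cU : \forall p \near whp P, `|0 - U p.1 p.2| <= eps * c / 2.
  by move/cvgrPdist_le : top_eta_spacing_cvg; exact.
have cQ : \forall p \near whp P, `|0 - kap p.1 * Q p.1 p.2| <= eps * c / 2.
  by move/cvgrPdist_le : (top_xi_sqr_cvg kap_cvg); exact.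
have brW := filterI (near_bracketed half0 half1) near_top_spacing.
have brW' : \forall p \near whp P, bracketed 2^-1 p.1 p.2 /\ c <= W p.1 p.2 by exact: brW.
refine (whp_imply3 brW' cU cQ _) => n w /= [br Wc] {}cU {}cQ.
have W0 : 0 < W n w by exact: lt_le_trans Wc.
have /andP[V0 VQ] := top_mean_spacing_le br half1.
have l0 : 0 <= lam n * V n w.
  by case: br => _ bp _ pp _; apply: mulr_ge0 => //; apply: divr_ge0; exact: ltW.
have D0 : 0 < W n w + lam n * V n w by rewrite ltr_pwDl.
rewrite (slopeE br W0 V0) sub0r normrN normrM normfV (gtr0_norm D0) ler_pdivrMr//.
apply: (@le_trans _ _ (eps * c)); last by rewrite ler_pM2l// (le_trans Wc)// lerDl.
apply: (le_trans (ler_normB _ _)); rewrite [leRHS]splitr; apply: lerD.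
  by move: cU; rewrite sub0r normrN.
apply: le_trans cQ; rewrite sub0r normrN [X in X <= _]normrM [X in _ <= X]normrM.
by rewrite ler_wpM2l// (ger0_norm V0) (ger0_norm (le_trans V0 VQ)).
Unshelve. all: by end_near. Qed.

Let gain n w : R := kap n + slope n w * lam n.

Let gain_cvg : gain p.1 p.2 @[p --> whp P] --> (0 : R).
Proof.
rewrite -[X in _ --> X](_ : 0 + 0 * 0 = 0 :> R); last by rewrite mulr0 addr0.
apply: cvgD; first exact: (whp_cvg_fst P kap_cvg).
by apply: cvgM; [exact: slope_cvg|exact: (whp_cvg_fst P lam_cvg)].
Qed.

Lemma drift_sqr_cvg :
  top_mean p.1 p.2 (fun z => drift p.1 p.2 z ^+ 2) @[p --> whp P] --> (0 : R).
Proof.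
have sq0 (u : nat -> R) : u n @[n --> \oo] --> (0 : R) -> u n ^+ 2 @[n --> \oo] --> (0 : R).
  move=> u0; have H : u n * u n @[n --> \oo] --> (0 * 0 : R) by exact: cvgM.
  by rewrite mulr0 in H.
have kQ := top_xi_sqr_cvg (sq0 _ kap_cvg).
have lQ := top_xi_sqr_cvg (sq0 _ lam_cvg).
have sl := slope_cvg.
have ub : 2 * (slope p.1 p.2 * slope p.1 p.2) + (4 * (kap p.1 ^+ 2 * Q p.1 p.2) +
    4 * (slope p.1 p.2 * slope p.1 p.2 * (lam p.1 ^+ 2 * Q p.1 p.2))) @[p --> whp P] -->
    (2 * (0 * 0) + (4 * 0 + 4 * (0 * 0 * 0)) : R).
  apply: cvgD; first by apply: cvgMr; exact: cvgM.
  apply: cvgD; first exact: cvgMr.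
  by apply: cvgMr; apply: cvgM; [exact: cvgM|].
rewrite !mulr0 !addr0 in ub.
apply: (@squeeze_cvgr _ _ _ _ (fun=> 0) _ _ _ _ (cvg_cst _) ub).
refine (whp_imply (near_bracketed half0 half1) _) => n w /= br.
apply/andP; split; first by apply: top_mean_ge0 => z _; exact: sqr_ge0.
set s := slope n w; apply: (@le_trans _ _ (top_mean n w (fun z =>
    2 * (s * s) + (4 * kap n ^+ 2 + 4 * (s * s * lam n ^+ 2)) * xi n z ^+ 2))).
  apply: top_mean_le => z _; rewrite /drift -/s.
  move: (xi n z) (kap n) (lam n) => x kk l.
  have h1 := sqr_ge0 (s - (kk + s * l) * x).
  have h2 := sqr_ge0 ((kk - s * l) * x).
  rewrite -subr_ge0 (_ : _ - _ = (s - (kk + s * l) * x) ^+ 2 + 2 * ((kk - s * l) * x) ^+ 2).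
    by rewrite addr_ge0// mulr_ge0.
  by ring.
rewrite top_meanD (top_mean_cst br) top_meanZ.
by rewrite le_eqVlt; apply/orP; left; apply/eqP; ring.
Qed.

(** The cross term of the expanded square is a combination of the top means of eta and of eta (xi -
    1), with coefficients that tend to 0. *)
Lemma residual_sqr_cvg :
  top_mean p.1 p.2 (fun z => (eta p.1 z - drift p.1 p.2 z) ^+ 2) @[p --> whp P] --> (1 : R).
Proof.
have : TM (fun n z => eta n z ^+ 2) p + (- 2 * (slope p.1 p.2 * TM (fun n z => eta n z) p +
    gain p.1 p.2 * (TM (fun n z => eta n z * (xi n z - 1)) p + TM (fun n z => eta n z) p)) +
    top_mean p.1 p.2 (fun z => drift p.1 p.2 z ^+ 2)) @[p --> whp P] -->
    (1 + (- 2 * (0 * 0 + 0 * (0 + 0)) + 0) : R).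
  apply: cvgD; first exact: top_eta_sqr_cvg.
  apply: cvgD; last exact: drift_sqr_cvg.
  apply: cvgMr; apply: cvgD; first exact: (cvgM slope_cvg top_eta_cvg).
  apply: cvgM; first exact: gain_cvg.
  by apply: cvgD; [exact: top_eta_xi_cvg|exact: top_eta_cvg].
rewrite !(mulr0, addr0); apply: cvg_trans; apply: near_eq_cvg; apply: nearW => p.
rewrite -!top_meanD -!top_meanZ -top_meanD -!top_meanZ -!top_meanD.
by apply: eq_top_mean => z _; rewrite /drift /gain; ring.
Qed.

Lemma a_check_cvg : a_check Xs Ys p.1 (k p.1) p.2 / aN p.1 @[p --> whp P] --> (1 : R).
Proof.
have : Num.sqrt (top_mean p.1 p.2 (fun z => (eta p.1 z - drift p.1 p.2 z) ^+ 2))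
    @[p --> whp P] --> Num.sqrt (1 : R).
  exact: (cvg_comp _ _ residual_sqr_cvg (@sqrt_continuous R 1)).
rewrite sqrtr1; apply: cvg_trans; apply: near_eq_cvg.
by refine (whp_imply (near_bracketed half0 half1) _) => n w /= /a_checkE.
Qed.

(** Where |drift| <= h, the bound al y + drift is within 2 h of y, and ramps placed between 2 h and
    3 h from y sandwich the indicator. The points with |drift| > h cost at most the top mean of h^-2
    drift^2, which vanishes. Continuity of Psi closes the remaining gap. *)
Lemma Psi_check_cvg y : Psi_check Xs Ys p.1 (k p.1) y p.2 @[p --> whp P] --> Psi y.
Proof.
apply/cvgrPdist_le => eps eps0; have eps3 : 0 < eps / 3 by rewrite divr_gt0.
have [h h0 Ph] : exists2 h, 0 < h &
    `|Psi y - Psi (y + 3 * h)| <= eps / 3 /\ `|Psi y - Psi (y - 3 * h)| <= eps / 3.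
  move/cvgrPdist_le : (@Psi_continuous y) => /(_ _ eps3) /nbhs_ballP[r /= r0 rP].
  exists (r / 4); first by rewrite divr_gt0.
  have r3 : 0 < 3 * (r / 4) by lra.
  split; apply: rP; rewrite /ball/=.
    rewrite (_ : y - (y + 3 * (r / 4)) = - (3 * (r / 4))); last by ring.
    by rewrite normrN gtr0_norm//; lra.
  rewrite (_ : y - (y - 3 * (r / 4)) = 3 * (r / 4)); last by ring.
  by rewrite gtr0_norm//; lra.
have r1 (u v x : R) : 0 <= 1 - ramp u v x <= 1.
  by rewrite subr_ge0 ramp_le1 gerBl ramp_ge0.
have step (u v : R) (uv : u < v) : exists G : R,
    [/\ Psi u <= G, G <= Psi v &
     TM (fun n z => 1 - ramp u v (eta n z)) p @[p --> whp P] --> G].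
  have cg : continuous (fun x => 1 - ramp u v x).
    by move=> x; apply: cvgB; [exact: cvg_cst|exact: ramp_continuous].
  have mg : measurable_fun setT (fun x => 1 - ramp u v x) by meas.
  have g0 x : 0 <= 1 - ramp u v x by case/andP: (r1 u v x).
  have gC x : 1 - ramp u v x <= 1 * (1 + x ^+ 2).
    by case/andP: (r1 u v x) => _ /le_trans; apply; rewrite mul1r lerDl sqr_ge0.
  have mi (c : R) : measurable_fun setT (fun x : R => (x <= c)%R%:R : R) by meas.
  have [G _ GE] := integral_Psi_fin normalized mg g0 gC.
  exists G; split; last exact: (top_cvg cg g0 gC GE).
    rewrite -lee_fin -GE -integral_Psi_le.
    apply: ge0_le_integral_fin; [exact: mi|exact: mg| |] => x; first exact: ler0n.
    by case: (leP x u) => xu; [rewrite ramp0// subr0|exact: g0].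
  rewrite -lee_fin -GE -integral_Psi_le; apply: ge0_le_integral_fin;
    [exact: mg|exact: mi|exact: g0|] => x.
  by case: (leP x v) => [_|/ltW vx]; [case/andP: (r1 u v x)|rewrite ramp1// subrr].
have [Gu [_ Gu1 cu]] : exists G : R, [/\ Psi (y + 2 * h) <= G, G <= Psi (y + 3 * h) &
    TM (fun n z => 1 - ramp (y + 2 * h) (y + 3 * h) (eta n z)) p @[p --> whp P] --> G].
  by apply: step; lra.
have [Gl [Gl1 _ cl]] : exists G : R, [/\ Psi (y - 3 * h) <= G, G <= Psi (y - 2 * h) &
    TM (fun n z => 1 - ramp (y - 3 * h) (y - 2 * h) (eta n z)) p @[p --> whp P] --> G].
  by apply: step; lra.
have nu' : \forall p \near whp P, TM (fun n z => 1 - ramp (y + 2 * h) (y + 3 * h) (eta n z)) p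
    + h ^- 2 * top_mean p.1 p.2 (fun z => drift p.1 p.2 z ^+ 2) <= Gu + 2 * (eps / 3).
  apply: (cvgr_le _ (_ : _ --> Gu + h ^- 2 * 0)); last by rewrite mulr0; lra.
  by apply: cvgD => //; apply: cvgMr; exact: drift_sqr_cvg.
have nl : \forall p \near whp P, Gl - 2 * (eps / 3) <=
    TM (fun n z => 1 - ramp (y - 3 * h) (y - 2 * h) (eta n z)) p
    - h ^- 2 * top_mean p.1 p.2 (fun z => drift p.1 p.2 z ^+ 2).
  apply: (cvgr_ge _ (_ : _ --> Gl - h ^- 2 * 0)); last by rewrite mulr0; lra.
  by apply: cvgB => //; apply: cvgMr; exact: drift_sqr_cvg.
have h' : 0 < h / (`|y| + 1) by rewrite divr_gt0// ltr_wpDl.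
have na : \forall p \near whp P, `|1 - a_check Xs Ys p.1 (k p.1) p.2 / aN p.1| <= h / (`|y| + 1).
  by move/cvgrPdist_le : a_check_cvg; exact.
have nba : \forall p \near whp P, bracketed 2^-1 p.1 p.2 /\
    `|1 - a_check Xs Ys p.1 (k p.1) p.2 / aN p.1| <= h / (`|y| + 1).
  exact: (filterI (F := whp P) (near_bracketed half0 half1) na).
refine (whp_imply3 nba nu' nl _) => n w /= [br {}na] {}nu' {}nl.
rewrite (Psi_checkE br); set al := _ / aN n in na *.
have ay : `|al * y - y| <= h.
  have y1 : 0 < `|y| + 1 by rewrite ltr_wpDl.
  rewrite (_ : al * y - y = - ((1 - al) * y)); last by ring.
  rewrite normrN normrM; move: na; rewrite ler_pdivlMr//; apply: le_trans.
  by rewrite ler_wpM2l// lerDl.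
have h2 : 0 < h ^+ 2 by rewrite exprn_gt0.
have big (x : R) : h < `|x| -> 1 <= h ^- 2 * x ^+ 2.
  move=> hx; rewrite ler_pdivlMl// mulr1 -[leRHS]real_normK ?num_real//.
  by rewrite lerXn2r ?nnegrE ?ltW//; lra.
have big0 (x : R) : 0 <= h ^- 2 * x ^+ 2 by rewrite mulr_ge0 ?invr_ge0 ?sqr_ge0// ltW.
move: ay; rewrite ler_norml => /andP[ay1 ay2].
have up : top_mean n w (fun z => (eta n z <= al * y + drift n w z)%R%:R) <=
    top_mean n w (fun z => 1 - ramp (y + 2 * h) (y + 3 * h) (eta n z))
    + h ^- 2 * top_mean n w (fun z => drift n w z ^+ 2).
  rewrite -top_meanZ -top_meanD; apply: top_mean_le => z _.
  have /andP[g0 g1] := r1 (y + 2 * h) (y + 3 * h) (eta n z).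
  have [/big d1|] := ltP h `|drift n w z|.
    by apply: (@le_trans _ _ 1); [rewrite lern1 leq_b1|apply: ler_wpDl].
  rewrite ler_norml => /andP[d1 d2]; case: (leP (eta n z) (al * y + drift n w z)) => ez; last exact: addr_ge0.
  rewrite ramp0; [|lra|lra].
  by rewrite subr0 lerDl.
have lo : top_mean n w (fun z => 1 - ramp (y - 3 * h) (y - 2 * h) (eta n z))
    - h ^- 2 * top_mean n w (fun z => drift n w z ^+ 2) <=
    top_mean n w (fun z => (eta n z <= al * y + drift n w z)%R%:R).
  rewrite lerBlDr -top_meanZ -top_meanD; apply: top_mean_le => z _.
  have /andP[g0 g1] := r1 (y - 3 * h) (y - 2 * h) (eta n z).
  have [/big d1|] := ltP h `|drift n w z|.
    by apply: (le_trans g1); apply: ler_wpDl.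
  rewrite ler_norml => /andP[d1 d2]; case: (leP (eta n z) (al * y + drift n w z)) => ez.
    by apply: (le_trans g1); rewrite lerDl.
  rewrite ramp1; [|lra|lra].
  by rewrite subrr add0r.
move: Ph nu' nl up lo; rewrite !ler_norml => -[/andP[? ?] /andP[? ?]] ? ? ? ?.
by apply/andP; split; lra.
Qed.

(** Slow variation exchanges the normalization at level N for the one at n / k. *)
Let ratio_a : (a (b (tau n)) / aN n)^-1 @[n --> \oo] --> (1 : R).
Proof.
rewrite -[X in _ --> X]invr1; apply: cvgV; first exact: oner_neq0.
apply: (a_level_cvg right_endpoint A1 A2 A4 normalized mu0 level_cvgy).
by apply: filterS level_bounds => n [].
Qed.

Let near_pos_level : \forall n \near \oo, [/\ (1 < N n)%N, 0 < bN n, 0 < aN n & 0 < psiN n].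
Proof. exact: (level_cvgy (near_pos right_endpoint A1 A4)). Qed.

Lemma rho_hat_rate : cvg_in_prob P (fun n w =>
  b (tau n) * (rho_hat Xs Ys n (k n) w - rho) / a (b (tau n))) 0.
Proof.
apply: cvg_whp_in_prob => [n|].
  apply: measurable_funM => //; apply: measurable_funM => //.
  by apply: measurable_funB => //; exact: measurable_rho_hat.
have cb : b (tau n) / bN n @[n --> \oo] --> (1 : R).
  apply: (b_level_cvg right_endpoint A1 A2 A4 normalized level_cvgy).
  by apply: filterS level_bounds => n [].
have : slope p.1 p.2 * (b (tau p.1) / bN p.1) * (a (b (tau p.1)) / aN p.1)^-1
    @[p --> whp P] --> (0 * 1 * 1 : R).
  apply: cvgM; last exact: (whp_cvg_fst P ratio_a).
  by apply: cvgM; [exact: slope_cvg|exact: (whp_cvg_fst P cb)].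
rewrite !mul0r; apply: cvg_trans; apply: near_eq_cvg.
refine (whp_imply (whp_fst P near_pos_level) _) => n w /= [_ b0 a0 _].
rewrite /slope invf_div; move: (a (b (tau n)))^-1 => v.
by field; rewrite !gt_eqF.
Qed.

Lemma a_check_rate : cvg_in_prob P (fun n w =>
  a_check Xs Ys n (k n) w / a (b (tau n))) 1.
Proof.
apply: cvg_whp_in_prob => [n|].
  by apply: measurable_funM => //; exact: measurable_a_check.
have : a_check Xs Ys p.1 (k p.1) p.2 / aN p.1 * (a (b (tau p.1)) / aN p.1)^-1
    @[p --> whp P] --> (1 * 1 : R).
  by apply: cvgM; [exact: a_check_cvg|exact: (whp_cvg_fst P ratio_a)].
rewrite mulr1; apply: cvg_trans; apply: near_eq_cvg.
refine (whp_imply (whp_fst P near_pos_level) _) => n w /= [_ b0 a0 _].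
rewrite invf_div; move: (a (b (tau n)))^-1 => v.
by field; rewrite !gt_eqF.
Qed.

Lemma Psi_check_consistent y : cvg_in_prob P (fun n w => Psi_check Xs Ys n (k n) y w) (Psi y).
Proof.
apply: cvg_whp_in_prob => [n|]; first exact: measurable_Psi_check.
exact: Psi_check_cvg.
Qed.

Lemma rho_hat_consistent : a x / x @[x --> +oo] --> (0 : R) ->
  cvg_in_prob P (fun n w => rho_hat Xs Ys n (k n) w) rho.
Proof.
move=> ax0; apply: cvg_whp_in_prob => [n|]; first exact: measurable_rho_hat.
have bn : b n%:R @[n --> \oo] --> +oo.
  exact: (cvg_comp _ _ cvgr_idn (b_cvgy right_endpoint A1 A4)).
have ab : aN n / bN n @[n --> \oo] --> (0 : R).
  exact: (cvg_comp _ _ level_cvgy (cvg_comp _ _ bn ax0)).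
have : rho + slope p.1 p.2 * (aN p.1 / bN p.1) @[p --> whp P] --> rho + 0 * 0.
  apply: cvgD; first exact: cvg_cst.
  by apply: cvgM; [exact: slope_cvg|exact: (whp_cvg_fst P ab)].
rewrite mulr0 addr0; apply: cvg_trans; apply: near_eq_cvg.
refine (whp_imply (whp_fst P near_pos_level) _) => n w /= [_ b0 a0 _].
by rewrite /slope; field; rewrite !gt_eqF.
Qed.

End intermediate_sample.

Unset Implicit Arguments.

Theorem theorem13 (d : measure_display) (T : measurableType d) (R : realType)
    (P : probability T R) (X Y : {RV P >-> R})
    (Xs Ys : nat -> {RV P >-> R})
    (gamma : R) (a b m psi : R -> R)
    (nu : {measure set (\bar R * \bar R) -> \bar R})
    (rho : R) (Psi : cumulativeBounded (0:R) (1:R))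
    (iid : iid_copies X Y Xs Ys)
    (gamma_ge0 : 0 <= gamma)
    (right_endpoint : gamma = 0 -> infinite_right_endpoint X)
    (A1 : assumption1 X Y gamma a b m psi nu)
    (A2 : assumption2 X Y gamma a b m psi nu 1 2)
    (A4 : assumption4 gamma m psi nu rho Psi)
    (normalization :
      (\int[lebesgue_stieltjes_measure Psi]_y (y ^+ 2)%:E)%E = 1%E)
    (mu0 : cross_moment nu = 0%E)
    (k : nat -> nat) (k_intermediate : intermediate R k) :
  [/\ cvg_in_prob P (fun n w =>
        b (n%:R / (k n)%:R) * (rho_hat Xs Ys n (k n) w - rho)
        / a (b (n%:R / (k n)%:R))) 0,
      cvg_in_prob P (fun n w =>
        a_check Xs Ys n (k n) w / a (b (n%:R / (k n)%:R))) 1,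
      (forall z : R, cvg_in_prob P (fun n w =>
        Psi_check Xs Ys n (k n) z w) (Psi z))
    & a x / x @[x --> +oo] --> (0 : R) ->
      cvg_in_prob P (fun n w => rho_hat Xs Ys n (k n) w) rho].
Proof.
split.
- exact: (rho_hat_rate iid right_endpoint A1 A2 A4 normalization mu0 k_intermediate).
- exact: (a_check_rate iid right_endpoint A1 A2 A4 normalization mu0 k_intermediate).
- exact: (Psi_check_consistent iid right_endpoint A1 A2 A4 normalization mu0 k_intermediate).
- exact: (rho_hat_consistent iid right_endpoint A1 A2 A4 normalization mu0 k_intermediate).
Qed.
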